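(* Let $C=V(f)\subset\mathbb{P}^2$ be a conic-line arrangement of degree $d\ge 5$ over $\mathbb{C}$. Then $\tau(C)=(d-1)(d-2)+1$ if and only if $C$ is one of the following: \begin{itemize} \item ($\mathcal{L}$) a line arrangement consisting of $d-1$ concurrent lines and a general line, i.e. one further line not passing through the common point of the $d-1$ lines; \item ($\mathcal{C}_1$) a union of conics belonging to a hyperosculating pencil; \item ($\mathcal{C}\mathcal{L}_1$) a union of conics belonging to a hyperosculating pencil, together with their common tangent line at the hyperosculating point; \item ($\mathcal{C}\mathcal{L}_2$) a union of conics belonging to a bitangent pencil, together with the common tangent line at one of the two bitangency points; \item ($\mathcal{C}\mathcal{L}_3$) a union of conics belonging to a bitangent pencil, together with the two common tangent lines at the two bitangency points; \item ($\mathcal{C}\mathcal{L}_4$) a union of conics belonging to a bitangent pencil, together with the common tangent line at one of the two bitangency points and the line joining the two bitangency points; \item ($\mathcal{C}\mathcal{L}_5$) a union of conics belonging to a bitangent pencil, together with the two common tangent lines at the two bitangency points and the line joining the two bitangency points. \end{itemize}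
   Context: Work over $\mathbb{C}$ with $R=\mathbb{C}[x,y,z]$ and $\mathbb{P}^2=\mathrm{Proj}(R)$. A conic-line arrangement is a reduced plane curve $C=V(f)$ ($f\in R_d$ homogeneous of degree $d$) all of whose irreducible components are lines or smooth conics (arrangements of only lines or only conics are allowed). The Jacobian ideal of $f$ is $J_f=(\partial_x f,\partial_y f,\partial_z f)\subset R$. The global (total) Tjurina number $\tau(C)$ is the degree of the zero-dimensional scheme defined by $J_f$; equivalently $\tau(C)=\sum_{p\in \mathrm{Sing}(C)}\tau_p(C)$, where, if $g=0$ is a local affine equation of $C$ with $p$ translated to the origin, $\tau_p(C)=\dim_{\mathbb{C}}\mathbb{C}\{x,y\}/\langle \partial_xg,\partial_yg,g\rangle$. A hyperosculating pencil is a pencil of conics whose general member is smooth and whose base locus is supported at a single point $p$, the hyperosculating point (so any two distinct smooth members meet only at $p$, with intersection multiplicity $4$). In suitable coordinates the smooth conics used are $x^2+a(xz+y^2)=0$ with $a\neq 0$, the point is $p=(0:0:1)$, and the common tangent line at $p$ is $x=0$. A bitangent pencil is a pencil of conics whose general member is smooth and such that any two distinct smooth members meet exactly at two fixed points $p,q$ (the bitangency points), being tangent with intersection multiplicity $2$ at each. In suitable coordinates the smooth conics used are $xz+ay^2=0$ with $a\ne0$, $p=(0:0:1)$, $q=(1:0:0)$; the common tangent lines at $p$ and $q$ are $x=0$ and $z=0$ respectively, and the line joining $p$ and $q$ is $y=0$. ''A union of conics belonging to a pencil'' means a union of $m\ge 1$ distinct smooth conics of that pencil, with $m$ determined by the degree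 $d$ of $C$. *)

(* Defs.v *)
From mathcomp Require Import all_boot all_order all_algebra.
From mathcomp Require Import reals complex.
From mathcomp Require Import mpoly.

Set Implicit Arguments.
Unset Strict Implicit.
Unset Printing Implicit Defensive.

Import GRing.Theory.
Local Open Scope ring_scope.

Section Algebra.
Variable K : fieldType.

(* dim_K (U / (U :&: W)) = n, for linear subspaces U and W of V. *)
Definition quotient_dim (V : lmodType K) (U W : V -> Prop) (n : nat) : Prop :=
  exists phi : {linear V -> 'rV[K]_n},
    (forall y, exists2 u, U u & phi u = y) /\
    (forall u, U u -> (phi u = 0 <-> W u)).

Definition in_ideal (A : comNzRingType) (gs : seq A) (a : A) : Prop :=
  exists c : 'I_(size gs) -> A, a = \sum_(i < size gs) c i * gs`_i.

Definition divides (A : comNzRingType) (g f : A) : Prop :=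
  exists h, f = h * g.

Definition irreducible_elt (A : comUnitRingType) (g : A) : Prop :=
  [/\ g != 0, g \isn't a GRing.unit &
    forall a b, g = a * b -> a \is a GRing.unit \/ b \is a GRing.unit].

Definition squarefree (A : comUnitRingType) (f : A) : Prop :=
  forall g, divides (g ^+ 2) f -> g \is a GRing.unit.

(* Equality of the points of P^2 with homogeneous coordinates u and v, and
   equality of the reduced curves with equations u and v. *)
Definition same_proj (V : lmodType K) (u v : V) : Prop :=
  exists2 c : K, c != 0 & u = c *: v.

Definition pairwise_distinct (V : lmodType K) (s : seq V) : Prop :=
  forall i j, (i < j < size s)%N -> ~ same_proj s`_i s`_j.

End Algebra.

Section PlaneCurves.
Variable K : fieldType.
Local Notation poly3 := {mpoly K[3]}.
Local Notation vec3 := 'rV[K]_3.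

Definition ev (g : poly3) (p : vec3) : K := g.@[p ord0].

Definition is_line (l : poly3) : Prop := l != 0 /\ l \is 1.-homog.

Definition smooth_curve (g : poly3) : Prop :=
  forall p, p != 0 -> ev g p = 0 -> exists i, ev g^`M(i) p != 0.

(* A zero form is not smooth, so smooth conics are nonzero. *)
Definition smooth_conic (g : poly3) : Prop :=
  g \is 2.-homog /\ smooth_curve g.

Definition conic_line_arrangement (d : nat) (f : poly3) : Prop :=
  [/\ f != 0, f \is d.-homog, squarefree f &
    forall g, irreducible_elt g -> divides g f -> is_line g \/ smooth_conic g].

Definition jacobian_ideal (f : poly3) : poly3 -> Prop :=
  in_ideal [seq f^`M(i) | i <- enum 'I_3].

(* dim_K (R/J)_k = n *)
Definition hilbert_function (J : poly3 -> Prop) (k n : nat) : Prop :=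
  quotient_dim (fun a : poly3 => a \is k.-homog) J n.

(* The degree of the zero-dimensional (or empty) subscheme of P^2 defined by
   the Jacobian ideal is its constant Hilbert polynomial, that is the value
   of dim (R/J_f)_k for all large k. *)
Definition total_tjurina (f : poly3) (n : nat) : Prop :=
  exists k0, forall k, (k0 <= k)%N ->
    hilbert_function (jacobian_ideal f) k n.

(* Contraction to K[x,y,z] of the ideal generated by gs in the local ring of
   affine 3-space at the vector p. *)
Definition in_local_ideal (gs : seq poly3) (p : vec3) (a : poly3) : Prop :=
  exists2 u : poly3, ev u p != 0 & in_ideal gs (u * a).

(* Intersection multiplicity dim O_{P^2,p}/(g,h) at the point p of P^2.  For a
   linear form l with l(p) = 1, the plane l = 1 of affine 3-space is an affine
   chart of P^2 around p, so that this is the local ring of 3-space at the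
   vector p modulo (g, h, l - 1).  When this quotient has finite dimension,
   K[x,y,z] surjects onto it, with kernel the contracted ideal. *)
Definition intersection_mult (g h : poly3) (p : vec3) (n : nat) : Prop :=
  exists l : poly3, [/\ l \is 1.-homog, ev l p = 1 &
    quotient_dim (fun _ => True) (in_local_ideal [:: g; h; l - 1] p) n].

(* Equation of the tangent line at a smooth point p of V(g). *)
Definition tangent_form (g : poly3) (p : vec3) : poly3 :=
  \sum_(i < 3) ev g^`M(i) p *: 'X_i.

(* A pencil of conics is given by a basis q of the corresponding
   two-dimensional linear system. *)
Definition member (q : 'I_2 -> poly3) (v : 'rV[K]_2) : poly3 :=
  \sum_(i < 2) v ord0 i *: q i.

Definition is_pencil (q : 'I_2 -> poly3) : Prop :=
  (forall i, q i \is 2.-homog) /\ (forall v, member q v = 0 -> v = 0).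

Definition smooth_member (q : 'I_2 -> poly3) (g : poly3) : Prop :=
  smooth_conic g /\ exists v, g = member q v.

(* Smoothness holds on a nonempty Zariski open set of parameters. *)
Definition general_member_smooth (q : 'I_2 -> poly3) : Prop :=
  exists2 D : {mpoly K[2]}, D != 0 &
    forall v : 'rV[K]_2, D.@[v ord0] != 0 -> smooth_conic (member q v).

Definition hyperosculating_pencil (q : 'I_2 -> poly3) (p : vec3) : Prop :=
  [/\ is_pencil q, general_member_smooth q, p != 0 &
    forall v, v != 0 -> ((forall i, ev (q i) v = 0) <-> same_proj v p)].

Definition simply_tangent_at (g h : poly3) (p : vec3) : Prop :=
  same_proj (tangent_form g p) (tangent_form h p) /\ intersection_mult g h p 2.

Definition bitangent_pencil (q : 'I_2 -> poly3) (p p' : vec3) : Prop :=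
  [/\ is_pencil q, general_member_smooth q,
      [/\ p != 0, p' != 0 & ~ same_proj p p'] &
    forall g h, smooth_member q g -> smooth_member q h -> ~ same_proj g h ->
      [/\ forall v, v != 0 ->
            (ev g v = 0 /\ ev h v = 0 <-> same_proj v p \/ same_proj v p'),
          simply_tangent_at g h p & simply_tangent_at g h p']].

Definition common_tangent (q : 'I_2 -> poly3) (p : vec3) (l : poly3) : Prop :=
  is_line l /\ forall g, smooth_member q g -> same_proj l (tangent_form g p).

Definition joining_line (p p' : vec3) (l : poly3) : Prop :=
  [/\ is_line l, ev l p = 0 & ev l p' = 0].

Definition conics_of_pencil (q : 'I_2 -> poly3) (gs : seq poly3) : Prop :=
  [/\ (0 < size gs)%N, forall g, g \in gs -> smooth_member q g &
      pairwise_distinct gs].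

(* V(f) is the reduced curve with components V(g), for g in gs. *)
Definition curve_union (f : poly3) (gs : seq poly3) : Prop :=
  same_proj f (\prod_(g <- gs) g).

Definition type_L (d : nat) (f : poly3) : Prop :=
  exists (ls : seq poly3) (l0 : poly3) (p : vec3),
    [/\ size ls = d.-1, forall l, l \in ls -> is_line l, pairwise_distinct ls &
     [/\ p != 0, forall l, l \in ls -> ev l p = 0, is_line l0, ev l0 p != 0 &
         curve_union f (l0 :: ls)]].

Definition type_C1 (f : poly3) : Prop :=
  exists q p gs, [/\ hyperosculating_pencil q p, conics_of_pencil q gs &
    curve_union f gs].

Definition type_CL1 (f : poly3) : Prop :=
  exists q p gs l, [/\ hyperosculating_pencil q p, conics_of_pencil q gs,
    common_tangent q p l & curve_union f (l :: gs)].

Definition type_CL2 (f : poly3) : Prop :=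
  exists q p p' gs l, [/\ bitangent_pencil q p p', conics_of_pencil q gs,
    common_tangent q p l & curve_union f (l :: gs)].

Definition type_CL3 (f : poly3) : Prop :=
  exists q p p' gs l l', [/\ bitangent_pencil q p p', conics_of_pencil q gs,
    common_tangent q p l, common_tangent q p' l' &
    curve_union f [:: l, l' & gs]].

Definition type_CL4 (f : poly3) : Prop :=
  exists q p p' gs l m, [/\ bitangent_pencil q p p', conics_of_pencil q gs,
    common_tangent q p l, joining_line p p' m &
    curve_union f [:: l, m & gs]].

Definition type_CL5 (f : poly3) : Prop :=
  exists q p p' gs l l' m,
    [/\ bitangent_pencil q p p', conics_of_pencil q gs &
     [/\ common_tangent q p l, common_tangent q p' l', joining_line p p' m &
         curve_union f [:: l, l', m & gs]]].

End PlaneCurves.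

(* Main.v *)
Require Import Defs.
From HB Require Import structures.
From mathcomp Require Import all_boot all_order all_algebra.
From mathcomp Require Import separable closed_field.
From mathcomp Require Import boolp mpoly ring zify.

Set Implicit Arguments.
Unset Strict Implicit.
Unset Printing Implicit Defensive.
Import Order.TTheory GRing.Theory Num.Theory.
Local Open Scope ring_scope.

(** Let e = d - 1 and let AR_m be the space of triples of forms of degree m that annihilate the
    gradient of f. Counting dimensions in the exact sequence
    0 -> AR_m -> (R_m)^3 -> R_(m+e) -> (R/J)_(m+e) -> 0,
    the equality tau = e (e - 1) + 1 means that for large m the dimension of AR_m is
    C(m+1, 2) + C(m+3-e, 2) ([tjurinaP]), the dimension of a free module on generators of degrees 1
    and e - 1.

    For every m this number bounds dim AR_m from above, as soon as there is a good line: one that is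
    transverse to the curve and along which no constant vector field annihilates the gradient.
    Restriction to such a line has kernel AR_(m-1), and its image consists of syzygies of three
    univariate polynomials without common zero, which are controlled by one of minimal degree
    ([dim_syz_step]). The growth from degree m - 1 to m is thereby bounded, so a deficit in one degree
    persists in all later degrees. Good lines exist unless the curve is a set of concurrent lines
    ([good_line_exists], [arrangement_rigid]); concurrent lines have a constant syzygy, which makes AR_m
    too large ([not_tjurina_of_const]).

    Two independent syzygies of degrees 1 and e - 1 attain the bound ([tjurina_of_syz]); they are
    written down for each curve of the list. For all types that contain a line moved by a diagonal field,
    the second syzygy is the Hamiltonian field of the residual curve along that line
    ([tjurina_eigen]); the hyperosculating types need explicit formulas ([osculating_types_tjurina]).

    Conversely, if the bound is attained for large m, it is attained for m = 1 and m = e - 1. The first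
    gives a linear vector field that kills f, and the second forces its zeros to lie on the curve
    ([linear_syz_of_tjurina]). The field preserves each component ([component_eigen]). If all components
    are lines, a matter of eigenvectors leaves one general line and a pencil of lines
    ([lines_type_L]). If there is a conic, the field minus a multiple of the Euler field is an
    infinitesimal rotation of it, so in suitable coordinates a multiple of X d/dX - Z d/dZ or of
    X d/dY - 2 Y d/dZ ([skew_normal_form]). The invariant smooth conics are then a XZ + b Y^2, respectively
    a X^2 + b (XZ + Y^2), and the invariant lines are X, Y, Z, respectively X. This is the list, apart
    from diagonal fields with neither X nor Z on the curve; those vanish at (0 : 1 : 0), off the curve. *)

(** * Restriction of polynomials to parametrized curves *)

(** Separates the monomials of bounded degree under the substitution of t^(N^i) for the i-th
    variable. *)
Lemma eq_digits n N (m m' : 'I_n -> nat) :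
  (forall i, (m i < N)%N) -> (forall i, (m' i < N)%N) ->
  (\sum_i m i * N ^ i = \sum_i m' i * N ^ i)%N -> m =1 m'.
Proof.
elim: n m m' => [|n IH] m m' lm lm' E; first by case.
have split_low (k : 'I_n.+1 -> nat) : (\sum_i k i * N ^ i =
    k ord0 + N * \sum_(i < n) k (lift ord0 i) * N ^ i)%N.
  rewrite big_ord_recl expn0 muln1 big_distrr /=; congr (_ + _)%N.
  by apply: eq_bigr => i _; rewrite /bump /= add1n expnS; ring.
move: E; rewrite !split_low => E.
have E0 : m ord0 = m' ord0.
  have := congr1 (modn^~ N) E.
  have modE x y : (x < N)%N -> ((x + N * y) %% N)%N = x.
    by move=> xN; rewrite addnC mulnC modnMDl modn_small.
  by rewrite (modE _ _ (lm _)) (modE _ _ (lm' _)).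
have Npos : (0 < N)%N by apply: leq_ltn_trans (lm ord0).
have E1 : (\sum_(i < n) m (lift ord0 i) * N ^ i =
           \sum_(i < n) m' (lift ord0 i) * N ^ i)%N.
  by move: E; rewrite E0 => /addnI /eqP; rewrite eqn_pmul2l // => /eqP.
have Elift := IH _ _ (fun i => lm (lift ord0 i)) (fun i => lm' (lift ord0 i)) E1.
by move=> i; case: (unliftP ord0 i) => [j ->|-> //]; apply: Elift.
Qed.

Section Restriction.
Variables (K : fieldType) (n : nat).
Implicit Types (g : 'rV[{poly K}]_n) (p q : {mpoly K[n]}).

(** Substitution of polynomials in one variable: restriction to the curve parametrized by g. *)
Definition restr g p : {poly K} := mmap (@polyC K) (g ord0) p.

HB.instance Definition _ g := GRing.RMorphism.copy (restr g)
  (@mmap n K {poly K} (@polyC K) (g ord0)).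

Lemma restrZ g c p : restr g (c *: p) = c *: restr g p.
Proof. by rewrite /restr mmapZ mul_polyC. Qed.

Lemma restrX g i : restr g 'X_i = g ord0 i.
Proof. by rewrite /restr mmapX mmap1U. Qed.

Lemma restrC g c : restr g c%:MP = c%:P.
Proof. by rewrite /restr mmapC. Qed.

Lemma restrE g p :
  restr g p = \sum_(m <- msupp p) p@_m *: \prod_i g ord0 i ^+ m i.
Proof.
rewrite /restr /mmap /=; apply: eq_bigr => m _.
by rewrite -mul_polyC.
Qed.

Definition ev_path g (t : K) : 'rV[K]_n := map_mx (horner^~ t) g.

Lemma horner_restr g p t : (restr g p).[t] = p.@[ev_path g t ord0].
Proof.
rewrite restrE mevalE horner_sum; apply: eq_bigr => m _.
rewrite hornerZ horner_prod; congr (_ * _); apply: eq_bigr => i _.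
by rewrite horner_exp /ev_path mxE.
Qed.

Lemma deriv_restr g p :
  (restr g p)^`() = \sum_i (g ord0 i)^`() * restr g p^`M(i).
Proof.
elim/mpolyind: p => [|c m p _ _ IH].
  by rewrite rmorph0 deriv0 big1 // => i _; rewrite mderiv0 rmorph0 mulr0.
rewrite rmorphD derivD {}IH.
under [RHS]eq_bigr => i _ do rewrite linearD rmorphD mulrDr.
rewrite big_split /=; congr (_ + _).
rewrite restrZ derivZ.
under eq_bigr => i _ do rewrite linearZ /= restrZ -scalerAr.
rewrite -scaler_sumr; congr (_ *: _).
elim: {m}(mdeg m) {-2}m (erefl (mdeg m)) => [|k IH] m mk.
  move/eqP: mk; rewrite mdeg_eq0 => /eqP ->.
  rewrite mpolyX0 rmorph1 derivC big1 // => i _.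
  by rewrite -mpolyC1 mderivC rmorph0 mulr0.
have [i mi] : exists i, m i != 0%N.
  apply/existsP; apply: contraPT mk; rewrite negb_exists => /forallP mi0.
  by rewrite mdegE big1 // => i _; have := mi0 i; rewrite negbK => /eqP.
have [m' def_m] : exists m', m = (U_(i) + m')%MM.
  by exists (m - U_(i))%MM; rewrite addmC submK // lep1mP.
have m'k : mdeg m' = k by apply: succn_inj; rewrite -mk def_m mdegD mdeg1 add1n.
rewrite def_m mpolyXD rmorphM /= restrX derivM IH //.
under [RHS]eq_bigr => j _ do
  rewrite mderivM rmorphD !rmorphM /= restrX mulrDr.
rewrite big_split /=; congr (_ + _); last first.
  by rewrite big_distrr; apply: eq_bigr => j _ /=; ring.
rewrite (bigD1 i) //= big1 ?addr0 => [|j ji].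
  rewrite mderivX mnm1E eqxx -{1}[U_(i)%MM]add0m addmK mpolyX0 scale1r.
  by rewrite rmorph1 mul1r.
by rewrite mderivX mnm1E eq_sym (negbTE ji) scale0r rmorph0 mul0r mulr0.
Qed.

End Restriction.

Section Identity.
Variable K : numFieldType.
Lemma poly_eval0 (p : {poly K}) : (forall t, p.[t] = 0) -> p = 0.
Proof.
move=> p0; apply/eqP; apply: contraT => /max_poly_roots mr.
have := mr [seq i%:R | i <- iota 0 (size p)].
rewrite map_inj_uniq ?iota_uniq; last by move=> i j /eqP; rewrite eqr_nat => /eqP.
by rewrite size_map size_iota ltnn => -> //; apply/allP => x _; apply/rootP.
Qed.

(** Kronecker substitution: sending the i-th variable to t^(N^i) with N large is injective on the
    monomials of p and reduces the claim to one variable. *)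
Lemma mpoly_eval0 n (p : {mpoly K[n]}) :
  (forall v : 'rV[K]_n, p.@[v ord0] = 0) -> p = 0.
Proof.
move=> p0; pose N := (msize p).+1.
pose g : 'rV[{poly K}]_n := \row_i 'X^(N ^ i).
have gp0 : restr g p = 0 by apply: poly_eval0 => t; rewrite horner_restr.
have coords_lt m : m \in msupp p -> forall i, (m i < N)%N.
  move=> mp i; apply: (@leq_ltn_trans (mdeg m)).
    by rewrite mdegE (bigD1 i) //= leq_addr.
  exact: leqW (msize_mdeg_lt mp).
apply/mpolyP => m0; rewrite mcoeff0; apply: contraTeq isT => nz.
have m0p : m0 \in msupp p by rewrite mcoeff_msupp.
have coefE m : (\prod_i g ord0 i ^+ m i)`_(\sum_i m0 i * N ^ i) =
    ((\sum_i m0 i * N ^ i)%N == (\sum_i m i * N ^ i)%N)%:R :> K.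
  under eq_bigr => i _ do rewrite mxE -exprM mulnC.
  by rewrite -expr_sum coefXn.
have := congr1 (fun q : {poly K} => q`_(\sum_i m0 i * N ^ i)) gp0.
rewrite coef0 restrE coef_sum (bigD1_seq m0) ?msupp_uniq //= coefZ coefE eqxx mulr1.
suff -> : \sum_(i <- msupp p | i != m0)
    (p@_i *: \prod_k g ord0 k ^+ i k)`_(\sum_k m0 k * N ^ k) = 0.
  by move=> /eqP; rewrite addr0 (negbTE nz).
rewrite big_seq_cond; apply: big1 => m /andP [mp mm0].
rewrite coefZ coefE; case: eqP => [E|_]; last by rewrite mulr0.
case/eqP: mm0; apply/mnmP; exact: (eq_digits (coords_lt _ mp) (coords_lt _ m0p) (esym E)).
Qed.

End Identity.

(** * Homogeneous forms and hyperplanes *)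

Section Homogeneous.
Variables (K : fieldType) (n : nat).
Implicit Types (p q g : {mpoly K[n]}).

(** Induction along the generation of the polynomial ring as an algebra. *)
Lemma mpoly_alg_ind (P : {mpoly K[n]} -> Prop) :
  (forall c, P c%:MP) -> (forall i, P 'X_i) ->
  (forall p q, P p -> P q -> P (p + q)) ->
  (forall p q, P p -> P q -> P (p * q)) -> forall p, P p.
Proof.
move=> PC PX PD PM p; elim/mpolyind: p => [|c m p _ _ IH].
  by rewrite -mpolyC0; apply: PC.
apply: PD IH; rewrite -mul_mpolyC; apply: (PM) (PC c) _.
rewrite mpolyXE_id; apply: (big_ind P) => [||i _].
- by rewrite -mpolyC1; apply: PC.
- exact: PM.
elim: (m i) => [|k IHk]; first by rewrite expr0 -mpolyC1; apply: PC.
by rewrite exprS; apply: PM (PX i) IHk.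
Qed.

Lemma mdeg_homog d p m : p \is d.-homog -> m \in msupp p -> mdeg m = d.
Proof. by move=> /dhomogP hp; apply: hp. Qed.

Lemma homog0E p : p \is 0.-homog -> p = (p@_0%MM)%:MP.
Proof.
move=> hp; apply: msize1_polyC; rewrite msizeE; apply/bigmax_leqP_seq => m mp _.
by rewrite (mdeg_homog hp mp).
Qed.

Lemma mderiv_homog d p i : p \is d.+1.-homog -> p^`M(i) \is d.-homog.
Proof.
move=> /dhomogP hp; apply/dhomogP => m; rewrite mcoeff_msupp mcoeff_deriv => nz.
have : (m + U_(i))%MM \in msupp p.
  by rewrite mcoeff_msupp; apply: contraNneq nz => ->; rewrite mul0rn.
by move/hp; rewrite /= mdegD mdeg1 addn1 => -[].
Qed.

Lemma euler d p : p \is d.-homog -> \sum_i 'X_i * p^`M(i) = d%:R *: p.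
Proof.
move=> hp; rewrite [in RHS](mpolyE p) scaler_sumr.
have dE i : p^`M(i) = \sum_(m <- msupp p) (p@_m *: 'X_[m])^`M(i).
  by rewrite {1}(mpolyE p) linear_sum.
under eq_bigr => i _ do rewrite dE mulr_sumr.
rewrite exchange_big /= big_seq [RHS]big_seq; apply: eq_bigr => m mp.
under eq_bigr => i _ do rewrite linearZ /= mderivX -!scalerAr.
transitivity (\sum_(i < n) (p@_m * (m i)%:R) *: 'X_[m] : {mpoly K[n]}).
  apply: eq_bigr => i _; rewrite scalerA; case mi : (m i == 0)%N.
    by rewrite (eqP mi) mulr0 !scale0r.
  by rewrite -mpolyXD addmC submK // lep1mP mi.
rewrite -scaler_suml -mulr_sumr -natr_sum -mdegE scalerA mulrC.
by rewrite (mdeg_homog hp mp).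
Qed.

Lemma meval_homog d p (c : K) (v : 'rV[K]_n) : p \is d.-homog ->
  p.@[(c *: v) ord0] = c ^+ d * p.@[v ord0].
Proof.
move=> hp; rewrite !mevalE mulr_sumr big_seq [RHS]big_seq.
apply: eq_bigr => m mp; rewrite mulrCA; congr (_ * _).
under eq_bigr => i _ do rewrite mxE exprMn.
by rewrite big_split /= -expr_sum -mdegE (mdeg_homog hp mp).
Qed.

Lemma pihomogMr e k p g : g \is e.-homog ->
  pihomog mdeg (k + e) (p * g) = pihomog mdeg k p * g.
Proof.
move=> hg; elim/mpolyind: p => [|c m p _ _ IH].
  by rewrite !(mul0r, linear0).
rewrite mulrDl !linearD /= IH mulrDl; congr (_ + _).
rewrite -scalerAl !linearZ /= -scalerAl; congr (_ *: _).
have hm : 'X_[m] * g \is (mdeg m + e).-homog by rewrite dhomogM // dhomogX.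
rewrite pihomogX /=; case: eqP => [<-|/eqP ne]; first exact: pihomog_dE.
by rewrite mul0r; apply: pihomog_ne0 hm; rewrite eqn_add2r.
Qed.

Lemma homog_div d e p q g : p \is (d + e).-homog -> g \is e.-homog ->
  g != 0 -> p = q * g -> q \is d.-homog.
Proof.
move=> hp hg g0 E; have := pihomogMr d q hg; rewrite -E pihomog_dE // E.
by move=> /(mulIf g0) ->; apply: pihomogP.
Qed.

Definition affine (a b : 'rV[K]_n) : 'rV[{poly K}]_n :=
  \row_i ((a ord0 i)%:P + b ord0 i *: 'X).

Lemma ev_affine a b t : ev_path (affine a b) t = a + t *: b.
Proof. by apply/rowP => i; rewrite !mxE !hornerE mulrC. Qed.

Lemma size_coef_prod (p q : {poly K}) i j : (size p <= i.+1)%N -> (size q <= j.+1)%N ->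
  (size (p * q)%R <= (i + j).+1)%N /\ (p * q)`_(i + j) = p`_i * q`_j.
Proof.
move=> si sj; split.
  by apply: leq_trans (size_polyMleq _ _) _; lia.
have lt_i : (i < (i + j).+1)%N by lia.
rewrite coefM (bigD1 (Ordinal lt_i)) //= addKn big1 ?addr0 // => k /eqP ki.
have [ik|ik] := ltnP i k; first by rewrite [p`_k]nth_default ?mul0r // (leq_trans si).
have {}ik : (k < i)%N by rewrite ltn_neqAle ik andbT; apply/eqP => E; apply/ki/val_inj.
by rewrite [X in _ * X]nth_default ?mulr0 // (leq_trans sj) //; lia.
Qed.

(** On the affine line a + t b the coefficient of t^d is the value at the point at infinity b. *)
Lemma restr_affine d p a b : p \is d.-homog ->
  (size (restr (affine a b) p) <= d.+1)%N /\ (restr (affine a b) p)`_d = p.@[b ord0].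
Proof.
move=> hp; rewrite restrE mevalE.
have mon (m : 'X_{1..n}) : (size (\prod_i affine a b ord0 i ^+ m i)%R <= (mdeg m).+1)%N /\
   (\prod_i affine a b ord0 i ^+ m i)`_(mdeg m) = \prod_i b ord0 i ^+ m i.
  rewrite mdegE; elim/big_rec3: _ => [|i x y z _ [sz cz]]; first by rewrite size_poly1 coef1.
  have pw : (size (affine a b ord0 i ^+ m i)%R <= (m i).+1)%N /\
            (affine a b ord0 i ^+ m i)`_(m i) = b ord0 i ^+ m i.
    elim: (m i) => [|k [sk ck]]; first by rewrite !expr0 size_poly1 coef1.
    have s1 : (size (affine a b ord0 i) <= 2)%N.
      rewrite mxE; apply: leq_trans (size_polyD _ _) _; rewrite geq_max.
      rewrite (leq_trans (size_polyC_leq1 _)) //=.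
      by apply: leq_trans (size_scale_leq _ _) _; rewrite size_polyX.
    have [s c] := size_coef_prod s1 sk; rewrite !exprS -[k.+1]/(1 + k)%N; split => //.
    by rewrite c ck mxE coefD coefC coefZ coefX add0r mulr1.
  have [s c] := size_coef_prod pw.1 sz; split => //.
  by rewrite c pw.2 cz.
split.
  apply: leq_trans (size_sum _ _ _) _; rewrite big_seq; elim/big_ind: _ => //.
    by move=> x y sx sy; rewrite geq_max sx.
  move=> m mp; apply: leq_trans (size_scale_leq _ _) _.
  by have := (mon m).1; rewrite (mdeg_homog hp mp).
rewrite coef_sum big_seq [RHS]big_seq; apply: eq_bigr => m mp.
by rewrite coefZ; have := (mon m).2; rewrite (mdeg_homog hp mp) => ->.
Qed.

End Homogeneous.

Lemma nonzero_coord (K : nzRingType) n (v : 'rV[K]_n) : v != 0 -> exists i, v ord0 i != 0.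
Proof.
move=> v0; apply/existsP; apply: contraNT v0; rewrite negb_exists => /forallP z.
by apply/eqP/rowP => i; rewrite [RHS]mxE; apply/eqP; have := z i; rewrite negbK.
Qed.

Section Hyperplane.
Variables (K : numFieldType) (n : nat).
Implicit Types (p q l : {mpoly K[n]}).

Definition lform (c : 'rV[K]_n) : {mpoly K[n]} := \sum_i c ord0 i *: 'X_i.

Lemma lform_homog c : lform c \is 1.-homog.
Proof. by apply: rpred_sum => i _; rewrite rpredZ // dhomogX /= mdeg1. Qed.

Lemma meval_lform c (v : 'rV[K]_n) : (lform c).@[v ord0] = \sum_i c ord0 i * v ord0 i.
Proof.
by rewrite /lform raddf_sum; apply: eq_bigr => i _; rewrite /= mevalZ mevalXU.
Qed.

Lemma lform_eq0 c : (lform c == 0) = (c == 0).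
Proof.
apply/eqP/eqP => [l0|->]; last by rewrite /lform big1 // => i _; rewrite mxE scale0r.
apply/rowP => i; rewrite mxE.
have := meval_lform c (delta_mx 0 i); rewrite l0 meval0 (bigD1 i) //= big1 ?addr0.
  by rewrite mxE !eqxx mulr1.
by move=> j ji; rewrite mxE (negbTE ji) andbF mulr0.
Qed.

Lemma lformE p : p \is 1.-homog -> p = lform (\row_i p@_U_(i)).
Proof.
move=> hp; apply/mpolyP => m; rewrite raddf_sum /=.
under eq_bigr => i _ do rewrite mxE mcoeffZ mcoeffX.
have [m1|m1] := boolP (mdeg m == 1%N).
  have /mdeg1P [j /eqP ->] := m1; rewrite (bigD1 j) //= eqxx mulr1 big1 ?addr0 // => i ij.
  by rewrite eq_mnm1 (negbTE ij) mulr0.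
rewrite (dhomog_nemf_coeff hp m1) big1 // => i _.
case: eqP => [Em|_]; last by rewrite mulr0.
by rewrite -Em mdeg1 in m1.
Qed.

Lemma subst_congr (h : {mpoly K[n]}) (lq : n.-tuple {mpoly K[n]}) p :
  (forall i, divides h (tnth lq i - 'X_i)) -> divides h (p \mPo lq - p).
Proof.
move=> H; elim/mpoly_alg_ind: p.
- by move=> c; exists 0; rewrite comp_mpolyC subrr mul0r.
- by move=> i; rewrite comp_mpolyX (bigD1 i) //= mnm1E eqxx expr1 big1 ?mulr1 //
    => j /negbTE ji; rewrite mnm1E eq_sym ji.
- move=> p q [u Eu] [w Ew]; exists (u + w); rewrite mulrDl -Eu -Ew rmorphD /=; ring.
move=> p q [u Eu] [w Ew]; exists (u * (q \mPo lq) + p * w).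
by rewrite mulrDl mulrAC -Eu -mulrA -Ew rmorphM /=; ring.
Qed.

(** Projection onto the hyperplane along a coordinate axis replaces each variable by one congruent
    to it modulo the linear form, and the projected polynomial vanishes identically. *)
Lemma vanish_hyperplane c p : c != 0 ->
  (forall v : 'rV[K]_n, (lform c).@[v ord0] = 0 -> p.@[v ord0] = 0) ->
  divides (lform c) p.
Proof.
move=> c0 van; have [i0 ci0] := nonzero_coord c0.
pose lq := [tuple 'X_i - ((i == i0)%:R / c ord0 i0) *: lform c | i < n].
have lqE i : tnth lq i = 'X_i - ((i == i0)%:R / c ord0 i0) *: lform c.
  by rewrite tnth_mktuple.
have [] := @subst_congr (lform c) lq p.
  move=> i; exists (- (((i == i0)%:R / c ord0 i0))%:MP).
  by rewrite lqE mulNr mul_mpolyC; ring.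
move=> q Eq; exists (- q); rewrite mulNr -Eq; suff -> : p \mPo lq = 0 by ring.
apply: mpoly_eval0 => v; rewrite comp_mpoly_meval.
pose w : 'rV[K]_n := \row_i (v ord0 i - (i == i0)%:R / c ord0 i0 * (lform c).@[v ord0]).
rewrite (@meval_eq _ _ _ (w ord0)) => [|i]; last first.
  by rewrite lqE mxE mevalB mevalZ mevalXU.
apply: van; rewrite meval_lform.
under eq_bigr => i _ do rewrite mxE mulrBr.
rewrite sumrB -meval_lform (bigD1 i0) //= eqxx big1 ?addr0.
  by rewrite mul1r mulrA divff // mul1r subrr.
by move=> i /negbTE ->; rewrite !mul0r mulr0.
Qed.

End Hyperplane.

(** * Jacobian syzygies and the Hilbert function of the Jacobian ring *)

Notation o0 := (ord0 : 'I_3).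
Notation o1 := (lift ord0 ord0 : 'I_3).
Notation o2 := (lift ord0 (lift ord0 ord0) : 'I_3).

Lemma sum3 (V : nmodType) (F : 'I_3 -> V) : \sum_i F i = F o0 + F o1 + F o2.
Proof. by rewrite !big_ord_recl big_ord0 addr0 addrA. Qed.

Lemma ord3_ind (P : 'I_3 -> Prop) : P o0 -> P o1 -> P o2 -> forall i, P i.
Proof.
move=> P0 P1 P2 i; case: (unliftP ord0 i) => [j ->|-> //].
case: (unliftP ord0 j) => [k ->|-> //].
by case: (unliftP ord0 k) => [[[]]|->].
Qed.

Lemma in_ideal3 (A : comNzRingType) (u v w a : A) :
  in_ideal [:: u; v; w] a <-> exists c : 'I_3 -> A, a = c o0 * u + c o1 * v + c o2 * w.
Proof.
by split=> -[c ->]; exists c; rewrite sum3.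
Qed.

Lemma jacobian_idealP (K : fieldType) (f a : {mpoly K[3]}) :
  jacobian_ideal f a <-> exists c : 'I_3 -> {mpoly K[3]}, a = \sum_i c i * f^`M(i).
Proof.
rewrite /jacobian_ideal !enum_ordSl (_ : enum 'I_0 = [::]) /=; last first.
  by apply: size0nil; rewrite size_enum_ord.
rewrite in_ideal3.
by split=> -[c ->]; exists c; rewrite sum3.
Qed.

Section DimDrop.
Variables (K : fieldType) (vT : vectType K).

Lemma dim_drop (U : {vspace vT}) (phi : {linear vT -> {poly K}}) N :
  (forall u, u \in U -> (size (phi u) <= N)%N) ->
  exists W : {vspace vT}, [/\ (\dim U <= N + \dim W)%N, (W <= U)%VS &
    forall u, u \in W -> phi u = 0].
Proof.
move=> szphi; pose F : 'Hom(vT, 'rV[K]_N) := linfun (@poly_rV K N \o phi).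
have FE u : F u = poly_rV (phi u) by rewrite lfunE.
exists (U :&: lker F)%VS; split; first last.
- move=> u; rewrite memv_cap memv_ker FE => /andP [uU /eqP Fu].
  by rewrite -(poly_rV_K (szphi u uU)) Fu linear0.
- exact: capvSl.
rewrite -(limg_ker_dim F U) addnC leq_add2r.
by apply: leq_trans (dimvS (subvf _)) _; rewrite dimvf dim_matrix mul1r.
Qed.

Lemma dim_limg_le (rT : vectType K) (F : 'Hom(vT, rT)) (U : {vspace vT}) :
  (\dim (F @: U) <= \dim U)%N.
Proof. by rewrite -(limg_ker_dim F U) leq_addl. Qed.

End DimDrop.

Section Syzygies.
Variables (K : fieldType) (e : nat) (g : 'I_3 -> {mpoly K[3]}).
Hypothesis hg : forall i, g i \is e.-homog.
Local Notation form m := (dhomog 3 K m).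
Local Notation fields m := {ffun 'I_3 -> dhomog 3 K m}.

Lemma dim_form m : \dim {: form m} = 'C(m + 2, 2).
Proof. by rewrite dimvf -[RHS]bin_sub ?addnK // leq_addl. Qed.

Lemma dim_fields m : \dim {: fields m} = (3 * 'C(m + 2, 2))%N.
Proof. by rewrite dimvf /dim /= card_ord -dim_form dimvf mulnC. Qed.

Definition jac_fun m (r : fields m) : form (m + e) :=
  indhomog (m + e) (\sum_i val (r i) * g i).

Lemma val_jac_fun m (r : fields m) : val (jac_fun r) = \sum_i val (r i) * g i.
Proof.
rewrite /jac_fun /indhomog val_insubd ifT //; apply: rpred_sum => i _.
by apply: dhomogM (dhomog_is_dhomog _) (hg i).
Qed.

Lemma jac_fun_linear m : linear (@jac_fun m).
Proof.
move=> c r s; apply: val_inj; rewrite linearP /= !val_jac_fun scaler_sumr -big_split.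
by apply: eq_bigr => i _; rewrite !ffunE /= mulrDl scalerAl.
Qed.

HB.instance Definition _ m := GRing.isLinear.Build K (fields m) (form (m + e)) _
  (@jac_fun m) (@jac_fun_linear m).

Definition jac m : 'Hom(fields m, form (m + e)) := linfun (@jac_fun m).
Definition syz m : {vspace fields m} := lker (jac m).

Lemma syzP m (r : fields m) : reflect (\sum_i val (r i) * g i = 0) (r \in syz m).
Proof.
rewrite memv_ker lfunE /= -val_jac_fun; apply: (iffP eqP) => [-> //|E].
exact: val_inj.
Qed.

Lemma jac_imgP m (a : form (m + e)) :
  reflect (exists c : 'I_3 -> {mpoly K[3]}, val a = \sum_i c i * g i) (a \in limg (jac m)).
Proof.
apply: (iffP memv_imgP) => [[r _ ->]|[c E]].
  by exists (fun i => val (r i)); rewrite lfunE /= val_jac_fun.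
exists [ffun i => indhomog m (pihomog mdeg m (c i))]; first exact: memvf.
apply: val_inj; rewrite lfunE /= val_jac_fun -(pihomog_dE (dhomog_is_dhomog a)) E.
rewrite linear_sum; apply: eq_bigr => i _ /=; rewrite pihomogMr // ffunE.
by rewrite /indhomog val_insubd ifT ?pihomogP.
Qed.

Lemma dim_syz_jac m : (\dim (syz m) + \dim (limg (jac m)) = 3 * 'C(m + 2, 2))%N.
Proof.
by rewrite -dim_fields -(limg_ker_dim (jac m) fullv) capfv.
Qed.

End Syzygies.

Section Hilbert.
Variables (K : fieldType) (e : nat) (f : {mpoly K[3]}).
Hypothesis hf : f \is e.+1.-homog.
Let hg i : f^`M(i) \is e.-homog := mderiv_homog i hf.
Local Notation form m := (dhomog 3 K m).

(** A complement of the image of the Jacobian map, with the projection onto it, realizes the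
    quotient. *)
Lemma dim_quotient m N : hilbert_function (jacobian_ideal f) (m + e) N <->
  (N + \dim (limg (jac e (fun i => f^`M(i)) m)) = 'C(m + e + 2, 2))%N.
Proof.
set I := limg _.
have IP (a : form (m + e)) : a \in I <-> jacobian_ideal f (val a).
  by rewrite jacobian_idealP; split=> /(jac_imgP hg).
split=> [[phi [surj ker]]|dimN].
  pose F : 'Hom(form (m + e), 'rV[K]_N) :=
    linfun (phi \o (@mpoly_of_dhomog 3 K (m + e))).
  have FE a : F a = phi (val a) by rewrite lfunE.
  have kerF : lker F = I.
    apply/vspaceP => a; rewrite memv_ker FE; apply/eqP/idP => [E|aI].
      by apply/IP; apply/ker => //; apply: dhomog_is_dhomog.
    by apply/ker; [apply: dhomog_is_dhomog | apply/IP].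
  have imgF : limg F = fullv.
    apply/vspaceP => y; rewrite memvf; apply/memv_imgP.
    have [u hu <-] := surj y; exists (DHomog hu); first exact: memvf.
    by rewrite FE.
  have := limg_ker_dim F fullv; rewrite capfv kerF imgF dimvf dim_matrix mul1r.
  by rewrite dim_form addnC.
pose C := (I^C)%VS.
have dimC : \dim C = N.
  by rewrite dimv_compl dim_form -dimN addnK.
pose B := vbasis C.
pose rest a := a - projv I a.
have restP c a b : rest (c *: a + b) = c *: rest a + rest b.
  by rewrite /rest linearP scalerBr opprD addrACA.
pose psi (a : form (m + e)) : 'rV[K]_N :=
  \row_(i < N) coord B (cast_ord (esym dimC) i) (rest a).
have psi_lin : linear psi.
  by move=> c a b; apply/rowP => i; rewrite !mxE restP linearP.
pose Psi := GRing.isLinear.Build K _ _ _ psi psi_lin.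
pose psiL : {linear form (m + e) -> 'rV[K]_N} := HB.pack psi Psi.
pose th (p : {mpoly K[3]}) : form (m + e) := indhomog (m + e) (pihomog mdeg (m + e) p).
have valth p : val (th p) = pihomog mdeg (m + e) p.
  by rewrite /th /indhomog val_insubd ifT ?pihomogP.
have th_lin : linear th.
  by move=> c p q; apply: val_inj; rewrite linearP /= !valth linearP.
pose Th := GRing.isLinear.Build K _ _ _ th th_lin.
pose thL : {linear {mpoly K[3]} -> form (m + e)} := HB.pack th Th.
exists (psiL \o thL); split.
  move=> y; pose a := \sum_(i < \dim C) y ord0 (cast_ord dimC i) *: B`_i.
  have aC : a \in C.
    by apply: rpred_sum => i _; rewrite rpredZ // vbasis_mem // mem_nth // size_tuple.
  exists (val a); first exact: dhomog_is_dhomog.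
  transitivity (psi a).
    rewrite /=; congr psi; apply: val_inj; rewrite valth; apply: pihomog_dE.
    exact: dhomog_is_dhomog.
  apply/rowP => i; have pa0 : projv I a == 0 by rewrite -memv_ker lker_proj.
  rewrite mxE /rest (eqP pa0) subr0 coord_sum_free.
    by congr (y _ _); apply: val_inj.
  exact: basis_free (vbasisP C).
move=> u hu; rewrite [X in X = 0](_ : _ = psi (DHomog hu)); last first.
  by rewrite /=; congr psi; apply: val_inj; rewrite valth /=; apply: pihomog_dE.
rewrite -[u]/(val (DHomog hu)) -IP; set a := DHomog hu.
have -> : a \in I = (a - projv I a == 0).
  rewrite subr_eq0; apply/idP/eqP => [aI|->]; last exact: memv_proj.
  by rewrite projv_id.
split=> [E|/eqP E]; last by apply/rowP => i; rewrite !mxE /rest E linear0.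
apply/eqP; rewrite (coord_vbasis (memv_projC I a)) big1 // => i _.
move: E => /rowP /(_ (cast_ord dimC i)); rewrite !mxE.
rewrite (_ : cast_ord _ _ = i); last exact: val_inj.
by move=> ->; rewrite scale0r.
Qed.

End Hilbert.

(** * Syzygies of three univariate polynomials *)

Section Cross.
Variable A : comRingType.
Implicit Types u v w : 'I_3 -> A.

Definition dot u w : A := \sum_i u i * w i.

Definition cross u w (i : 'I_3) : A :=
  match val i with
  | 0%N => u o1 * w o2 - u o2 * w o1
  | 1%N => u o2 * w o0 - u o0 * w o2
  | _ => u o0 * w o1 - u o1 * w o0
  end.

Lemma dot3 u w : dot u w = u o0 * w o0 + u o1 * w o1 + u o2 * w o2.
Proof. exact: sum3. Qed.

(** The identity w x (u x v) = (w.v) u - (w.u) v. *)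
Lemma cross_proportional u v w : dot u w = 0 -> dot v w = 0 ->
  forall i j, w i * cross u v j = w j * cross u v i.
Proof.
rewrite !dot3 => uw vw i j; apply/eqP; rewrite -subr_eq0; apply/eqP.
have E (k : A) : k * (u o0 * w o0 + u o1 * w o1 + u o2 * w o2) = 0 by rewrite uw mulr0.
have F (k : A) : k * (v o0 * w o0 + v o1 * w o1 + v o2 * w o2) = 0 by rewrite vw mulr0.
elim/ord3_ind: i; elim/ord3_ind: j; rewrite /cross /=; try ring.
- by transitivity (u o2 * (v o0 * w o0 + v o1 * w o1 + v o2 * w o2)
    - v o2 * (u o0 * w o0 + u o1 * w o1 + u o2 * w o2)); [ring | rewrite E F subr0].
- by transitivity (v o1 * (u o0 * w o0 + u o1 * w o1 + u o2 * w o2)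
    - u o1 * (v o0 * w o0 + v o1 * w o1 + v o2 * w o2)); [ring | rewrite E F subr0].
- by transitivity (v o2 * (u o0 * w o0 + u o1 * w o1 + u o2 * w o2)
    - u o2 * (v o0 * w o0 + v o1 * w o1 + v o2 * w o2)); [ring | rewrite E F subr0].
- by transitivity (u o0 * (v o0 * w o0 + v o1 * w o1 + v o2 * w o2)
    - v o0 * (u o0 * w o0 + u o1 * w o1 + u o2 * w o2)); [ring | rewrite E F subr0].
- by transitivity (u o1 * (v o0 * w o0 + v o1 * w o1 + v o2 * w o2)
    - v o1 * (u o0 * w o0 + u o1 * w o1 + u o2 * w o2)); [ring | rewrite E F subr0].
- by transitivity (v o0 * (u o0 * w o0 + u o1 * w o1 + u o2 * w o2)
    - u o0 * (v o0 * w o0 + v o1 * w o1 + v o2 * w o2)); [ring | rewrite E F subr0].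
Qed.

Lemma cross0_proportional u v : cross u v =1 (fun=> 0) -> forall i j, u i * v j = u j * v i.
Proof.
move=> c i j; move: (c o0) (c o1) (c o2); rewrite /cross /=.
move=> /eqP; rewrite subr_eq0 => /eqP c0 /eqP; rewrite subr_eq0 => /eqP c1.
move=> /eqP; rewrite subr_eq0 => /eqP c2.
by elim/ord3_ind: i; elim/ord3_ind: j.
Qed.

(** Multiply v by 1 = dot al u and exchange the indices. *)
Lemma bezout_proportional (al u v : 'I_3 -> A) : dot al u = 1 ->
  (forall i j, u i * v j = u j * v i) -> forall j, v j = dot al v * u j.
Proof.
move=> al1 E j; rewrite -[LHS]mul1r -al1 /dot !mulr_suml; apply: eq_bigr => i _.
by rewrite -!mulrA E; congr (_ * _); rewrite mulrC.
Qed.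
End Cross.

Section Univariate.
Variable K : fieldType.
Implicit Types u v w pi si ta : 'I_3 -> {poly K}.

(** Bounds on sizes: [bounded n.+1 u] means that all entries have degree at most n. *)
Definition bounded n u := forall i, (size (u i) <= n)%N.
Definition minimal_syz pi a si := [/\ dot si pi = 0, bounded a.+1 si,
  exists i, si i != 0 &
  forall u, dot u pi = 0 -> bounded a u -> u =1 (fun=> 0)].

Lemma minimal_syz_size pi a si : minimal_syz pi a si -> exists i, size (si i) = a.+1.
Proof.
case=> [sp sb [i si0] mn]; apply: contrapT => /forallNP H.
have /mn-/(_ sp i) E : bounded a si.
  by move=> j; have := sb j; rewrite leq_eqVlt => /orP [/eqP/H|].
by rewrite E eqxx in si0.
Qed.

(** A common factor of the entries could be divided out, which would lower the degree. *)
Lemma minimal_syz_bezout pi a si : minimal_syz pi a si -> exists al, dot al si = 1.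
Proof.
move=> ms; have [k sk] := minimal_syz_size ms; have [sp sb [i0 si0] mn] := ms.
pose D := gcdp (gcdp (si o0) (si o1)) (si o2).
have Ddvd i : D %| si i.
  elim/ord3_ind: i; rewrite /D; last exact: dvdp_gcdr.
    exact: dvdp_trans (dvdp_gcdl _ _) (dvdp_gcdl _ _).
  exact: dvdp_trans (dvdp_gcdl _ _) (dvdp_gcdr _ _).
have D0 : D != 0 by apply: contraNneq si0 => D0; rewrite -dvd0p -D0 Ddvd.
have [si' siE] : exists si' : 'I_3 -> {poly K}, forall i, si i = si' i * D.
  by exists (fun i => si i %/ D) => i; rewrite divpK.
have sp' : dot si' pi = 0.
  apply: (mulIf D0); rewrite mul0r -sp /dot mulr_suml; apply: eq_bigr => i _.
  by rewrite siE mulrAC.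
have szD : size D = 1%N.
  apply/eqP; rewrite eqn_leq size_poly_gt0 D0 andbT leqNgt; apply/negP => szD.
  have : si' =1 (fun=> 0).
    apply: mn => // i; have [->|n0] := eqVneq (si' i) 0; first by rewrite size_poly0.
    have := sb i; rewrite siE size_mul //; move: (size (si' i)) (size D) szD; lia.
  by move=> /(_ i0) E; rewrite siE E mul0r eqxx in si0.
have [[x y]] := Bezoutp (gcdp (si o0) (si o1)) (si o2).
have [[z t]] := Bezoutp (si o0) (si o1).
rewrite /= -/D => /eqpP [[c1 c2] /= /andP [c10 c20] E1] /eqpP [[c3 c4] /= /andP [c30 c40] E2].
have /size_poly1P [c c0 Dc] : size D == 1%N by rewrite szD.
pose l1 := c1 / c2; pose l2 := c3 / c4.
have G1 : gcdp (si o0) (si o1) = l1 *: (z * si o0 + t * si o1).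
  by apply: (scalerI c20); rewrite -E1 scalerA mulrCA divff // mulr1.
have G2 : D = l2 *: (x * gcdp (si o0) (si o1) + y * si o2).
  by apply: (scalerI c40); rewrite -E2 scalerA mulrCA divff // mulr1.
pose al (i : 'I_3) : {poly K} := match val i with
   0%N => c^-1 *: (l2 *: (x * (l1 *: z))) | 1%N => c^-1 *: (l2 *: (x * (l1 *: t)))
   | _ => c^-1 *: (l2 *: y) end.
exists al; rewrite dot3 /al /=.
have : c^-1 *: D = 1 by rewrite Dc -mul_polyC -polyCM mulVf.
rewrite G2 G1 => <-; rewrite -!mul_polyC; ring.
Qed.

(** Koszul syzygies are nonzero, so some degree contains a syzygy. *)
Lemma minimal_syz_exists pi al : dot al pi = 1 -> exists a si, minimal_syz pi a si.
Proof.
move=> al1; pose P a := exists si, [/\ dot si pi = 0, bounded a.+1 si & exists i, si i != 0].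
have exP : exists a, `[< P a >].
  suff [si [sp si0]] : exists si, dot si pi = 0 /\ exists i, si i != 0.
    exists (\max_i size (si i))%N; apply/asboolP; exists si; split => // i.
    exact: leq_trans (leq_bigmax i) (leqnSn _).
  have [i pi0] : exists i, pi i != 0.
    apply: contrapT => /forallNP H; move: al1; rewrite /dot big1 => [/eqP|i _].
      by rewrite eq_sym oner_eq0.
    by have /negP := H i; rewrite negbK => /eqP ->; rewrite mulr0.
  have tab (x y z : {poly K}) : exists u, [/\ u o0 = x, u o1 = y & u o2 = z].
    by exists (fun i => match val i with 0%N => x | 1%N => y | _ => z end).
  move: pi0; elim/ord3_ind: i => pi0.
  - have [u [u0 u1 u2]] := tab (pi o1) (- pi o0) 0; exists u; split; last first.
      by exists o1; rewrite u1 oppr_eq0.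
    by rewrite dot3 u0 u1 u2; ring.
  - have [u [u0 u1 u2]] := tab (pi o1) (- pi o0) 0; exists u; split; last first.
      by exists o0; rewrite u0.
    by rewrite dot3 u0 u1 u2; ring.
  have [u [u0 u1 u2]] := tab (pi o2) 0 (- pi o0); exists u; split; last first.
    by exists o0; rewrite u0.
  by rewrite dot3 u0 u1 u2; ring.
have [a /asboolP [si [sp sb s0]] mn] := ex_minnP exP.
exists a, si; split => // u up ub i.
apply/eqP; apply: contraT => ui; case: a mn ub {sb} => [|a] mn ub.
  by have := ub i; rewrite leqn0 size_poly_eq0 (negbTE ui).
suff /mn : `[< P a >] by rewrite ltnn.
by apply/asboolP; exists u; split => //; exists i.
Qed.

(** Both si and ta are orthogonal to pi, whose entries are coprime, so si x ta is a multiple of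
    pi; the degrees of si, ta and pi then bound the degree of the cofactor. *)
Lemma size_cross_cofactor pi al e si ta a j :
  dot al pi = 1 -> (exists i, size (pi i) = e.+1) ->
  dot si pi = 0 -> dot ta pi = 0 -> bounded a.+1 si -> bounded j.+1 ta ->
  (forall i, cross si ta i = dot al (cross si ta) * pi i) /\
  (size (dot al (cross si ta)) <= a + j + 1 - e)%N.
Proof.
move=> al1 [i szi] sp tp sb tb.
have E : forall i, cross si ta i = dot al (cross si ta) * pi i.
  exact: bezout_proportional (cross_proportional sp tp).
split => //; have [->|h0] := eqVneq (dot al (cross si ta)) 0; first by rewrite size_poly0.
have pi0 : pi i != 0 by rewrite -size_poly_gt0 szi.
have szc : (size (cross si ta i) <= (a + j).+1)%N.
  have szM (k l : 'I_3) : (size (si k * ta l)%R <= (a + j).+1)%N.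
    by apply: leq_trans (size_polyMleq _ _) _; have := sb k; have := tb l; lia.
  have szB (k l m n : 'I_3) : (size (si k * ta l - si m * ta n)%R <= (a + j).+1)%N.
    by apply: leq_trans (size_polyD _ _) _; rewrite size_polyN geq_max !szM.
  by rewrite /cross; case: (val i) => [|[|?]]; apply: szB.
by move: szc; rewrite E size_mul // szi; move: (size (polyseq (dot _ _))) => h; lia.
Qed.

(** When si x ta = 0 the syzygy ta is a multiple of si, again by coprimality of the entries of si.
    *)
Lemma size_multiple si ta be a j : dot be si = 1 -> (exists i, size (si i) = a.+1) ->
  bounded j.+1 ta -> cross si ta =1 (fun=> 0) ->
  (forall i, ta i = dot be ta * si i) /\ (size (dot be ta) <= j.+1 - a)%N.
Proof.
move=> be1 [i szi] tb c0.
have E : forall i, ta i = dot be ta * si i.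
  exact: bezout_proportional (cross0_proportional c0).
split => //; have [->|q0] := eqVneq (dot be ta) 0; first by rewrite size_poly0.
have si0 : si i != 0 by rewrite -size_poly_gt0 szi.
by have := tb i; rewrite E size_mul // szi; move: (size (polyseq (dot _ _))) => h; lia.
Qed.

End Univariate.

(** * Restricting syzygies to a line *)

Definition crossv (K : fieldType) (a b : 'rV[K]_3) : 'rV[K]_3 :=
  \row_i cross (a ord0) (b ord0) i.

Lemma crossv_span (K : fieldType) (a b v : 'rV[K]_3) : crossv a b != 0 ->
  \sum_i crossv a b ord0 i * v ord0 i = 0 -> exists x y, v = x *: a + y *: b.
Proof.
move=> c0; rewrite sum3 !mxE /cross /= => E.
have [k ck] := nonzero_coord c0.
move: E ck; rewrite mxE;  set a0 := a ord0 o0; set a1 := a ord0 o1; set a2 := a ord0 o2.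
set b0 := b ord0 o0; set b1 := b ord0 o1; set b2 := b ord0 o2.
set v0 := v ord0 o0; set v1 := v ord0 o1; set v2 := v ord0 o2 => E.
elim/ord3_ind: k; rewrite /cross /= -/a0 -/a1 -/a2 -/b0 -/b1 -/b2 => ck.
- exists ((v1 * b2 - v2 * b1) / (a1 * b2 - a2 * b1)), ((a1 * v2 - a2 * v1) / (a1 * b2 - a2 * b1)).
  have E0 : v0 = - ((a2 * b0 - a0 * b2) * v1 + (a0 * b1 - a1 * b0) * v2) / (a1 * b2 - a2 * b1).
    by apply: (mulIf ck); rewrite mulfVK // -[RHS]addr0 -E; ring.
  apply/rowP => i; rewrite !mxE; elim/ord3_ind: i; rewrite -/v0 -/v1 -/v2 -/a0 -/a1 -/a2 -/b0 -/b1 -/b2 ?E0;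
  by field.
- exists ((v2 * b0 - v0 * b2) / (a2 * b0 - a0 * b2)), ((a2 * v0 - a0 * v2) / (a2 * b0 - a0 * b2)).
  have E0 : v1 = - ((a1 * b2 - a2 * b1) * v0 + (a0 * b1 - a1 * b0) * v2) / (a2 * b0 - a0 * b2).
    by apply: (mulIf ck); rewrite mulfVK // -[RHS]addr0 -E; ring.
  apply/rowP => i; rewrite !mxE; elim/ord3_ind: i; rewrite -/v0 -/v1 -/v2 -/a0 -/a1 -/a2 -/b0 -/b1 -/b2 ?E0;
  by field.
exists ((v0 * b1 - v1 * b0) / (a0 * b1 - a1 * b0)), ((a0 * v1 - a1 * v0) / (a0 * b1 - a1 * b0)).
have E0 : v2 = - ((a1 * b2 - a2 * b1) * v0 + (a2 * b0 - a0 * b2) * v1) / (a0 * b1 - a1 * b0).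
  by apply: (mulIf ck); rewrite mulfVK // -[RHS]addr0 -E; ring.
apply/rowP => i; rewrite !mxE; elim/ord3_ind: i; rewrite -/v0 -/v1 -/v2 -/a0 -/a1 -/a2 -/b0 -/b1 -/b2 ?E0;
by field.
Qed.

(** The line through a and b is covered by the affine line a + t b and the point b. *)
Lemma restr_affine_eq0 (K : numFieldType) (a b : 'rV[K]_3) d p :
  crossv a b != 0 -> p \is d.-homog -> restr (affine a b) p = 0 ->
  divides (lform (crossv a b)) p.
Proof.
move=> c0 hp p0; apply: vanish_hyperplane => // v.
rewrite meval_lform => /(crossv_span c0) [x [y ->]].
have [->|x0] := eqVneq x 0.
  rewrite scale0r add0r (meval_homog _ _ hp) -(restr_affine a b hp).2 p0 coef0.
  by rewrite mulr0.
have -> : x *: a + y *: b = x *: (a + (y / x) *: b).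
  by rewrite scalerDr scalerA mulrCA divff // mulr1.
by rewrite (meval_homog _ _ hp) -ev_affine -horner_restr p0 horner0 mulr0.
Qed.

Section LineBound.
Variables (K : numFieldType) (e : nat) (g : 'I_3 -> {mpoly K[3]}).
Hypothesis hg : forall i, g i \is e.-homog.
Variables a b : 'rV[K]_3.
Hypothesis ab : crossv a b != 0.
Local Notation fields m := {ffun 'I_3 -> dhomog 3 K m}.
Let gam := affine a b.
Let pi i := restr gam (g i).

Definition line_field m (r : fields m) (i : 'I_3) : {poly K} := restr gam (val (r i)).

Lemma line_field_bounded m (r : fields m) : bounded m.+1 (line_field r).
Proof. by move=> i; have [] := restr_affine a b (dhomog_is_dhomog (r i)). Qed.

Lemma line_field_linear m i : linear (fun r : fields m => line_field r i).
Proof. by move=> c r s; rewrite /line_field !ffunE linearP rmorphD /= restrZ. Qed.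

Lemma line_field_syz m (r : fields m) : r \in syz e g m -> dot (line_field r) pi = 0.
Proof.
move/(syzP hg) => /(congr1 (restr gam)); rewrite rmorph0 => <-.
by rewrite rmorph_sum; apply: eq_bigr => i _; rewrite rmorphM.
Qed.

Definition shift m (r : fields m) : fields m.+1 :=
  [ffun i => indhomog m.+1 (val (r i) * lform (crossv a b))].

Lemma val_shift m (r : fields m) i :
  val (shift r i) = val (r i) * lform (crossv a b).
Proof.
rewrite ffunE /indhomog val_insubd ifT //.
by have := dhomogM (dhomog_is_dhomog (r i)) (lform_homog (crossv a b)); rewrite addn1.
Qed.

Lemma shift_linear m : linear (@shift m).
Proof.
move=> c r s; apply/ffunP => i; apply: val_inj.
transitivity (c *: val (shift r i) + val (shift s i)); last by rewrite !ffunE linearP.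
by rewrite !val_shift !ffunE linearP /= mulrDl scalerAl.
Qed.

HB.instance Definition _ m := GRing.isLinear.Build K (fields m) (fields m.+1) _
  (@shift m) (@shift_linear m).

(** A syzygy that vanishes on the line is divisible by the equation of the line, with quotient a
    syzygy of one degree less. *)
Lemma dim_line_kernel m (W : {vspace fields m.+1}) : (W <= syz e g m.+1)%VS ->
  (forall r, r \in W -> line_field r =1 (fun=> 0)) -> (\dim W <= \dim (syz e g m))%N.
Proof.
move=> WS W0; apply: leq_trans (dim_limg_le (linfun (@shift m)) (syz e g m)).
apply/dimvS/subvP => r rW.
have /choice [q Eq] i : exists q, val (r i) = q * lform (crossv a b).
  have := W0 r rW i; apply: restr_affine_eq0 => //; exact: dhomog_is_dhomog.
have l0 : lform (crossv a b) != 0 by rewrite lform_eq0.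
have hq i : q i \is m.-homog.
  apply: (@homog_div _ _ m 1 (val (r i)) (q i) (lform (crossv a b))) => //.
    by rewrite addn1; apply: dhomog_is_dhomog.
  exact: lform_homog.
apply/memv_imgP; exists [ffun i => DHomog (hq i)].
  apply/(syzP hg); apply: (mulIf l0); rewrite mul0r -[RHS](syzP hg _ (subvP WS _ rW)).
  by rewrite mulr_suml; apply: eq_bigr => i _; rewrite ffunE /= Eq mulrAC.
apply/ffunP => i; apply: val_inj; rewrite lfunE /= val_shift ffunE /= Eq.
by [].
Qed.

Section MinimalSyzygy.
Variables (si : 'I_3 -> {poly K}) (d1 : nat).
Hypothesis ms : minimal_syz pi d1 si.

Let comb m (be : 'I_3 -> {poly K}) (r : fields m) := dot be (line_field r).

Lemma comb_linear m be : linear (@comb m be).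
Proof.
move=> c r s; rewrite /comb /dot scaler_sumr -big_split; apply: eq_bigr => i _ /=.
by rewrite line_field_linear mulrDr scalerAr.
Qed.

(** On the line such syzygies are multiples of si, so they are counted by the coefficients of the
    quotient plus the kernel of the restriction. *)
Lemma dim_parallel m (W : {vspace fields m.+1}) : (W <= syz e g m.+1)%VS ->
  (forall r, r \in W -> cross si (line_field r) =1 (fun=> 0)) ->
  (\dim W <= m.+2 - d1 + \dim (syz e g m))%N.
Proof.
move=> WS W0; have [be be1] := minimal_syz_bezout ms.
have [i szi] := minimal_syz_size ms.
pose phi : {linear fields m.+1 -> {poly K}} :=
  HB.pack (@comb m.+1 be) (GRing.isLinear.Build K _ _ _ _ (@comb_linear m.+1 be)).
have mult r (rW : r \in W) := size_multiple be1 (ex_intro _ i szi)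
  (line_field_bounded r) (W0 r rW).
have [W1 [dW1 W1W W1phi]] := dim_drop (phi := phi) (fun r rW => (mult r rW).2).
apply: leq_trans dW1 _; rewrite leq_add2l; apply: dim_line_kernel.
  exact: subv_trans W1W WS.
move=> r rW1 j; have [E _] := mult r (subvP W1W _ rW1).
by rewrite E; have := W1phi r rW1; rewrite /= /comb => ->; rewrite mul0r.
Qed.

Hypothesis d1_gt0 : (0 < d1)%N.
Variable al : 'I_3 -> {poly K}.
Hypothesis al1 : dot al pi = 1.
Hypothesis szpi : exists i, size (pi i) = e.+1.

Let hcomb m (r : fields m) := dot al (cross si (line_field r)).

Lemma hcomb_linear m : linear (@hcomb m).
Proof.
move=> c r s; rewrite /hcomb !dot3 /cross /= !line_field_linear -!mul_polyC; ring.
Qed.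

(** Send a restricted syzygy ta to the cofactor of si x ta, of degree at most d1 + m + 1 - e, and
    count the kernel with [dim_parallel], which contributes m + 2 - d1: the degree d1 of the
    minimal syzygy cancels. *)
Lemma dim_syz_step m :
  (\dim (syz e g m.+1) <= m.+1 + (m.+3 - e) + \dim (syz e g m))%N.
Proof.
have [sp sb _ mn] := ms.
have [lt_md|le_dm] := ltnP m.+1 d1.
  have := @dim_parallel m _ (subvv _); move/(_ _)/leq_trans; apply; last first.
    by rewrite (eqP (_ : m.+2 - d1 == 0)%N) ?leq_addl // subn_eq0.
  move=> r /line_field_syz rp i.
  have r0 : line_field r =1 (fun=> 0).
    apply: mn => // j; exact: leq_trans (line_field_bounded r j) lt_md.
  by rewrite /cross !r0 !mulr0 subrr; case: (val i) => [|[|]].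
pose phi : {linear fields m.+1 -> {poly K}} :=
  HB.pack (@hcomb m.+1) (GRing.isLinear.Build K _ _ _ _ (@hcomb_linear m.+1)).
have mult r (rW : r \in syz e g m.+1) := size_cross_cofactor al1 szpi sp
  (line_field_syz rW) sb (line_field_bounded r).
have [W1 [dW1 W1W W1phi]] := dim_drop (phi := phi) (fun r rW => (mult r rW).2).
have dimW1 : (\dim W1 <= m.+2 - d1 + \dim (syz e g m))%N.
  apply: dim_parallel => // r rW1 i; have [E _] := mult r (subvP W1W _ rW1).
  by rewrite E; have := W1phi r rW1; rewrite /= /hcomb => ->; rewrite mul0r.
apply: leq_trans dW1 _; apply: leq_trans (leq_add (leqnn _) dimW1) _.
by rewrite addnA leq_add2r; lia.
Qed.

Lemma dim_syz0 : \dim (syz e g 0) = 0%N.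
Proof.
have [_ _ _ mn] := ms.
apply/eqP; rewrite dimv_eq0 -subv0; apply/subvP => r rs; rewrite memv0.
apply/eqP/ffunP => i; apply: val_inj; rewrite [in RHS]ffunE /=.
have r0 : line_field r i = 0.
  by apply: mn (line_field_syz rs) _ i => j; apply: leq_trans (line_field_bounded r j) d1_gt0.
have := dhomog_is_dhomog (r i); set p := val (r i) => hp.
have Ep := homog0E hp.
have : p = 0.
  by move: r0; rewrite /line_field -/p Ep restrC => /eqP; rewrite polyC_eq0 => /eqP ->;
    rewrite mpolyC0.
exact.
Qed.

End MinimalSyzygy.

End LineBound.

(** * The maximal Tjurina number as a bound on syzygies *)

Lemma bin2_mul2 n : ('C(n.+1, 2) * 2 = n.+1 * n)%N.
Proof. by rewrite bin2 /= muln2 halfK -[RHS]/(n.+1 * n.+1.-1)%N oddM /= andNb subn0. Qed.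

Section LowerBound.
Variables (K : fieldType) (e : nat) (g : 'I_3 -> {mpoly K[3]}).
Hypothesis hg : forall i, g i \is e.-homog.
Implicit Types rho : 'I_3 -> {mpoly K[3]}.

Definition multiple m k rho (p : dhomog 3 K k) : {ffun 'I_3 -> dhomog 3 K m} :=
  [ffun i => indhomog m (pihomog mdeg m (val p * rho i))].

Lemma multiple_linear m k rho : linear (@multiple m k rho).
Proof.
have vE p i : val (@multiple m k rho p i) = pihomog mdeg m (val p * rho i).
  by rewrite ffunE /indhomog val_insubd ifT ?pihomogP.
move=> c p q; apply/ffunP => i; apply: val_inj.
transitivity (c *: val (@multiple m k rho p i) + val (@multiple m k rho q i)).
  by rewrite !vE linearP /= mulrDl -scalerAl linearP.
by rewrite !ffunE linearP.
Qed.

HB.instance Definition _ m k rho := GRing.isLinear.Build K (dhomog 3 K k)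
  {ffun 'I_3 -> dhomog 3 K m} _ (@multiple m k rho) (@multiple_linear m k rho).

Lemma val_multiple m k r rho p i : (forall i, rho i \is r.-homog) -> (k + r = m)%N ->
  val (@multiple m k rho p i) = val p * rho i.
Proof.
move=> hrho krm; have hm : val p * rho i \is m.-homog.
  by rewrite -krm; apply: dhomogM (dhomog_is_dhomog p) (hrho i).
by rewrite ffunE /indhomog pihomog_dE // val_insubd ifT.
Qed.

Lemma multiple_syz m k r rho p : (forall i, rho i \is r.-homog) -> (k + r = m)%N ->
  dot rho g = 0 -> @multiple m k rho p \in syz e g m.
Proof.
move=> hrho krm rg; apply/(syzP hg).
under eq_bigr => i _ do rewrite (val_multiple p i hrho krm) -mulrA.
by rewrite -mulr_sumr -/(dot rho g) rg mulr0.
Qed.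

Definition multiples_of m r rho : {vspace {ffun 'I_3 -> dhomog 3 K m}} :=
  limg (linfun (@multiple m (m - r) rho)).

Lemma multiples_ofP m r rho u :
  u \in multiples_of m r rho -> exists p, u = @multiple m (m - r) rho p.
Proof. by case/memv_imgP => p _ ->; exists p; rewrite lfunE. Qed.

Lemma dim_multiples_of m r rho : (forall i, rho i \is r.-homog) -> (r <= m)%N ->
  (exists i, rho i != 0) -> \dim (multiples_of m r rho) = 'C(m - r + 2, 2).
Proof.
move=> hrho rm [i rho0]; rewrite /multiples_of limg_dim_eq ?dim_form //.
apply/eqP; rewrite -subv0; apply/subvP => p.
rewrite memv_cap memv_ker memv0 lfunE => /andP [_ /eqP/ffunP/(_ i)/(congr1 val)].
rewrite /= (val_multiple p i hrho (subnK rm)) ffunE => /eqP.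
by rewrite mulf_eq0 (negbTE rho0) orbF.
Qed.

(** The multiples of two independent syzygies form a direct sum. *)
Lemma dim_syz_ge m r1 r2 rho1 rho2 :
  (forall i, rho1 i \is r1.-homog) -> (forall i, rho2 i \is r2.-homog) ->
  dot rho1 g = 0 -> dot rho2 g = 0 ->
  (forall A B, (forall i, A * rho1 i + B * rho2 i = 0) -> A = 0 /\ B = 0) ->
  (r1 <= m)%N -> (r2 <= m)%N ->
  ('C(m - r1 + 2, 2) + 'C(m - r2 + 2, 2) <= \dim (syz e g m))%N.
Proof.
move=> h1 h2 s1 s2 ind m1 m2.
have n1 : exists i, rho1 i != 0.
  apply: contrapT => /forallNP H; have [i|] := ind 1 0; last by move/eqP; rewrite oner_eq0.
  by have /negP := H i; rewrite negbK => /eqP ->; rewrite mulr0 mul0r addr0.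
have n2 : exists i, rho2 i != 0.
  apply: contrapT => /forallNP H; have [i|_] := ind 0 1; last by move/eqP; rewrite oner_eq0.
  by have /negP := H i; rewrite negbK => /eqP ->; rewrite mulr0 mul0r addr0.
rewrite -(dim_multiples_of h1 m1 n1) -(dim_multiples_of h2 m2 n2) -dimv_disjoint_sum.
  apply/dimvS/subvP => u /memv_addP [v vV [w wW ->]]; apply: rpredD.
    by have [p ->] := multiples_ofP vV; apply: multiple_syz h1 (subnK m1) s1.
  by have [p ->] := multiples_ofP wW; apply: multiple_syz h2 (subnK m2) s2.
apply/eqP; rewrite -subv0; apply/subvP => u; rewrite memv_cap memv0 => /andP [u1 u2].
have [p Ep] := multiples_ofP u1; have [q Eq] := multiples_ofP u2.
have [i|p0 _] := ind (val p) (- val q).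
  rewrite mulNr -(val_multiple p i h1 (subnK m1)) -(val_multiple q i h2 (subnK m2)).
  by rewrite -Ep -Eq subrr.
by rewrite Ep; apply/eqP/ffunP => i; apply: val_inj;
  rewrite (val_multiple p i h1 (subnK m1)) p0 mul0r ffunE.
Qed.

End LowerBound.

(** The dimension in degree m of a graded free module on generators of degrees 1 and e - 1. *)
Definition syz_bound e m := ('C(m + 1, 2) + 'C(m + 3 - e, 2))%N.

Lemma syz_boundS e m : (syz_bound e m.+1 = m.+1 + (m.+3 - e) + syz_bound e m)%N.
Proof.
rewrite /syz_bound !addn1 addnAC -addnA.
have -> : ('C(m.+2, 2) = m.+1 + 'C(m.+1, 2))%N by rewrite [LHS]binS bin1 addnC.
have -> : ('C(m.+1 + 3 - e, 2) = (m.+3 - e) + 'C(m + 3 - e, 2))%N.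
  have [le|lt] := leqP e (m + 3); last by rewrite !bin_small //; lia.
  have -> : (m.+1 + 3 - e = (m + 3 - e).+1)%N by lia.
  by rewrite binS bin1 addnC addn3.
lia.
Qed.

Section GoodLine.
Variables (K : numFieldType) (e : nat) (f : {mpoly K[3]}).
Hypothesis hf : f \is e.+1.-homog.
Let hg i : f^`M(i) \is e.-homog := mderiv_homog i hf.
Local Notation ar m := (syz e (fun i => f^`M(i)) m).
Local Notation syz_bound := (syz_bound e).
Implicit Types a b : 'rV[K]_3.

(** By Euler's formula and the chain rule, the restriction of f and its derivative are
    combinations of the restricted partial derivatives; separability makes the first two coprime.
    *)
Lemma gradient_line_bezout a b : separable_poly (restr (affine a b) f) ->
  exists al, dot al (fun i => restr (affine a b) f^`M(i)) = 1.
Proof.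
rewrite unlock => /Bezout_coprimepP [[u v] /= /eqpP [[c1 c2] /= /andP [c10 c20] E]].
set F := restr _ f in E.
have Eu : e.+1%:R *: F = \sum_i affine a b ord0 i * restr (affine a b) f^`M(i).
  rewrite -restrZ -(euler hf) rmorph_sum; apply: eq_bigr => i _.
  by rewrite rmorphM /= restrX.
have Ed : F^`() = \sum_i (b ord0 i)%:P * restr (affine a b) f^`M(i).
  rewrite deriv_restr; apply: eq_bigr => i _; congr (_ * _).
  by rewrite mxE derivD derivC derivZ derivX add0r alg_polyC.
exists (fun i => (c1 / c2) *: (u * (e.+1%:R^-1 *: affine a b ord0 i) + v * (b ord0 i)%:P)).
apply: (scalerI c20); rewrite -E /dot.
under eq_bigr => i _ do rewrite -scalerAl mulrDl -mulrA -mulrA -scalerAl.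
rewrite -scaler_sumr big_split /= -mulr_sumr -scaler_sumr -mulr_sumr -Eu -Ed.
rewrite !scalerA mulVf ?pnatr_eq0 // scale1r mulrCA divff // mulr1.
by rewrite addrC [v * _]mulrC addrC.
Qed.

(** The coefficients of t^e are the values of the partial derivatives at b, and they do not all
    vanish, by Euler's formula. *)
Lemma gradient_line_top a b : f.@[b ord0] != 0 ->
  exists i, size (restr (affine a b) f^`M(i)) = e.+1.
Proof.
move=> fb; apply: contrapT => /forallNP H.
have : e.+1%:R * f.@[b ord0] = 0.
  rewrite -mevalZ -(euler hf) raddf_sum big1 // => i _.
  rewrite /= mevalM; have [sz <-] := restr_affine a b (hg i); rewrite nth_default ?mulr0 //.
  by move: sz; rewrite leq_eqVlt => /orP [/eqP/H|].
by move/eqP; rewrite mulf_eq0 pnatr_eq0 (negbTE fb).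
Qed.

(** The last condition makes the degree of a minimal syzygy along the line positive. *)
Definition good_line a b := [/\ crossv a b != 0, f.@[b ord0] != 0,
  separable_poly (restr (affine a b) f) &
  forall v : 'rV[K]_3, \sum_i (v ord0 i)%:P * restr (affine a b) f^`M(i) = 0 -> v = 0].

Lemma good_line_minimal a b : good_line a b ->
  exists d1 si, (0 < d1)%N /\ minimal_syz (fun i => restr (affine a b) f^`M(i)) d1 si.
Proof.
move=> [ab fb sep const]; have [al al1] := gradient_line_bezout sep.
have [d1 [si ms]] := minimal_syz_exists al1; exists d1, si; split => //.
case: d1 ms => // -[sp sb [i si0] _]; case/negP: si0.
have siE j : si j = ((\row_k (si k)`_0 : 'rV[K]_3) ord0 j)%:P.
  by rewrite mxE; apply: size1_polyC.
have /rowP /(_ i) : (\row_k (si k)`_0 : 'rV[K]_3) = 0.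
  by apply: const; apply: etrans sp; apply: eq_bigr => j _; rewrite -siE.
by rewrite siE => ->; rewrite mxE polyC0.
Qed.

Lemma good_line_step a b m : good_line a b ->
  (\dim (ar m.+1) <= m.+1 + (m.+3 - e) + \dim (ar m))%N.
Proof.
move=> gl; have [d1 [si [d1_gt0 ms]]] := good_line_minimal gl.
have [ab fb sep const] := gl; have [al al1] := gradient_line_bezout sep.
exact: (dim_syz_step hg ab ms d1_gt0 al1 (gradient_line_top a fb)).
Qed.

Lemma good_line_bound a b m : good_line a b -> (\dim (ar m) <= syz_bound m)%N.
Proof.
move=> gl; elim: m => [|m IH].
  have [d1 [si [d1_gt0 ms]]] := good_line_minimal gl.
  by rewrite (dim_syz0 hg ms d1_gt0).
by rewrite syz_boundS (leq_trans (good_line_step _ gl)) // leq_add2l.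
Qed.

(** The growth of the two sides of the bound in one step is the same, so a deficit is never
    recovered. *)
Lemma good_line_strict a b m0 : good_line a b -> (\dim (ar m0) < syz_bound m0)%N ->
  forall m, (m0 <= m)%N -> (\dim (ar m) < syz_bound m)%N.
Proof.
move=> gl lt0; elim=> [|m IH]; first by rewrite leqn0 => /eqP E; move: lt0; rewrite E.
rewrite leq_eqVlt => /orP [/eqP E|/IH lt]; first by move: lt0; rewrite E.
by rewrite syz_boundS (leq_ltn_trans (good_line_step _ gl)) // ltn_add2l.
Qed.

(** The alternating sum of dimensions in 0 -> AR_m -> (R_m)^3 -> R_(m+e) -> (R/J)_(m+e) -> 0. *)
Lemma tjurinaP : (0 < e)%N -> total_tjurina f (e * (e - 1) + 1) <->
  exists m0, forall m, (m0 <= m)%N -> \dim (ar m) = syz_bound m.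
Proof.
move=> e_gt0.
have key m : (e <= m)%N -> hilbert_function (jacobian_ideal f) (m + e) (e * (e - 1) + 1) <->
    \dim (ar m) = syz_bound m.
  move=> em; rewrite dim_quotient //.
  have := dim_syz_jac e (fun i => f^`M(i)) m.
  have [e' Ee] : exists e', e = e'.+1 by exists e.-1; lia.
  have [k Em] : exists k, m = (e'.+1 + k)%N by exists (m - e)%N; lia.
  have E : (e * (e - 1) + 1 + 3 * 'C(m + 2, 2) = 'C(m + e + 2, 2) + syz_bound m)%N.
    rewrite /syz_bound (_ : m + 3 - e = (k + 2).+1)%N; last by lia.
    have := bin2_mul2 (k + 2); have := bin2_mul2 m; have := bin2_mul2 m.+1.
    have := bin2_mul2 (m + e + 1); rewrite -addnS !addn2 !addn1 Em Ee.
    move: ('C(_, _)) ('C(_, _)) ('C(_, _)) ('C(_, _)) => B1 B2 B3 B4; lia.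
  move: E; set x := \dim (limg _); set y := \dim (syz _ _ m).
  move: x y (syz_bound m) (e * (e - 1))%N ('C(m + 2, 2)) ('C(m + e + 2, 2)) => x y u p B1 B2 E D.
  by split; lia.
split=> -[k0 H].
  exists (k0 + e)%N => m lem; apply/key; first by lia.
  by apply: H; lia.
exists (k0 + e + e)%N => k lek.
have -> : (k = (k - e) + e)%N by lia.
by apply/key; [lia | apply: H; lia].
Qed.

End GoodLine.

(** * General position, and linear fields that vanish off the curve *)

Section Generic.
Variables (K : numFieldType) (V : lmodType K).
Implicit Types F G : V -> K.

(** Functions that are polynomial along every affine line serve as regular functions in general
    position arguments: a product of nonzero ones is nonzero. *)
Definition linepoly F := forall u w, exists p : {poly K}, forall t, F (u + t *: w) = p.[t].
Definition generic F := linepoly F /\ exists v, F v != 0.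

Lemma linepoly_cst c : linepoly (fun=> c).
Proof. by move=> u w; exists c%:P => t; rewrite hornerC. Qed.

Lemma linepolyD F G : linepoly F -> linepoly G -> linepoly (fun v => F v + G v).
Proof.
by move=> lF lG u w; have [p pE] := lF u w; have [q qE] := lG u w;
  exists (p + q) => t; rewrite hornerD pE qE.
Qed.

Lemma linepolyM F G : linepoly F -> linepoly G -> linepoly (fun v => F v * G v).
Proof.
by move=> lF lG u w; have [p pE] := lF u w; have [q qE] := lG u w;
  exists (p * q) => t; rewrite hornerM pE qE.
Qed.

Lemma linepolyN F : linepoly F -> linepoly (fun v => - F v).
Proof.
by move=> lF u w; have [p pE] := lF u w; exists (- p) => t; rewrite hornerN pE.
Qed.

Lemma linepolyB F G : linepoly F -> linepoly G -> linepoly (fun v => F v - G v).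
Proof. by move=> lF lG; apply: linepolyD lF (linepolyN lG). Qed.

Lemma linepoly_linear (F : V -> K) :
  (forall c u v, F (c *: u + v) = c * F u + F v) -> linepoly F.
Proof.
move=> lin u w; exists ((F u)%:P + F w *: 'X) => t.
by rewrite !hornerE addrC lin addrC mulrC.
Qed.

Lemma linepoly_meval n (p : {mpoly K[n]}) (phi : V -> 'rV[K]_n) :
  (forall i, linepoly (fun v => phi v ord0 i)) -> linepoly (fun v => p.@[phi v ord0]).
Proof.
move=> lphi; elim/mpoly_alg_ind: p.
- move=> c u w; exists c%:P => t; rewrite mevalC hornerC //.
- move=> i u w; have [q qE] := lphi i u w; exists q => t; rewrite mevalXU qE //.
- move=> p q lp lq u w; have [p' pE] := lp u w; have [q' qE] := lq u w.
  by exists (p' + q') => t; rewrite mevalD pE qE hornerD.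
move=> p q lp lq u w; have [p' pE] := lp u w; have [q' qE] := lq u w.
by exists (p' * q') => t; rewrite mevalM pE qE hornerM.
Qed.

Lemma poly_nonroot (p : {poly K}) : p != 0 -> exists t, p.[t] != 0.
Proof.
move=> p0; apply: contrapT => /forallNP H; case/eqP: p0; apply: poly_eval0 => t.
by have /negP := H t; rewrite negbK => /eqP.
Qed.

(** On the line joining a point where F is nonzero to one where G is nonzero both are nonzero
    polynomials. *)
Lemma genericM F G : generic F -> generic G -> generic (fun v => F v * G v).
Proof.
move=> [lF [u Fu]] [lG [w Gw]]; split; first exact: linepolyM.
have [p pE] := lF u (w - u); have [q qE] := lG u (w - u).
have p0 : p != 0.
  by apply: contraNneq Fu => p0; have := pE 0; rewrite scale0r addr0 p0 horner0 => ->.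
have q0 : q != 0.
  by apply: contraNneq Gw => q0; have := qE 1; rewrite scale1r addrC subrK q0 horner0 => ->.
have [t] : exists t, (p * q).[t] != 0 by apply: poly_nonroot; rewrite mulf_neq0.
by rewrite hornerM => pqt; exists (u + t *: (w - u)); rewrite pE qE.
Qed.

Lemma generic1 : generic (fun=> 1).
Proof. by split; [apply: linepoly_cst | exists 0; rewrite oner_eq0]. Qed.

Lemma generic_prod (I : eqType) (r : seq I) (F : I -> V -> K) :
  (forall i, i \in r -> generic (F i)) -> generic (fun v => \prod_(i <- r) F i v).
Proof.
elim: r => [|i r IH] H; last first.
  have [l [v nz]] : generic (fun v => F i v * \prod_(i <- r) F i v).
    apply: genericM; first by apply: H; rewrite mem_head.
    by apply: IH => j jr; apply: H; rewrite in_cons jr orbT.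
  split; last by exists v; rewrite big_cons.
  by move=> u w; have [p pE] := l u w; exists p => t; rewrite big_cons.
have [l [v nz]] := generic1; split; last by exists v; rewrite big_nil.
by move=> u w; have [p pE] := l u w; exists p => t; rewrite big_nil.
Qed.

End Generic.

Lemma linepoly_coord (K : numFieldType) n (i : 'I_n) : linepoly (fun v : 'rV[K]_n => v ord0 i).
Proof. by apply: linepoly_linear => c u v; rewrite !mxE. Qed.

Lemma generic_mpoly (K : numFieldType) n (p : {mpoly K[n]}) : p != 0 ->
  generic (fun v : 'rV[K]_n => p.@[v ord0]).
Proof.
move=> p0; split; first by apply: linepoly_meval => i; apply: linepoly_coord.
apply: contrapT => /forallNP H; case/eqP: p0; apply: mpoly_eval0 => v.
by have /negP := H v; rewrite negbK => /eqP.
Qed.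

Section Exclusion.
Variables (K : numFieldType) (e : nat) (f : {mpoly K[3]}).
Hypothesis hf : f \is e.+1.-homog.
Let hg i : f^`M(i) \is e.-homog := mderiv_homog i hf.
Local Notation ar m := (syz e (fun i => f^`M(i)) m).
Implicit Types a b p : 'rV[K]_3.

Lemma restr_cross (gam : 'rV[{poly K}]_3) (u v : 'I_3 -> {mpoly K[3]}) i :
  restr gam (cross u v i) = cross (fun j => restr gam (u j)) (fun j => restr gam (v j)) i.
Proof.
by rewrite /cross; case: (val i) => [|[|k]]; rewrite rmorphB !rmorphM.
Qed.

(** On a line a + t p the coefficient of t in rho is rho(p) = 0, so rho restricts to a syzygy of
    degree 0. By degrees the cofactor of its cross product with a restricted syzygy of degree less
    than e is zero. The lines through p cover the plane. *)
Lemma low_degree_parallel (rho : 'I_3 -> {mpoly K[3]}) p m (r : {ffun 'I_3 -> dhomog 3 K m}) :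
  (forall i, rho i \is 1.-homog) -> dot rho (fun i => f^`M(i)) = 0 ->
  (forall i, (rho i).@[p ord0] = 0) -> f.@[p ord0] != 0 ->
  (exists2 G : 'rV[K]_3 -> K, generic G &
     forall a, G a != 0 -> separable_poly (restr (affine a p) f)) ->
  (m < e)%N -> r \in ar m -> cross rho (fun i => val (r i)) =1 (fun=> 0).
Proof.
move=> hrho rho_syz rho_p fp [G genG sepG] lt_me rs i; apply/eqP; apply: contraT => c0.
have [_ [a]] := genericM genG (generic_mpoly c0).
rewrite mulf_eq0 negb_or => /andP [Ga]; apply: contraNeq => _; apply/eqP.
have sep := sepG a Ga; have [al al1] := gradient_line_bezout hf sep.
pose gam := affine a p; pose si i := restr gam (rho i).
have sb : bounded 1 si.
  move=> j; have [sz c] := restr_affine a p (hrho j).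
  move: sz; rewrite leq_eqVlt => /orP [/eqP sz|//].
  have := lead_coefE (restr (affine a p) (rho j)); rewrite sz c rho_p => /eqP.
  by rewrite lead_coef_eq0 -size_poly_eq0 sz.
have sp : dot si (fun i => restr gam f^`M(i)) = 0.
  rewrite -[RHS](rmorph0 (restr gam)) -rho_syz rmorph_sum.
  by apply: eq_bigr => j _; rewrite rmorphM.
have [E sz] := size_cross_cofactor al1 (gradient_line_top hf a fp) sp
  (line_field_syz hg a p rs) sb (line_field_bounded a p r).
have h0 : dot al (cross si (line_field a p r)) = 0.
  by apply/eqP; rewrite -size_poly_eq0 -leqn0; apply: leq_trans sz _; lia.
have := restr_cross gam rho (fun i => val (r i)) i.
rewrite -/si -[fun j => restr gam (val (r j))]/(line_field a p r) E h0 mul0r.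
move/(congr1 (horner^~ 0)); rewrite horner_restr ev_affine scale0r addr0 horner0.
exact.
Qed.

(** In degree e - 1 every syzygy is parallel to rho by [low_degree_parallel], so [dim_parallel]
    with d1 = 1 replaces the general estimate, and falls short of it. *)
Lemma vanishing_field_strict (rho : 'I_3 -> {mpoly K[3]}) a b p : (1 < e)%N ->
  good_line f a b ->
  (forall i, rho i \is 1.-homog) -> (exists i, rho i != 0) ->
  dot rho (fun i => f^`M(i)) = 0 ->
  (forall i, (rho i).@[p ord0] = 0) -> f.@[p ord0] != 0 ->
  (exists2 G : 'rV[K]_3 -> K, generic G &
     forall a, G a != 0 -> separable_poly (restr (affine a p) f)) ->
  (\dim (ar e.-1) < syz_bound e e.-1)%N.
Proof.
move=> e_gt1 gl hrho [i0 rho0] rho_syz rho_p fp sepp.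
have [m em] : exists m, e = m.+2 by exists (e - 2)%N; lia.
have [ab fb sep const] := gl.
pose si i := restr (affine a b) (rho i).
have sp : dot si (fun i => restr (affine a b) f^`M(i)) = 0.
  rewrite -[RHS](rmorph0 (restr (affine a b))) -rho_syz rmorph_sum.
  by apply: eq_bigr => j _; rewrite rmorphM.
have const0 u : dot u (fun i => restr (affine a b) f^`M(i)) = 0 -> bounded 1 u ->
    u =1 (fun=> 0).
  move=> up ub i; pose v : 'rV[K]_3 := \row_k (u k)`_0.
  have uE j : u j = (v ord0 j)%:P by rewrite mxE; apply: size1_polyC.
  have v0 : v = 0.
    by apply: const; apply: etrans up; apply: eq_bigr => j _; rewrite -uE.
  by rewrite uE v0 mxE polyC0.
have si0 : exists i, si i != 0.
  apply: contrapT => /forallNP H.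
  have /choice [q Eq] i : exists q, rho i = q * lform (crossv a b).
    apply: (restr_affine_eq0 ab (hrho i)).
    by have /negP := H i; rewrite negbK => /eqP.
  have l0 : lform (crossv a b) != 0.
    by apply: contraNneq rho0 => l0; rewrite Eq l0 mulr0.
  have hq i : q i \is 0.-homog.
    exact: (@homog_div _ _ 0 1 (rho i) (q i) _ (hrho i) (lform_homog _) l0 (Eq i)).
  have q_syz : dot q (fun i => f^`M(i)) = 0.
    apply: (mulIf l0); rewrite mul0r -[RHS]rho_syz mulr_suml.
    by apply: eq_bigr => i _; rewrite Eq mulrAC.
  have := const (\row_i (q i)@_0%MM) _.
  move/(_ _)/rowP/(_ i0); rewrite !mxE => q0.
  case/negP: rho0; rewrite Eq (homog0E (hq i0)) q0 ?mpolyC0 ?mul0r //.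
  rewrite -[RHS](rmorph0 (restr (affine a b))) -q_syz rmorph_sum.
  by apply: eq_bigr => j _; rewrite rmorphM mxE /= {2}(homog0E (hq j)) restrC.
have ms : minimal_syz (fun i => restr (affine a b) f^`M(i)) 1 si.
  by split => // i; have [] := restr_affine a b (hrho i).
have par r : r \in ar m.+1 -> cross si (line_field a b r) =1 (fun=> 0).
  move=> rs i; have lt : (m.+1 < e)%N by rewrite em.
  rewrite -restr_cross (low_degree_parallel hrho rho_syz rho_p fp sepp lt rs).
  exact: rmorph0.
have d1 := dim_parallel hg ab ms (subvv _) par.
have d2 := good_line_bound hf m gl.
have -> : e.-1 = m.+1 by lia.
rewrite syz_boundS; apply: leq_ltn_trans d1 _.
by rewrite subn1 /= -addnA ltn_add2l (leq_ltn_trans d2) //; lia.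
Qed.

End Exclusion.

(** * Polar forms, coordinates and frames adapted to a conic *)

Section Polar.
Variable K : numFieldType.
Implicit Types (g l : {mpoly K[3]}) (u v w p : 'rV[K]_3).

Lemma ev_linear l (c : K) u v : l \is 1.-homog -> ev l (c *: u + v) = c * ev l u + ev l v.
Proof.
move=> /lformE ->; rewrite /ev !meval_lform mulr_sumr -big_split.
by apply: eq_bigr => i _; rewrite !mxE /=; ring.
Qed.

Lemma evD1 l u v : l \is 1.-homog -> ev l (u + v) = ev l u + ev l v.
Proof. by move=> hl; rewrite -[u]scale1r ev_linear // mul1r scale1r. Qed.

Lemma evZ1 l c u : l \is 1.-homog -> ev l (c *: u) = c * ev l u.
Proof. by move=> hl; rewrite /ev (meval_homog _ _ hl) expr1. Qed.

Lemma ev0 d l : l \is d.+1.-homog -> ev l 0 = 0.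
Proof. by move=> hl; rewrite -(scale0r 0) /ev (meval_homog _ _ hl) expr0n mul0r. Qed.

Lemma ev_comb l (x y z : K) u v w : l \is 1.-homog ->
  ev l (x *: u + y *: v + z *: w) = x * ev l u + y * ev l v + z * ev l w.
Proof. by move=> hl; rewrite !(evD1, evZ1). Qed.

Lemma ev_eq g h : ev g =1 ev h -> g = h.
Proof.
move=> E; apply/eqP; rewrite -subr_eq0; apply/eqP/mpoly_eval0 => v.
by rewrite mevalB; have := E v; rewrite /ev => ->; rewrite subrr.
Qed.

Lemma evD g h v : ev (g + h) v = ev g v + ev h v. Proof. exact: mevalD. Qed.
Lemma evM g h v : ev (g * h) v = ev g v * ev h v. Proof. exact: mevalM. Qed.
Lemma evZ c g v : ev (c *: g) v = c * ev g v. Proof. exact: mevalZ. Qed.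
Lemma evB g h v : ev (g - h) v = ev g v - ev h v. Proof. exact: mevalB. Qed.
Lemma evX g n v : ev (g ^+ n) v = ev g v ^+ n. Proof. exact: rmorphXn. Qed.

(** The derivative of g at v in the direction u; for a quadratic form it is the symmetric bilinear
    form with [pol g v v = 2 * ev g v]. *)
Definition pol g u v := \sum_i u ord0 i * ev g^`M(i) v.

Lemma pol_linl g c u w v : pol g (c *: u + w) v = c * pol g u v + pol g w v.
Proof.
by rewrite /pol mulr_sumr -big_split; apply: eq_bigr => i _; rewrite !mxE /=; ring.
Qed.

Lemma polDl g u w v : pol g (u + w) v = pol g u v + pol g w v.
Proof. by rewrite -[u]scale1r pol_linl mul1r scale1r. Qed.

Lemma polZl g c u v : pol g (c *: u) v = c * pol g u v.
Proof.
by rewrite /pol mulr_sumr; apply: eq_bigr => i _; rewrite !mxE /=; ring.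
Qed.

Lemma tangent_homog g p : tangent_form g p \is 1.-homog.
Proof. by apply: rpred_sum => i _; rewrite rpredZ // dhomogX /= mdeg1. Qed.

Lemma ev_tangent g p u : ev (tangent_form g p) u = pol g u p.
Proof.
rewrite /ev /tangent_form raddf_sum; apply: eq_bigr => i _ /=.
by rewrite mevalZ mevalXU mulrC.
Qed.

Variable g : {mpoly K[3]}.
Hypothesis hg : g \is 2.-homog.
Let hgi i : g^`M(i) \is 1.-homog := mderiv_homog i hg.

Lemma polC u v : pol g u v = pol g v u.
Proof.
have E u' v' : pol g u' v' = \sum_i \sum_j u' ord0 i * v' ord0 j * (g^`M(i)^`M(j))@_0%MM.
  apply: eq_bigr => i _.
    have -> : ev g^`M(i) v' = ev (\sum_j 'X_j * g^`M(i)^`M(j)) v'.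
      by rewrite (euler (hgi i)) scale1r.
  rewrite /ev raddf_sum mulr_sumr; apply: eq_bigr => j _ /=.
  rewrite mevalM mevalXU mulrA; congr (_ * _).
  by rewrite {1}(homog0E (mderiv_homog j (hgi i))) mevalC.
rewrite !E exchange_big; apply: eq_bigr => i _; apply: eq_bigr => j _.
by rewrite mderiv_comm [u _ _ * _]mulrC.
Qed.

Lemma polDr u v w : pol g u (v + w) = pol g u v + pol g u w.
Proof. by rewrite polC polDl !(polC u). Qed.

Lemma polZr c u v : pol g u (c *: v) = c * pol g u v.
Proof. by rewrite polC polZl (polC u). Qed.

Lemma pol_diag v : pol g v v = 2 * ev g v.
Proof.
have := congr1 (fun q => ev q v) (euler hg); rewrite evZ => <-.
rewrite /ev raddf_sum; apply: eq_bigr => i _ /=; by rewrite mevalM mevalXU.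
Qed.

Lemma ev_add u v : ev g (u + v) = ev g u + ev g v + pol g u v.
Proof.
have two0 : (2 : K) != 0 by rewrite pnatr_eq0.
apply: (mulfI two0); rewrite -pol_diag polDl !polDr !pol_diag (polC v u); ring.
Qed.

Lemma evZ2 c v : ev g (c *: v) = c ^+ 2 * ev g v.
Proof. by rewrite /ev (meval_homog _ _ hg). Qed.

Lemma ev_comb2 x y z u v w : ev g (x *: u + y *: v + z *: w) =
  x ^+ 2 * ev g u + y ^+ 2 * ev g v + z ^+ 2 * ev g w +
  x * y * pol g u v + x * z * pol g u w + y * z * pol g v w.
Proof. rewrite !ev_add polDl !evZ2 !polZl !polZr; ring. Qed.

Lemma smooth_pol v : smooth_curve g -> v != 0 -> exists u, pol g u v != 0.
Proof.
move=> sm v0; apply: contrapT => /forallNP H.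
have H0 u : pol g u v = 0 by have /negP := H u; rewrite negbK => /eqP.
have gv : ev g v = 0.
  have two0 : (2 : K) != 0 by rewrite pnatr_eq0.
  by apply: (mulfI two0); rewrite -pol_diag H0 mulr0.
have [i] := sm v v0 gv; have := H0 (delta_mx 0 i).
rewrite /pol (bigD1 i) //= mxE !eqxx mul1r big1 ?addr0 => [->|j ji]; first by rewrite eqxx.
by rewrite mxE (negbTE ji) andbF mul0r.
Qed.

Lemma pol_smooth : (forall v, v != 0 -> exists u, pol g u v != 0) -> smooth_curve g.
Proof.
move=> H p p0 _; have [u] := H p p0; apply: contraPP => /forallNP E.
rewrite /pol big1 => [|i _]; first by rewrite eqxx.
by have /negP := E i; rewrite negbK => /eqP ->; rewrite mulr0.
Qed.

End Polar.

Section Coordinates.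
Variable K : numFieldType.
Implicit Types (X Y Z l m : {mpoly K[3]}) (u v w : 'rV[K]_3).

Definition basis3 u v w := forall x y z : K,
  x *: u + y *: v + z *: w = 0 -> [/\ x = 0, y = 0 & z = 0].

(** The linear forms X, Y, Z are dual to the basis u, v, w. *)
Record coords X Y Z u v w : Prop := Coords {
  coords_homog1 : X \is 1.-homog;
  coords_homog2 : Y \is 1.-homog;
  coords_homog3 : Z \is 1.-homog;
  coordsK : forall p, p = ev X p *: u + ev Y p *: v + ev Z p *: w;
  coordsE1 : forall x y z, ev X (x *: u + y *: v + z *: w) = x;
  coordsE2 : forall x y z, ev Y (x *: u + y *: v + z *: w) = y;
  coordsE3 : forall x y z, ev Z (x *: u + y *: v + z *: w) = z }.

Lemma basis3_coords u v w : basis3 u v w -> exists X Y Z, coords X Y Z u v w.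
Proof.
move=> ind; pose E : 'M[K]_3 := \matrix_i
  (match val i with 0%N => u | 1%N => v | _ => w end).
have mulE (a : 'rV[K]_3) : a *m E = a ord0 o0 *: u + a ord0 o1 *: v + a ord0 o2 *: w.
  by rewrite mulmx_sum_row sum3 !rowK.
have uE : E \in unitmx.
  rewrite -row_free_unit -kermx_eq0; apply/eqP/row_matrixP => i; rewrite row0.
  have : row i (kermx E) *m E = 0 by rewrite -row_mul mulmx_ker row0.
  rewrite mulE => /ind [a0 a1 a2]; apply/rowP => j; rewrite [RHS]mxE.
  by elim/ord3_ind: j.
have rowsum (a : 'rV[K]_3) j : ev (lform (\row_i invmx E i j)) a = (a *m invmx E) ord0 j.
  by rewrite /ev meval_lform !mxE; apply: eq_bigr => i _; rewrite mxE mulrC.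
pose C j := lform (\row_i invmx E i j).
have ev3 x y z j : ev (C j) (x *: u + y *: v + z *: w) =
    (match val j with 0%N => x | 1%N => y | _ => z end).
  pose a : 'rV[K]_3 := \row_i (match val i with 0%N => x | 1%N => y | _ => z end).
  have -> : x *: u + y *: v + z *: w = a *m E by rewrite mulE !mxE.
  by rewrite rowsum mulmxK // mxE.
exists (C o0), (C o1), (C o2); split; try exact: lform_homog.
- by move=> p; rewrite -{1}[p](mulmxKV uE) mulE !rowsum.
- by move=> x y z; rewrite ev3.
- by move=> x y z; rewrite ev3.
by move=> x y z; rewrite ev3.
Qed.

Lemma coords_basis X Y Z u v w : coords X Y Z u v w -> basis3 u v w.
Proof.
move=> co x y z E; split.
- by rewrite -(coordsE1 co x y z) E (ev0 (coords_homog1 co)).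
- by rewrite -(coordsE2 co x y z) E (ev0 (coords_homog2 co)).
- by rewrite -(coordsE3 co x y z) E (ev0 (coords_homog3 co)).
Qed.

Lemma common_zero l m : l \is 1.-homog -> m \is 1.-homog ->
  exists v, [/\ v != 0, ev l v = 0 & ev m v = 0].
Proof.
move=> hl hm; pose A : 'M[K]_(3, 2) :=
  \matrix_(i, j) (if j == ord0 then l@_U_(i) else m@_U_(i)).
have : kermx A != 0.
  by rewrite -mxrank_eq0 mxrank_ker subn_eq0 -ltnNge (leq_ltn_trans (rank_leq_col _)).
case/rowV0Pn => v /sub_kermxP vA v0; exists v; split => //.
  rewrite (lformE hl) /ev meval_lform; move/rowP/(_ ord0): vA; rewrite !mxE => E.
  by rewrite -[RHS]E; apply: eq_bigr => i _; rewrite !mxE mulrC.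
rewrite (lformE hm) /ev meval_lform; move/rowP/(_ ord_max): vA; rewrite !mxE => E.
by rewrite -[RHS]E; apply: eq_bigr => i _; rewrite !mxE mulrC.
Qed.

End Coordinates.

Section Conics.
Variable K : numClosedFieldType.
Implicit Types (g h l : {mpoly K[3]}) (u v w p : 'rV[K]_3).

Lemma conic_point g : g \is 2.-homog -> exists2 p, p != 0 & ev g p = 0.
Proof.
move=> hg; pose u : 'rV[K]_3 := delta_mx 0 o0; pose w : 'rV[K]_3 := delta_mx 0 o1.
have w0 : w != 0.
  by apply/eqP => /rowP /(_ o1); rewrite !mxE /= => /eqP; rewrite oner_eq0.
have uw0 t : u + t *: w != 0.
  by apply/eqP => /rowP /(_ o0); rewrite !mxE /= mulr0 addr0 => /eqP; rewrite oner_eq0.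
have [gw|gw] := eqVneq (ev g w) 0; first by exists w.
have sz : size (restr (affine u w) g) != 1%N.
  have [_] := restr_affine u w hg; apply: contra_eqN => /eqP sz.
  by rewrite nth_default ?sz // eq_sym.
have [t /rootP rt] := closed_rootP (restr (affine u w) g) sz.
by exists (u + t *: w) => //; rewrite /ev -ev_affine -horner_restr.
Qed.

(** Take u as a second point of the conic off the tangent at p, and v as the pole of the line
    through u and p, normalized. In the dual coordinates the conic is XZ + Y^2. *)
Lemma conic_frame g p : smooth_conic g -> p != 0 -> ev g p = 0 ->
  exists u v, [/\ basis3 u v p, ev g u = 0, ev g v = 1 &
   [/\ pol g u p = 1, pol g u v = 0 & pol g v p = 0]].
Proof.
move=> [hg sm] p0 gp; have [u0 up] := smooth_pol hg sm p0.
have pp : pol g p p = 0 by rewrite pol_diag // gp mulr0.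
have [u1 u1p] : exists u1, pol g u1 p = 1.
  by exists ((pol g u0 p)^-1 *: u0); rewrite polZl mulVf.
have [u [gu up1]] : exists u, ev g u = 0 /\ pol g u p = 1.
  exists (u1 + (- ev g u1) *: p); split.
    by rewrite ev_add // evZ2 // polZr // gp u1p; ring.
  by rewrite polDl polZl u1p pp mulr0 addr0.
have uu : pol g u u = 0 by rewrite pol_diag // gu mulr0.
have [v1 [v10 v1u v1p]] := common_zero (tangent_homog g u) (tangent_homog g p).
rewrite !ev_tangent in v1u v1p.
have ind : basis3 u v1 p.
  move=> x y z E.
  have x0 : x = 0.
    have : pol g (x *: u + y *: v1 + z *: p) p = 0 by rewrite E -(scale0r 0) polZl mul0r.
    by rewrite !polDl !polZl v1p pp up1 !mulr0 !addr0 mulr1.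
  have z0 : z = 0.
    have : pol g (x *: u + y *: v1 + z *: p) u = 0 by rewrite E -(scale0r 0) polZl mul0r.
    by rewrite !polDl !polZl v1u uu (polC hg p u) up1 !mulr0 !add0r mulr1.
  split => //; move: E; rewrite x0 z0 !scale0r add0r addr0 => /eqP.
  by rewrite scaler_eq0 (negbTE v10) orbF => /eqP.
have [X [Y [Z co]]] := basis3_coords ind.
have gv1 : ev g v1 != 0.
  apply/eqP => gv1; have [x] := smooth_pol hg sm v10; rewrite (coordsK co x).
  rewrite !polDl !polZl (polC hg u) (polC hg p) v1u v1p pol_diag // gv1.
  by rewrite !mulr0 !addr0 eqxx.
pose s := sqrtC (ev g v1); have s0 : s != 0 by rewrite sqrtC_eq0.
exists u, (s^-1 *: v1); split => //.
- move=> x y z; rewrite scalerA => /ind [-> ys ->]; split => //.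
  by move/eqP: ys; rewrite mulf_eq0 invr_eq0 (negbTE s0) orbF => /eqP.
- by rewrite evZ2 // exprVn sqrtCK mulVf.
split => //; first by rewrite polC // polZl v1u mulr0.
by rewrite polZl v1p mulr0.
Qed.

End Conics.

(** * Parametrizations of lines and smooth conics *)

(** Used to read off the coefficients of a form from its vanishing along a parametrized line or
    conic. *)
Lemma quartic_eq0 (K : numFieldType) (c0 c1 c2 c3 c4 : K) :
  (forall t, c0 + c1 * t + c2 * t ^+ 2 + c3 * t ^+ 3 + c4 * t ^+ 4 = 0) ->
  [/\ c0 = 0, c1 = 0, c2 = 0, c3 = 0 & c4 = 0].
Proof.
move=> H; pose p := c0%:P + c1 *: 'X + c2 *: 'X^2 + c3 *: 'X^3 + c4 *: 'X^4.
have p0 : p = 0.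
  by apply: poly_eval0 => t; rewrite /p !hornerD !hornerZ hornerC !hornerXn hornerX.
have E i : p`_i = 0 by rewrite p0 coef0.
have := (E 0%N, E 1%N, E 2%N, E 3%N, E 4%N).
rewrite /p !coefD !coefZ !coefC !coefXn !coefX /= !(mulr0, mulr1, addr0, add0r).
by case=> [[[[-> ->] ->] ->] ->].
Qed.

Section Parametrization.
Variable K : numClosedFieldType.
Implicit Types (g h l m : {mpoly K[3]}) (u v w p : 'rV[K]_3) (gam : 'rV[{poly K}]_3).

Definition component g := is_line g \/ smooth_conic g.

(** A parametrization of a component, which misses only the point w. The last two fields express
    that the component is the only component, or curve of its degree, that contains the
    parametrized curve. *)
Record param g gam w : Prop := Param {
  param_restr : restr gam g = 0;
  param_cover : forall v, v != 0 -> ev g v = 0 ->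
    (exists c t, v = c *: ev_path gam t) \/ (exists c, v = c *: w);
  param_component : forall h, component h -> restr gam h = 0 -> same_proj h g;
  param_same_degree : forall d h, g \is d.-homog -> h \is d.-homog ->
    restr gam h = 0 -> exists c, h = c *: g }.

Lemma restr_eval gam g t : ev g (ev_path gam t) = (restr gam g).[t].
Proof. by rewrite /ev horner_restr. Qed.

Lemma restr_evalP gam g : (forall t, ev g (ev_path gam t) = 0) -> restr gam g = 0.
Proof. by move=> H; apply: poly_eval0 => t; rewrite -restr_eval. Qed.

Lemma smooth_conic_neq0 g : smooth_conic g -> g != 0.
Proof.
move=> [hg sm]; apply/eqP => g0.
have [] := sm (const_mx 1) _ _; last by move=> i; rewrite g0 linear0 /ev meval0 eqxx.
  by apply/eqP => /rowP /(_ ord0) /eqP; rewrite !mxE oner_eq0.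
by rewrite g0 /ev meval0.
Qed.

Lemma component_neq0 g : component g -> g != 0.
Proof. by case=> [[]|/smooth_conic_neq0]. Qed.

Lemma homog_degree d e g : g != 0 -> g \is d.-homog -> g \is e.-homog -> d = e.
Proof. exact: dhomog_uniq. Qed.

Lemma same_projE g h c : g != 0 -> g = c *: h -> same_proj g h.
Proof.
by move=> g0 E; exists c => //; apply: contraNneq g0 => c0; rewrite E c0 scale0r.
Qed.

Lemma line_frame l : is_line l -> exists s u w Y Z, coords l Y Z s u w.
Proof.
move=> [l0 hl]; have [w [w0 lw _]] := common_zero hl hl.
have [i wi] := nonzero_coord w0.
have Xw v : ev 'X_i v = v ord0 i by rewrite /ev mevalXU.
have hX : ('X_i : {mpoly K[3]}) \is 1.-homog by rewrite dhomogX /= mdeg1.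
have [u [u0 lu ui]] := common_zero hl hX.
have [s0 ls] : exists s, ev l s != 0.
  have [_ [s ls]] := generic_mpoly l0; by exists s.
pose s := (ev l s0)^-1 *: s0; have ls1 : ev l s = 1 by rewrite evZ1 // mulVf.
have [X [Y [Z co]]] : exists X Y Z, coords X Y Z s u w.
  apply: basis3_coords => x y z E.
  have x0 : x = 0.
    by have := congr1 (ev l) E; rewrite ev_comb // (ev0 hl) ls1 lu lw !mulr0 !addr0 mulr1.
  have z0 : z = 0.
    have := congr1 (ev 'X_i) E; rewrite ev_comb // (ev0 hX) ui x0 mul0r mulr0 !add0r.
    by move/eqP; rewrite mulf_eq0 Xw (negbTE wi) orbF => /eqP.
  split => //; move/eqP: E; rewrite x0 z0 !scale0r add0r addr0.
  by rewrite scaler_eq0 (negbTE u0) orbF => /eqP.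
exists s, u, w, Y, Z; have <- : X = l; last by [].
by apply: ev_eq => p; rewrite [in RHS](coordsK co p) ev_comb // ls1 lu lw !mulr0 !addr0 mulr1.
Qed.

Lemma line_param l : is_line l -> exists gam w, param l gam w.
Proof.
move=> ll; have [s [u [w [Y [Z co]]]]] := line_frame ll; have [l0 hl] := ll.
have E v : v = ev l v *: s + ev Y v *: u + ev Z v *: w by apply: coordsK co v.
have ev3 y z : ev l (y *: u + z *: w) = 0.
  by rewrite -[y *: u]add0r -(scale0r s) (coordsE1 co).
exists (affine u w), w; split.
- by apply: restr_evalP => t; rewrite ev_affine -[u]scale1r ev3.
- move=> v v0 lv; move: (E v) v0; rewrite lv scale0r add0r => Ev v0.
  have [Y0|Y0] := eqVneq (ev Y v) 0.
    by right; exists (ev Z v); rewrite {1}Ev Y0 scale0r add0r.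
  left; exists (ev Y v), (ev Z v / ev Y v).
  by rewrite ev_affine {1}Ev scalerDr scalerA mulrCA divff // mulr1.
- move=> h [[h0 hh]|[hh sm]] r0.
    have H t : ev h (u + t *: w) = 0 by rewrite -ev_affine restr_eval r0 horner0.
    have hu : ev h u = 0 by have := H 0; rewrite scale0r addr0.
    have hw : ev h w = 0 by have := H 1; rewrite evD1 // hu add0r scale1r.
    apply: (@same_projE _ _ (ev h s)) => //; apply: ev_eq => v; rewrite evZ {1}(E v).
    by rewrite ev_comb // hu hw !mulr0 !addr0 mulrC.
  have H t : ev h u + pol h u w * t + ev h w * t ^+ 2 + 0 * t ^+ 3 + 0 * t ^+ 4 = 0.
    rewrite !mul0r !addr0 -[RHS](horner0 t) -r0 -restr_eval ev_affine.
    by rewrite ev_add // evZ2 // polZr //; ring.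
  have [hu huw hw _ _] := quartic_eq0 H.
  have ind := coords_basis co.
  have [y [z [yz0 Es]]] : exists y z, (y, z) != (0, 0) /\ y * pol h u s + z * pol h w s = 0.
    have [hus|hus] := eqVneq (pol h u s) 0.
      by exists 1, 0; split; [rewrite xpair_eqE oner_eq0 | rewrite hus; ring].
    exists (pol h w s), (- pol h u s); split; last by ring.
    by rewrite xpair_eqE oppr_eq0 (negbTE hus) andbF.
  have v0 : y *: u + z *: w != 0.
    apply: contraNneq yz0 => v0; have [|_ -> -> //] := ind 0 y z.
    by rewrite scale0r add0r.
  have [x] := smooth_pol hh sm v0; rewrite (E x) !polDl !polZl !polDr // !polZr //.
  have [huu hww] : pol h u u = 0 /\ pol h w w = 0 by rewrite !pol_diag // hu hw mulr0.
  rewrite (polC hh s u) (polC hh s w) Es (polC hh w u) huu hww huw.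
  by rewrite !(mulr0, addr0) eqxx.
move=> d h hd hh r0; have d1 := homog_degree l0 hd hl; subst d.
have H t : ev h (u + t *: w) = 0 by rewrite -ev_affine restr_eval r0 horner0.
have hu : ev h u = 0 by have := H 0; rewrite scale0r addr0.
have hw : ev h w = 0 by have := H 1; rewrite evD1 // hu add0r scale1r.
exists (ev h s); apply: ev_eq => v; rewrite evZ {1}(E v).
by rewrite ev_comb // hu hw !mulr0 !addr0 mulrC.
Qed.

Lemma frame_eq g X Y Z u v p : g \is 2.-homog -> coords X Y Z u v p ->
  ev g u = 0 -> ev g v = 1 -> ev g p = 0 ->
  pol g u p = 1 -> pol g u v = 0 -> pol g v p = 0 -> g = X * Z + Y ^+ 2.
Proof.
move=> hg co gu gv gp gup guv gvp; apply: ev_eq => q.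
rewrite {1}(coordsK co q) ev_comb2 // gu gv gp gup guv gvp evD evM evX; ring.
Qed.

Lemma conic_param g : smooth_conic g -> exists gam w, param g gam w.
Proof.
move=> sg; have [hg sm] := sg; have [p p0 gp] := conic_point hg.
have [u [v [ind gu gv [gup guv gvp]]]] := conic_frame sg p0 gp.
have [X [Y [Z co]]] := basis3_coords ind.
have gE := frame_eq hg co gu gv gp gup guv gvp.
have E q : q = ev X q *: u + ev Y q *: v + ev Z q *: p by apply: coordsK co q.
pose gam : 'rV[{poly K}]_3 := \row_i ((u ord0 i)%:P + v ord0 i *: 'X - p ord0 i *: 'X^2).
have gamE t : ev_path gam t = 1 *: u + t *: v + (- t ^+ 2) *: p.
  by apply/rowP => i; rewrite !mxE hornerD hornerN hornerD !hornerZ hornerC hornerX hornerXn; ring.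
have quad d h : h \is d.-homog -> d = 2 -> restr gam h = 0 -> exists c, h = c *: g.
  move=> hh d2 r0; subst d.
  have H t : ev h u + pol h u v * t + (ev h v - pol h u p) * t ^+ 2 +
      (- pol h v p) * t ^+ 3 + ev h p * t ^+ 4 = 0.
    rewrite -[RHS](horner0 t) -r0 -restr_eval gamE ev_comb2 //; ring.
  have [hu huv hv hvp hp] := quartic_eq0 H.
  exists (ev h v); apply: ev_eq => q; rewrite evZ gE evD evM evX {1}(E q) ev_comb2 //.
  move/eqP: hv; rewrite subr_eq0 => /eqP hv; move/eqP: hvp; rewrite oppr_eq0 => /eqP hvp.
  rewrite hu huv hp -hv hvp; ring.
exists gam, p; split.
- apply: restr_evalP => t; rewrite gamE gE evD evM evX.
  by rewrite (coordsE1 co) (coordsE2 co) (coordsE3 co); ring.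
- move=> q q0 gq; have [x0|x0] := eqVneq (ev X q) 0.
    right; exists (ev Z q); move: gq; rewrite gE evD evM evX x0 mul0r add0r => /eqP.
    by rewrite expf_eq0 /= => /eqP Yq; rewrite {1}(E q) x0 Yq !scale0r !add0r.
  left; exists (ev X q), (ev Y q / ev X q); rewrite gamE !scalerDr !scalerA {1}(E q).
  have : ev X q * ev Z q = - ev Y q ^+ 2.
    by apply/eqP; rewrite -addr_eq0 -gq {1}gE evD evM evX.
  move=> XZ; congr (_ *: _ + _ *: _ + _ *: _); try by field.
  by apply: (mulfI x0); rewrite XZ; field.
- move=> h [[h0 hh]|sh] r0; last first.
    have [hh _] := sh; have [c Ec] := quad _ _ hh (erefl _) r0.
    exact: same_projE (smooth_conic_neq0 sh) Ec.
  have H t : ev h u + ev h v * t + (- ev h p) * t ^+ 2 + 0 * t ^+ 3 + 0 * t ^+ 4 = 0.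
    rewrite -[RHS](horner0 t) -r0 -restr_eval gamE ev_comb //; ring.
  have [hu hv hp _ _] := quartic_eq0 H.
  case/negP: h0; apply/eqP/ev_eq => q; rewrite (E q) ev_comb // hu hv.
  by move/eqP: hp; rewrite oppr_eq0 => /eqP ->; rewrite /ev meval0 !mulr0 !addr0.
move=> d h hd hh r0; apply: quad hh _ r0.
exact: homog_degree (smooth_conic_neq0 sg) hd hg.
Qed.

Lemma component_param g : component g -> exists gam w, param g gam w.
Proof. by case=> [/line_param|/conic_param]. Qed.

(** On the parametrization of g the equation of h is a nonzero polynomial in one variable; its
    roots and the missing point w give the list. *)
Lemma common_points g h : component g -> component h -> ~ same_proj h g ->
  exists cs : seq 'rV[K]_3, (forall c, c \in cs -> c != 0 /\ ev g c = 0) /\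
    forall v, v != 0 -> ev g v = 0 -> ev h v = 0 -> exists2 c, c \in cs & exists k, v = k *: c.
Proof.
move=> cg ch gh; have [gam [w pa]] := component_param cg.
have r0 : restr gam h != 0 by apply/eqP => /(param_component pa ch).
have [r Er] := closed_field_poly_normal (restr gam h).
have hh : exists d, h \is d.+1.-homog by case: ch => [[]|[]] hh; [exists 0%N | exists 1%N].
have {hh} [d hh] := hh.
exists [seq c <- w :: [seq ev_path gam t | t <- r] | (c != 0) && (ev g c == 0)]; split.
  by move=> c; rewrite mem_filter => /andP [/andP [-> /eqP ->]].
move=> v v0 gv hv.
have [d' hg] : exists d, g \is d.+1.-homog by case: cg => [[]|[]] hg; [exists 0%N | exists 1%N].
have good k c : v = k *: c -> (c != 0) && (ev g c == 0).
  move=> vc; have k0 : k != 0 by apply: contraNneq v0 => k0; rewrite vc k0 scale0r.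
  apply/andP; split; first by apply: contraNneq v0 => c0; rewrite vc c0 scaler0.
  move/eqP: gv; rewrite vc /ev (meval_homog _ _ hg) mulf_eq0 expf_eq0 /=.
  by rewrite (negbTE k0).
case: (param_cover pa v0 gv) => [[k [t vE]]|[k vE]].
  exists (ev_path gam t); last by exists k.
  rewrite mem_filter (good _ _ vE) in_cons map_f ?orbT //.
  have k0 : k != 0 by apply: contraNneq v0 => k0; rewrite vE k0 scale0r.
  have : root (restr gam h) t.
    apply/rootP; rewrite -restr_eval; apply/eqP; move/eqP: hv.
    by rewrite vE /ev (meval_homog _ _ hh) mulf_eq0 expf_eq0 /= (negbTE k0).
  by rewrite Er rootZ ?lead_coef_eq0 // root_prod_XsubC.
by exists w; [rewrite mem_filter (good _ _ vE) mem_head | exists k].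
Qed.

End Parametrization.

(** * General lines are transverse to an arrangement *)

Section Cross3.
Variable K : numFieldType.
Implicit Types a b c : 'rV[K]_3.

Lemma crossv_parallel b c : crossv b c = 0 -> c != 0 -> exists k, b = k *: c.
Proof.
move=> bc c0; have par : forall i j, b ord0 i * c ord0 j = b ord0 j * c ord0 i.
  apply: cross0_proportional => i.
  by move/rowP/(_ i): bc; rewrite !mxE.
have [j cj] := nonzero_coord c0.
exists (b ord0 j / c ord0 j); apply/rowP => i; rewrite mxE.
by apply: (mulIf cj); rewrite par mulrAC divfK.
Qed.

Lemma crossv_orth b c k l : (lform (crossv b c)).@[(k *: b + l *: c) ord0] = 0.
Proof. rewrite meval_lform sum3 !mxE /cross /=; ring. Qed.

Lemma crossv_neq0 b : b != 0 -> exists c, crossv b c != 0.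
Proof.
move=> b0; apply: contrapT => /forallNP H.
have H0 c : crossv b c = 0 by have /negP := H c; rewrite negbK => /eqP.
case/eqP: b0; apply/rowP => i; rewrite [RHS]mxE.
have /rowP C1 := H0 (delta_mx 0 o1); have /rowP C2 := H0 (delta_mx 0 o2).
have /rowP C0 := H0 (delta_mx 0 o0).
elim/ord3_ind: i.
- by have := C1 o2; rewrite !mxE /cross /= !mxE /= mulr1 mulr0 subr0.
- by have := C2 o0; rewrite !mxE /cross /= !mxE /= mulr1 mulr0 subr0.
by have := C0 o1; rewrite !mxE /cross /= !mxE /= mulr1 mulr0 subr0.
Qed.

End Cross3.

Section Separable.
Variable K : numClosedFieldType.
Implicit Types (g h l m f : {mpoly K[3]}) (u v w p a b : 'rV[K]_3) (gs : seq {mpoly K[3]}).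

Lemma distinct_cons g gs : pairwise_distinct (g :: gs) ->
  pairwise_distinct gs /\ forall h, h \in gs -> ~ same_proj g h.
Proof.
move=> H; split=> [i j ij|h]; first exact: (H i.+1 j.+1).
by case/(nthP 0) => j js <-; apply: (H 0%N j.+1).
Qed.

Lemma distinct_consI g gs : pairwise_distinct gs ->
  (forall h, h \in gs -> ~ same_proj g h) -> pairwise_distinct (g :: gs).
Proof.
by move=> pd H [|i] [|j] //= ij; [apply: H; rewrite mem_nth | apply: pd].
Qed.

Lemma same_proj_sym (V : lmodType K) (g h : V) : same_proj g h -> same_proj h g.
Proof.
by case=> c c0 ->; exists c^-1; rewrite ?invr_eq0 // scalerA mulVf // scale1r.
Qed.

(** For a conic the condition is that the discriminant of g(a + t b) in t is nonzero. If this
    vanished for all a, then 4 g(a) g(b) would be the square of a linear form in a, and g would be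
    singular. *)
Lemma separable_component g b : component g -> ev g b != 0 ->
  exists2 G : 'rV[K]_3 -> K, generic G &
    forall a, G a != 0 -> separable_poly (restr (affine a b) g).
Proof.
move=> [[g0 hg]|[hg sm]] gb.
  exists (fun=> 1); first exact: generic1.
  move=> a _; have [sz c] := restr_affine a b hg; rewrite unlock.
  have -> : (restr (affine a b) g)^`() = (ev g b)%:P.
    apply/polyP => i; rewrite coef_deriv coefC; case: i => [|i]; first by rewrite c mulr1n.
    by rewrite nth_default ?mul0rn // (leq_trans sz).
  by rewrite -alg_polyC coprimepZr ?coprimep1.
exists (fun a => pol g a b ^+ 2 - 4 * ev g a * ev g b).
  split.
    have lp : linepoly (fun a => pol g a b).
      by apply: linepoly_linear => c u v; rewrite pol_linl.
    have le : linepoly (ev g) by apply: linepoly_meval => i; apply: linepoly_coord.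
    apply: linepolyB; first exact: (linepolyM lp lp).
    exact: linepolyM (linepolyM (linepoly_cst 4) le) (linepoly_cst (ev g b)).
  apply: contrapT => /forallNP H.
  have disc a : pol g a b ^+ 2 = 4 * ev g a * ev g b.
    by apply/eqP; rewrite -subr_eq0; have /negP := H a; rewrite negbK.
  have perp0 a : pol g a b = 0 -> ev g a = 0.
    move=> ab0; have /esym /eqP := disc a; rewrite ab0 expr0n /= !mulf_eq0.
    by rewrite (negbTE gb) pnatr_eq0 orbF /= => /eqP.
  have [a [a0 ab _]] := common_zero (tangent_homog g b) (tangent_homog g b).
  rewrite ev_tangent in ab.
  have [x] := smooth_pol hg sm a0; rewrite polC //; apply/negP; rewrite negbK.
  pose k := pol g x b / pol g b b.
  have bb : pol g b b != 0 by rewrite pol_diag // mulf_neq0 // pnatr_eq0.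
  have xk : pol g (x - k *: b) b = 0.
    by rewrite -scaleNr polDl polZl /k mulNr divfK // subrr.
  have : pol g a (x - k *: b) = 0.
    have sum0 : ev g (a + (x - k *: b)) = 0 by apply: perp0; rewrite polDl ab xk addr0.
    have := ev_add hg a (x - k *: b).
    by rewrite sum0 (perp0 _ ab) (perp0 _ xk) !add0r => <-.
  by rewrite -scaleNr polDr // polZr // ab mulr0 addr0 => ->.
move=> a disc; rewrite unlock; apply/Pdiv.ClosedField.coprimepP => t /rootP gt0.
apply: contraNneq disc => dt0.
have ga : ev g a + pol g a b * t + ev g b * t ^+ 2 = 0.
  rewrite -[RHS]gt0 -restr_eval ev_affine ev_add // evZ2 // polZr //; ring.
have da : pol g a b + 2 * ev g b * t = 0.
  rewrite -[RHS]dt0 deriv_restr horner_sum.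
  transitivity (pol g b (a + t *: b)); last first.
    apply: eq_bigr => i _; rewrite hornerM -restr_eval ev_affine mxE.
    by rewrite derivD derivC derivZ derivX add0r alg_polyC hornerC.
  by rewrite polDr // polZr // pol_diag // polC //; ring.
have -> : pol g a b = - (2 * ev g b * t) by apply/eqP; rewrite -addr_eq0 da.
have -> : ev g a = ev g b * t ^+ 2.
  apply/eqP; rewrite -subr_eq0 -[X in _ == X]ga; apply/eqP.
  have -> : pol g a b = - (2 * ev g b * t) by apply/eqP; rewrite -addr_eq0 da.
  ring.
by apply/eqP; ring.
Qed.

Lemma component_homog g : component g -> exists d, g \is d.+1.-homog.
Proof. by case=> [[]|[]] hg; [exists 0%N | exists 1%N]. Qed.

(** It suffices that the line avoids the finitely many common points, so that a lies on none of
    the lines joining b to one of them. *)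
Lemma coprime_components g h b : component g -> component h -> ~ same_proj h g ->
  ev g b != 0 ->
  exists2 G : 'rV[K]_3 -> K, generic G &
    forall a, G a != 0 -> coprimep (restr (affine a b) g) (restr (affine a b) h).
Proof.
move=> cg ch gh gb; have [cs [csP cover]] := common_points cg ch gh.
have [d hg] := component_homog cg.
have b0 : b != 0 by apply: contraNneq gb => ->; rewrite (ev0 hg).
have [c0 bc0] := crossv_neq0 b0.
pose G c a := ev (lform (crossv b c)) a.
have genG c : crossv b c != 0 -> generic (G c).
  by move=> bc; apply: generic_mpoly; rewrite lform_eq0.
exists (fun a => G c0 a * \prod_(c <- cs) G c a).
  apply: genericM (genG _ bc0) (generic_prod _) => c /csP [cn0 gc]; apply: genG.
  apply/eqP => bc; have [k bk] := crossv_parallel bc cn0.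
  by move: gb; rewrite bk /ev (meval_homog _ _ hg) [_.@[c ord0]]gc mulr0 eqxx.
move=> a; rewrite mulf_eq0 negb_or => /andP [Gc0 Gcs].
apply/Pdiv.ClosedField.coprimepP => t /rootP gt0; apply/eqP => ht0.
rewrite -restr_eval ev_affine in gt0; rewrite -restr_eval ev_affine in ht0.
have v0 : a + t *: b != 0.
  apply: contraNneq Gc0 => v0; have -> : a = (- t) *: b + 0 *: c0.
    by rewrite scale0r addr0 scaleNr; apply/eqP; rewrite -addr_eq0 v0.
  by rewrite /G /ev crossv_orth.
have [c ccs [k vk]] := cover _ v0 gt0 ht0.
move: Gcs; rewrite (big_rem c) //= mulf_eq0 negb_or => /andP [/negP Gc _]; case: Gc.
have -> : a = (- t) *: b + k *: c by rewrite -vk scaleNr addrC addrK.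
by rewrite /G /ev crossv_orth.
Qed.

(** Each component meets a general line through b in distinct points, and two components meet it
    in disjoint sets. *)
Lemma separable_arrangement gs b : (forall g, g \in gs -> component g) ->
  pairwise_distinct gs -> (forall g, g \in gs -> ev g b != 0) ->
  exists2 G : 'rV[K]_3 -> K, generic G &
    forall a, G a != 0 -> separable_poly (restr (affine a b) (\prod_(g <- gs) g)).
Proof.
elim: gs => [|g gs IH] cgs pd gsb.
  exists (fun=> 1); first exact: generic1.
  by move=> a _; rewrite big_nil rmorph1 unlock /separable_poly coprime1p.
have [pd' gdist] := distinct_cons pd.
have [|h hgs|G1 gen1 sep1] := IH _ pd'.
- by move=> h hgs; apply: cgs; rewrite in_cons hgs orbT.
- by apply: gsb; rewrite in_cons hgs orbT.
have cg : component g by apply: cgs; rewrite mem_head.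
have gb : ev g b != 0 by apply: gsb; rewrite mem_head.
have [G2 gen2 sep2] := separable_component cg gb.
have /choice [G3 G3P] (h : {mpoly K[3]}) : exists G : 'rV[K]_3 -> K, h \in gs ->
    generic G /\ forall a, G a != 0 -> coprimep (restr (affine a b) g) (restr (affine a b) h).
  have [hgs|_] := boolP (h \in gs); last by exists (fun=> 1).
  have ch : component h by apply: cgs; rewrite in_cons hgs orbT.
  have [|G gen cop] := coprime_components cg ch _ gb; last by exists G.
  by move/same_proj_sym; apply: gdist.
exists (fun a => G1 a * (G2 a * \prod_(h <- gs) G3 h a)).
  apply: genericM gen1 (genericM gen2 (generic_prod _)) => h hgs.
  by have [] := G3P h hgs.
move=> a; rewrite !mulf_eq0 !negb_or => /and3P [H1 H2 H3].
rewrite big_cons rmorphM separable_mul sep1 // sep2 //= rmorph_prod.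
rewrite big_seq; elim/big_rec: _ => [|h x hgs cx]; first exact: coprimep1.
rewrite coprimepMr cx andbT; apply: (G3P h hgs).2.
by move: H3; rewrite (big_rem h) //= mulf_eq0 negb_or => /andP [].
Qed.

End Separable.

(** * Existence of good lines *)

Section GoodLines.
Variable K : numClosedFieldType.
Implicit Types (g h l m f : {mpoly K[3]}) (u v w p a b : 'rV[K]_3) (gs : seq {mpoly K[3]}).

Definition dirder v f := \sum_i v ord0 i *: f^`M(i).

Lemma ev_dirder v f u : ev (dirder v f) u = pol f v u.
Proof. by rewrite /ev raddf_sum; apply: eq_bigr => i _; rewrite /= mevalZ. Qed.

Lemma dirderM v f g : dirder v (f * g) = dirder v f * g + f * dirder v g.
Proof.
rewrite /dirder mulr_suml mulr_sumr -big_split; apply: eq_bigr => i _ /=.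
by rewrite mderivM scalerDr scalerAl scalerAr.
Qed.

Lemma dirderZ v c f : dirder v (c *: f) = c *: dirder v f.
Proof.
rewrite /dirder scaler_sumr; apply: eq_bigr => i _; rewrite mderivZ !scalerA.
by rewrite mulrC.
Qed.

Lemma dirderD v f g : dirder v (f + g) = dirder v f + dirder v g.
Proof.
by rewrite /dirder -big_split; apply: eq_bigr => i _; rewrite mderivD scalerDr.
Qed.

Lemma restr_dirder gam v f :
  restr gam (dirder v f) = \sum_i (v ord0 i)%:P * restr gam f^`M(i).
Proof.
by rewrite rmorph_sum; apply: eq_bigr => i _; rewrite /= restrZ mul_polyC.
Qed.

Lemma dirder_homog d v f : f \is d.+1.-homog -> dirder v f \is d.-homog.
Proof. by move=> hf; apply: rpred_sum => i _; rewrite rpredZ // mderiv_homog. Qed.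

Lemma pol_line l v u : l \is 1.-homog -> pol l v u = ev l v.
Proof.
move=> hl; have := congr1 (fun q => ev q v) (euler hl); rewrite scale1r => <-.
rewrite /ev raddf_sum; apply: eq_bigr => i _ /=.
by rewrite mevalM mevalXU (homog0E (mderiv_homog i hl)) /ev !mevalC.
Qed.

(** By the Leibniz rule the restriction of g divides that of D_v g times the other components. It
    is coprime to the latter and has larger degree than D_v g, so D_v g vanishes on the line. *)
Lemma const_syz_components gs a b v : (forall g, g \in gs -> component g) ->
  (forall g, g \in gs -> ev g b != 0) ->
  separable_poly (restr (affine a b) (\prod_(g <- gs) g)) ->
  restr (affine a b) (dirder v (\prod_(g <- gs) g)) = 0 ->
  forall g, g \in gs -> restr (affine a b) (dirder v g) = 0.
Proof.
elim: gs => [|g gs IH] cgs gsb //.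
rewrite big_cons dirderM rmorphD !rmorphM /= separable_mul => /and3P [sg sh cop] E.
have [d hg] := component_homog (cgs _ (mem_head _ _)).
have gb := gsb _ (mem_head _ _).
set F := restr _ g in sg cop E *; set H := restr _ (\prod_(j <- _) j) in sh cop E *.
have Fsz : (size F > d.+1)%N.
  have [_ c] := restr_affine a b hg; rewrite ltnNge; apply: contra gb => sz.
  by rewrite /ev -c nth_default.
have F0 : F != 0 by rewrite -size_poly_gt0 (leq_trans _ Fsz).
have dg0 : restr (affine a b) (dirder v g) = 0.
  apply/eqP; apply: contraTT isT => n0.
  have : F %| restr (affine a b) (dirder v g) * H.
    move/eqP: E; rewrite addr_eq0 => /eqP ->; rewrite dvdpNr.
    exact: dvdp_mulr (dvdpp F).
  rewrite Gauss_dvdpl // => /dvdp_leq - /(_ n0).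
  by rewrite leqNgt (leq_trans _ Fsz) // ltnS; have [] := restr_affine a b (dirder_homog v hg).
move=> h; rewrite in_cons => /orP [/eqP -> //|hgs].
apply: IH => //.
- by move=> k kgs; apply: cgs; rewrite in_cons kgs orbT.
- by move=> k kgs; apply: gsb; rewrite in_cons kgs orbT.
by apply/eqP; move/eqP: E; rewrite dg0 mul0r add0r mulf_eq0 (negbTE F0).
Qed.

Lemma two_lines_point l m : is_line l -> is_line m -> ~ same_proj l m ->
  exists2 q, q != 0 & forall v, ev l v = 0 -> ev m v = 0 -> exists k, v = k *: q.
Proof.
move=> ll [m0 hm] lm; have [s [u [w [Y [Z co]]]]] := line_frame ll; have [l0 hl] := ll.
have ind := coords_basis co.
have E v : v = ev l v *: s + ev Y v *: u + ev Z v *: w by apply: coordsK co v.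
pose q := ev m w *: u - ev m u *: w.
have muw : (ev m u != 0) || (ev m w != 0).
  apply: contra_notT lm; rewrite negb_or !negbK => /andP [/eqP mu /eqP mw].
  apply/same_proj_sym/(@same_projE _ _ _ (ev m s)) => //; apply: ev_eq => v; rewrite evZ {1}(E v).
  by rewrite ev_comb // mu mw !mulr0 !addr0 mulrC.
exists q.
  apply/eqP => q0; have [|_ mw mu] := ind 0 (ev m w) (- ev m u).
    by rewrite scale0r add0r scaleNr.
  by move/eqP: mu muw; rewrite oppr_eq0 mw eqxx orbF => ->.
move=> v lv mv; move: mv; rewrite {1}(E v) lv ev_comb // mul0r add0r => mv.
case/orP: muw => n0.
  exists (- (ev Z v / ev m u)); rewrite {1}(E v) lv scale0r add0r /q scalerBr !scalerA.
  have -> : ev Y v = - (ev Z v / ev m u) * ev m w.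
    by apply: (mulIf n0); move/eqP: mv; rewrite addr_eq0 => /eqP ->; field.
  by congr (_ + _); rewrite -scaleNr; congr (_ *: _); field.
exists (ev Y v / ev m w); rewrite {1}(E v) lv scale0r add0r /q scalerBr !scalerA.
have -> : ev Z v = - (ev Y v / ev m w) * ev m u.
  by apply: (mulIf n0); move/eqP: mv; rewrite addrC addr_eq0 => /eqP ->; field.
by congr (_ + _); rewrite -?scaleNr; congr (_ *: _); field.
Qed.

(** Three configurations for which a constant field tangent to every component along a general
    line must vanish: two conics, a conic and two lines, lines without a common point. *)
Definition rigid gs :=
  [\/ exists g h, [/\ g \in gs, h \in gs, smooth_conic g, smooth_conic h & ~ same_proj h g],
      exists g l m, [/\ smooth_conic g /\ g \in gs, is_line l /\ l \in gs,
        is_line m /\ m \in gs & ~ same_proj l m] |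
      (forall g, g \in gs -> is_line g) /\
      forall v, (forall g, g \in gs -> ev g v = 0) -> v = 0].

Lemma pol_generic g v : smooth_conic g -> v != 0 -> generic (fun a => pol g v a).
Proof.
move=> [hg sm] v0; split; last first.
  by have [u] := smooth_pol hg sm v0; exists u; rewrite polC.
by apply: linepoly_linear => c u w; rewrite polDr // polZr.
Qed.

(** If the gradients were proportional, then g h_j = h g_j by Euler's formula. On the conic g this
    forces g_j = 0, and a linear form that vanishes on a smooth conic is zero. *)
Lemma conics_distinct_gradients g h : smooth_conic g -> smooth_conic h -> ~ same_proj h g ->
  exists i j, g^`M(i) * h^`M(j) - g^`M(j) * h^`M(i) != 0.
Proof.
move=> sg sh gh; apply: contrapT => H; have [hg sm] := sg; have [hh _] := sh.
have E i j : g^`M(i) * h^`M(j) = g^`M(j) * h^`M(i).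
  apply/eqP; rewrite -subr_eq0; apply: contra_notT H => n0; by exists i, j.
have two0 : (2 : K) != 0 by rewrite pnatr_eq0.
have E2 j : g * h^`M(j) = h * g^`M(j).
  apply: (scalerI two0); rewrite !scalerAl -(euler hg) -(euler hh) !mulr_suml.
  by apply: eq_bigr => i _; rewrite -!mulrA E [g^`M(j) * _]mulrC.
have [gam [w pa]] := conic_param sg.
have r0 : restr gam h != 0 by apply/eqP => /(param_component pa (or_intror sh)).
have gi0 i : g^`M(i) = 0.
  apply/eqP; apply: contraT => n0; have := congr1 (restr gam) (E2 i).
  rewrite !rmorphM /= (param_restr pa) mul0r => /esym /eqP; rewrite mulf_eq0 (negbTE r0) /= => /eqP.
  have hgi := mderiv_homog i hg.
  case/(param_component pa (or_introl (conj n0 hgi))) => c c0 Ec.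
  have hgi2 : g^`M(i) \is 2.-homog by rewrite Ec rpredZ.
  by have := homog_degree n0 hgi hgi2.
have [p p0 gp] := conic_point hg.
by have [i] := sm p p0 gp; rewrite gi0 /ev meval0 eqxx.
Qed.

(** For two conics, v lies on the polar lines of b, which are distinct for general b and so
    determine v up to a scalar; the polar line of a general a does not contain it. For a conic and
    two lines, v is the common point of the lines, off the polar line of a general b. *)
Lemma rigid_generic gs : rigid gs -> exists2 G1 : 'rV[K]_3 -> K, generic G1 &
  forall b, G1 b != 0 -> exists2 G2 : 'rV[K]_3 -> K, generic G2 &
  forall a, G2 a != 0 -> forall v,
    (forall g, g \in gs -> restr (affine a b) (dirder v g) = 0) -> v = 0.
Proof.
have polL a b v g : restr (affine a b) (dirder v g) = 0 -> forall t, pol g v (a + t *: b) = 0.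
  by move=> r0 t; rewrite -ev_dirder -ev_affine restr_eval r0 horner0.
have polab a b v g : g \is 2.-homog -> restr (affine a b) (dirder v g) = 0 ->
    pol g v a = 0 /\ pol g v b = 0.
  move=> hg /polL H; have := H 0; rewrite scale0r addr0 => Ha; split => //.
  by have := H 1; rewrite scale1r polDr // Ha add0r.
case=> [[g [h [gin hin sg sh gh]]]|[g [l [m [[sg gin] [ll lin] [lm min] dist]]]]|[lines conc]].
- have [i [j n0]] := conics_distinct_gradients sg sh gh.
  have [hg sm] := sg; have [hh smh] := sh.
  exists (ev (g^`M(i) * h^`M(j) - g^`M(j) * h^`M(i))); first exact: generic_mpoly.
  move=> b Gb.
  have evb k q : ev (tangent_form k b) (delta_mx 0 q) = ev k^`M(q) b.
    rewrite ev_tangent /pol (bigD1 q) //= mxE !eqxx mul1r big1 ?addr0 // => r /negbTE rq.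
    by rewrite mxE rq andbF mul0r.
  have tl k q : k \is 2.-homog -> ev k^`M(q) b != 0 -> is_line (tangent_form k b).
    move=> hk nz; split; last exact: tangent_homog.
    by apply: contraNneq nz => t0; rewrite -evb t0 /ev meval0.
  move: Gb; rewrite evB !evM => Gb.
  have lg : is_line (tangent_form g b).
    have [z|nz] := eqVneq (ev g^`M(i) b) 0; last exact: tl nz.
    apply: (tl _ j) => //; apply: contraNneq Gb => z'; by rewrite z z' !mul0r subrr.
  have lh : is_line (tangent_form h b).
    have [z|nz] := eqVneq (ev h^`M(i) b) 0; last exact: tl nz.
    apply: (tl _ j) => //; apply: contraNneq Gb => z'; by rewrite z z' !mulr0 subrr.
  have dist : ~ same_proj (tangent_form g b) (tangent_form h b).
    case=> c c0 E; move: Gb; rewrite -!evb E !evZ -!mulrA [ev _ _ * ev _ (delta_mx 0 j)]mulrC.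
    by rewrite subrr eqxx.
  have [q q0 span] := two_lines_point lg lh dist.
  exists (pol g q); first exact: pol_generic.
  move=> a Ga v H.
  have [ga gb] := polab _ _ _ _ hg (H g gin); have [ha hb] := polab _ _ _ _ hh (H h hin).
  have [k vk] : exists k, v = k *: q by apply: span; rewrite ev_tangent.
  move: ga; rewrite vk polZl => /eqP; rewrite mulf_eq0 (negbTE Ga) orbF => /eqP ->.
  by rewrite scale0r.
- have [q q0 span] := two_lines_point ll lm dist; have [hg sm] := sg.
  exists (pol g q); first exact: pol_generic.
  move=> b Gb; exists (fun=> 1); first exact: generic1.
  move=> a _ v H; have [_ gb] := polab _ _ _ _ hg (H g gin).
  have lv n : is_line n -> n \in gs -> ev n v = 0.
    by move=> [_ hn] /H /polL /(_ 0); rewrite pol_line.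
  have [k vk] := span v (lv _ ll lin) (lv _ lm min).
  move: gb; rewrite vk polZl => /eqP; rewrite mulf_eq0 (negbTE Gb) orbF => /eqP ->.
  by rewrite scale0r.
exists (fun=> 1); first exact: generic1.
move=> b _; exists (fun=> 1); first exact: generic1.
move=> a _ v H; apply: conc => g gin; have [_ hg] := lines g gin.
by have := polL _ _ _ _ (H g gin) 0; rewrite pol_line.
Qed.

(** Choose b first, off the curve and general for [rigid_generic], and then a general a. *)
Lemma good_line_exists gs c : c != 0 -> (forall g, g \in gs -> component g) ->
  pairwise_distinct gs -> rigid gs -> exists a b, good_line (c *: \prod_(g <- gs) g) a b.
Proof.
move=> c0 cgs pd rg; have [G1 gen1 G1P] := rigid_generic rg.
have genp : generic (fun b => \prod_(g <- gs) ev g b).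
  by apply: generic_prod => g ggs; apply: generic_mpoly; apply: component_neq0; apply: cgs.
have genx : generic (ev ('X_o0 : {mpoly K[3]})).
  apply: generic_mpoly; apply/eqP => /(congr1 (fun q => ev q (const_mx 1))).
  by rewrite /ev mevalXU mxE meval0 => /eqP; rewrite oner_eq0.
have [_ [b]] := genericM genx (genericM gen1 genp).
rewrite !mulf_eq0 !negb_or => /and3P [xb G1b pb].
have gsb g : g \in gs -> ev g b != 0.
  by move=> ggs; apply: contraNneq pb => gb; rewrite (big_rem g) //= gb mul0r.
have b0 : b != 0 by apply: contraNneq xb => ->; rewrite /ev mevalXU mxE.
have [q bq] := crossv_neq0 b0.
have [G2 gen2 G2P] := G1P b G1b.
have [G3 gen3 G3P] := separable_arrangement cgs pd gsb.
have gen4 : generic (ev (lform (crossv b q))) by apply: generic_mpoly; rewrite lform_eq0.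
have [_ [a]] := genericM gen2 (genericM gen3 gen4).
rewrite !mulf_eq0 !negb_or => /and3P [G2a G3a G4a].
exists a, b; split.
- apply: contraNneq G4a => ab; have [k ->] := crossv_parallel ab b0.
  by rewrite -[k *: b]addr0 -(scale0r q) /ev crossv_orth.
- rewrite mevalZ mulf_neq0 // rmorph_prod /= prodf_seq_neq0.
  by apply/allP => g /gsb.
- by have := G3P a G3a; rewrite unlock restrZ derivZ coprimepZl // coprimepZr.
move=> v; rewrite -restr_dirder dirderZ restrZ => /eqP; rewrite scaler_eq0 (negbTE c0) => /eqP.
by move/(const_syz_components cgs gsb (G3P a G3a))/(G2P a G2a).
Qed.

End GoodLines.

(** * Components of an arrangement and syzygy criteria *)

Section Factorization.
Variable K : numClosedFieldType.
Implicit Types (g h l m f p : {mpoly K[3]}) (gs : seq {mpoly K[3]}).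

Lemma msize_homog d p : p != 0 -> p \is d.-homog -> msize p = d.+1.
Proof. by move=> p0 hp; rewrite -(mlead_deg p0) (mdeg_homog hp (mlead_supp p0)). Qed.

Lemma unit_msize p : (p \is a GRing.unit) = (msize p == 1%N).
Proof.
apply/idP/idP => [/andP [/eqP E u]|/msize_poly1P [c c0 ->]].
  by rewrite E msizeC -unitfE u.
by rewrite rmorph_unit // unitfE.
Qed.

Lemma irreducible_divisor p : (1 < msize p)%N -> exists2 g, irreducible_elt g & divides g p.
Proof.
elim: {p}(msize p) {-2}p (leqnn (msize p)) => [|n IH] p pn p1; first by lia.
have p0 : p != 0 by rewrite -msize_poly_eq0; lia.
have [irr|red] := pselect (irreducible_elt p).
  by exists p => //; exists 1; rewrite mul1r.
have [a [b [pab au bu]]] : exists a b, [/\ p = a * b, a \isn't a GRing.unit & b \isn't a GRing.unit].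
  apply: contrapT => H; apply: red; split => //; first by rewrite unit_msize; lia.
  move=> a b pab; have [|au] := boolP (a \is a GRing.unit); first by left.
  have [|bu] := boolP (b \is a GRing.unit); first by right.
  by case: H; exists a, b.
have a0 : a != 0 by apply: contraNneq p0 => a0; rewrite pab a0 mul0r.
have b0 : b != 0 by apply: contraNneq p0 => b0; rewrite pab b0 mulr0.
have := msizeM a0 b0; rewrite -pab => sz.
move: au bu; rewrite !unit_msize => au bu.
have a1 : (0 < msize a)%N by rewrite lt0n msize_poly_eq0.
have b1 : (0 < msize b)%N by rewrite lt0n msize_poly_eq0.
have an : (msize a <= n)%N.
  by move: (msize p) (msize a) (msize b) pn sz bu b1 => x y z; lia.
have a2 : (1 < msize a)%N by move: (msize a) au a1 => x; lia.
have [g irr [q Eq]] := IH a an a2.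
by exists g => //; exists (b * q); rewrite -mulrA -Eq mulrC pab mulrC.
Qed.

Lemma component_nonunit g : component g -> g \isn't a GRing.unit.
Proof.
move=> cg; have [d hg] := component_homog cg.
by rewrite unit_msize (msize_homog (component_neq0 cg) hg).
Qed.

(** Every form of positive degree has an irreducible divisor, which is a component and therefore
    homogeneous; the quotient is homogeneous of smaller degree. *)
Lemma components_of d f : f != 0 -> f \is d.-homog ->
  (forall g, irreducible_elt g -> divides g f -> component g) ->
  exists c gs, [/\ c != 0, f = c *: \prod_(g <- gs) g & forall g, g \in gs -> component g].
Proof.
elim: {d}d.+1 {-2}d (ltnSn d) f => // n IH d dn f f0 hf H.
case: d dn hf => [|d] dn hf.
  exists (f@_0%MM), [::]; split => //; last by rewrite big_nil {1}(homog0E hf) -mul_mpolyC mulr1.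
  by apply: contraNneq f0 => c0; rewrite (homog0E hf) c0 mpolyC0.
have [|g irr dv] := @irreducible_divisor f; first by rewrite (msize_homog f0 hf).
have cg := H g irr dv; have [k hg] := component_homog cg; have g0 := component_neq0 cg.
have [q Eq] := dv; have q0 : q != 0 by apply: contraNneq f0 => q0; rewrite Eq q0 mul0r.
have kd : (k <= d)%N.
  have := msizeM q0 g0; rewrite -Eq (msize_homog f0 hf) (msize_homog g0 hg).
  have : msize q != 0%N by rewrite msize_poly_eq0.
  by move: (msize q) => x; lia.
have hq : q \is (d - k).-homog.
  apply: (@homog_div _ _ (d - k) k.+1 f q g) => //.
  by rewrite addnS subnK.
have [|h hirr [r Er]|c [gs [c0 Egs cgs]]] := IH (d - k)%N _ q q0 hq; first by lia.
  by apply: H => //; exists (r * g); rewrite Eq Er mulrAC.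
exists c, (g :: gs); split => //.
  by rewrite Eq Egs big_cons -scalerAl mulrC.
by move=> h; rewrite in_cons => /orP [/eqP ->|/cgs].
Qed.

Lemma squarefree_distinct c gs : squarefree (c *: \prod_(g <- gs) g) ->
  (forall g, g \in gs -> component g) -> pairwise_distinct gs.
Proof.
elim: gs => [|g gs IH] sf cgs; first by move=> i j; rewrite ltn0 andbF.
apply: distinct_consI.
  apply: IH => [h [q Eq]|h hgs]; last by apply: cgs; rewrite in_cons hgs orbT.
  by apply: sf; exists (q * g); rewrite big_cons scalerAr Eq mulrA [g * q]mulrC.
move=> h hgs [k k0 Eh].
have ch : component h by apply: cgs; rewrite in_cons hgs orbT.
have /negP := component_nonunit ch; apply; apply: sf; exists ((c * k) *: \prod_(j <- rem h gs) j).
rewrite big_cons (big_rem h) //= Eh expr2 -!scalerA -!scalerAl; congr (_ *: (_ *: _)).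
ring.
Qed.

Lemma same_proj_refl (V : lmodType K) (g : V) : same_proj g g.
Proof. by exists 1; rewrite ?oner_eq0 ?scale1r. Qed.

Lemma pairwise_distinctP gs : pairwise_distinct gs <->
  uniq gs /\ forall g h, g \in gs -> h \in gs -> g != h -> ~ same_proj g h.
Proof.
elim: gs => [|g gs IH].
  split=> [_|_ i j]; last by rewrite ltn0 andbF.
  by split=> [|g h]; rewrite ?in_nil.
split=> [pd|[]].
  have [/IH [u dist] gd] := distinct_cons pd.
  split=> [/=|h k]; first by rewrite u andbT; apply/negP => /gd; apply; apply: same_proj_refl.
  rewrite !in_cons => /orP [/eqP ->|hgs] /orP [/eqP ->|kgs]; rewrite ?eqxx //.
  - by move=> _; apply: gd.
  - by move=> _ /same_proj_sym; apply: gd.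
  exact: dist.
rewrite cons_uniq => /andP [ngs u] dist; apply: distinct_consI.
  by apply/IH; split => // h k hgs kgs; apply: dist; rewrite in_cons ?hgs ?kgs orbT.
move=> h hgs; apply: dist; rewrite ?mem_head ?in_cons ?hgs ?orbT //.
by apply: contraNneq ngs => ->.
Qed.

Lemma distinct_filter (P : pred {mpoly K[3]}) gs : pairwise_distinct gs ->
  pairwise_distinct (filter P gs).
Proof.
move=> /pairwise_distinctP [u dist]; apply/pairwise_distinctP; split; first exact: filter_uniq.
by move=> g h; rewrite !mem_filter => /andP [_ gg] /andP [_ hh]; apply: dist.
Qed.

Lemma lines_homog gs : (forall g, g \in gs -> is_line g) ->
  \prod_(g <- gs) g \is (size gs).-homog.
Proof.
elim: gs => [|g gs IH] H; first by rewrite big_nil dhomog1.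
rewrite big_cons -[size _]/(1 + size gs)%N; apply: dhomogM; first by have [] := H g (mem_head _ _).
by apply: IH => h hgs; apply: H; rewrite in_cons hgs orbT.
Qed.

Lemma conics_homog gs : (forall g, g \in gs -> smooth_conic g) ->
  \prod_(g <- gs) g \is (size gs).*2.-homog.
Proof.
elim: gs => [|g gs IH] H; first by rewrite big_nil dhomog1.
rewrite big_cons -[(size _).*2]/(2 + (size gs).*2)%N; apply: dhomogM; first by have [] := H g (mem_head _ _).
by apply: IH => h hgs; apply: H; rewrite in_cons hgs orbT.
Qed.

Lemma components_prod_neq0 gs : (forall g, g \in gs -> component g) ->
  \prod_(g <- gs) g != 0.
Proof.
by move=> H; rewrite prodf_seq_neq0; apply/allP => g /H /component_neq0.
Qed.

(** Next to a single conic there remain at least three lines, since the degree is at least five.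
    *)
Lemma arrangement_rigid d gs : (4 < d)%N -> (forall g, g \in gs -> component g) ->
  pairwise_distinct gs -> \prod_(g <- gs) g \is d.-homog ->
  rigid gs \/ (forall g, g \in gs -> is_line g) /\
    exists2 v, v != 0 & forall g, g \in gs -> ev g v = 0.
Proof.
move=> d4 cgs /pairwise_distinctP [u dist] hd; have p0 := components_prod_neq0 cgs.
have [[g [gin sg]]|nc] := pselect (exists g, g \in gs /\ smooth_conic g); last first.
  have lines g : g \in gs -> is_line g.
    by move=> gin; case: (cgs g gin) => // sg; case: nc; exists g.
  have [H|H] := pselect (exists2 v, v != 0 & forall g, g \in gs -> ev g v = 0).
    by right.
  left; apply: Or33; split => // v gv; apply/eqP; apply: contra_notT H => v0.
  by exists v.
left; have [[h [hin sh hg]]|oneconic] := pselect (exists h, [/\ h \in gs, smooth_conic h & h != g]).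
  by apply: Or31; exists g, h; split => //; apply: dist.
have lines h : h \in rem g gs -> is_line h.
  rewrite mem_rem_uniq // inE => /andP [/= hg hin]; case: (cgs h hin) => // sh.
  by case: oneconic; exists h.
have szr : (1 < size (rem g gs))%N.
  have hr := lines_homog lines; have [hg _] := sg.
  have := hd; rewrite (big_rem g) //= => hd'.
  have p0' : g * \prod_(h <- rem g gs) h != 0.
    by move: p0; rewrite (big_rem g).
  have := homog_degree p0' hd' (dhomogM hg hr); lia.
case E : (rem g gs) lines szr => [|l [|m r]] // lines _.
have uE := rem_uniq g u; rewrite E /= in_cons negb_or in uE.
have inr h : h \in rem g gs -> h \in gs by apply: mem_rem.
have lin : l \in gs by apply: inr; rewrite E mem_head.
have min : m \in gs by apply: inr; rewrite E !in_cons eqxx orbT.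
apply: Or32; exists g, l, m; split; [by []| | |].
- by split => //; apply: lines; rewrite mem_head.
- by split => //; apply: lines; rewrite !in_cons eqxx orbT.
by apply: dist => //; move: uE => /andP [/andP []].
Qed.

End Factorization.

Lemma third_index (i j : 'I_3) : exists2 k, k != i & k != j.
Proof.
by elim/ord3_ind: i; elim/ord3_ind: j;
  first [by exists o0 | by exists o1 | by exists o2].
Qed.

Section Criteria.
Variable K : numClosedFieldType.
Variables (e : nat) (c : K) (gs : seq {mpoly K[3]}).
Let f := c *: \prod_(g <- gs) g.
Hypotheses (e4 : (4 <= e)%N) (c0 : c != 0) (hf : f \is e.+1.-homog).
Hypothesis cgs : forall g, g \in gs -> component g.
Hypothesis pd : pairwise_distinct gs.
Implicit Type rho : 'I_3 -> {mpoly K[3]}.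
Let hg i : f^`M(i) \is e.-homog := mderiv_homog i hf.
Let target := (e * (e - 1) + 1)%N.

(** The multiples of the two syzygies already fill the upper bound. *)
Lemma tjurina_of_syz rho1 rho2 : rigid gs ->
  (forall i, rho1 i \is 1.-homog) -> (forall i, rho2 i \is e.-1.-homog) ->
  dot rho1 (fun i => f^`M(i)) = 0 -> dot rho2 (fun i => f^`M(i)) = 0 ->
  (forall A B, (forall i, A * rho1 i + B * rho2 i = 0) -> A = 0 /\ B = 0) ->
  total_tjurina f target.
Proof.
move=> rg h1 h2 s1 s2 ind; have [a [b gl]] := good_line_exists c0 cgs pd rg.
apply/(tjurinaP hf); first by lia.
exists e => m em; apply/eqP; rewrite eqn_leq (good_line_bound hf m gl) /=.
have m1 : (1 <= m)%N by lia.
have m2 : (e.-1 <= m)%N by lia.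
have := dim_syz_ge hg h1 h2 s1 s2 ind m1 m2.
rewrite /syz_bound (_ : m - 1 + 2 = m + 1)%N; last by lia.
by rewrite (_ : m - e.-1 + 2 = m + 3 - e)%N //; lia.
Qed.

(** A constant syzygy v and a Koszul syzygy of degree e independent of it generate a space of
    dimension C(m+2, 2) + C(m-e+2, 2), which is greater than the bound. *)
Lemma not_tjurina_of_const v : v != 0 -> dirder v f = 0 -> ~ total_tjurina f target.
Proof.
move=> v0 vf /(tjurinaP hf) []; first by lia.
move=> m0 H.
have [i vi] := nonzero_coord v0.
have f0 : f != 0 by rewrite scaler_eq0 negb_or c0 components_prod_neq0.
have [j [ji fj]] : exists j, j != i /\ f^`M(j) != 0.
  apply: contrapT => z; have zj j : j != i -> f^`M(j) = 0.
    by move=> ji; apply/eqP; apply: contra_notT z => nz; exists j.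
  have fi : f^`M(i) = 0.
    apply: (scalerI vi); rewrite scaler0 -vf /dirder (bigD1 i) //= big1 ?addr0 // => j /zj ->.
    by rewrite scaler0.
  case/negP: f0; rewrite -(inj_eq (scalerI (_ : e.+1%:R != 0 :> K))) ?pnatr_eq0 //.
  rewrite scaler0 -(euler hf) big1 // => k _.
  by have [->|/zj ->] := eqVneq k i; rewrite ?fi mulr0.
have [k0 k0i k0j] := third_index i j.
pose r1 (q : 'I_3) := (v ord0 q)%:MP : {mpoly K[3]}.
pose r2 (q : 'I_3) := if q == j then - f^`M(k0) else if q == k0 then f^`M(j) else 0.
have h1 q : r1 q \is 0.-homog by rewrite /r1 -[_%:MP]mulr1 mul_mpolyC rpredZ // dhomog1.
have h2 q : r2 q \is e.-homog.
  rewrite /r2; case: ifP => _; first by rewrite rpredN.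
  by case: ifP => _ //; apply: rpred0.
have s1 : dot r1 (fun i => f^`M(i)) = 0.
  by rewrite -vf; apply: eq_bigr => q _; rewrite mul_mpolyC.
have s2 : dot r2 (fun i => f^`M(i)) = 0.
  rewrite /dot (bigD1 j) //= (bigD1 k0) //= /r2 eqxx (negbTE k0j) eqxx big1 ?addr0.
    by ring.
  by move=> q /andP [qj qk]; rewrite (negbTE qj) (negbTE qk) mul0r.
have ind A B : (forall q, A * r1 q + B * r2 q = 0) -> A = 0 /\ B = 0.
  move=> E; have A0 : A = 0.
    have := E i; rewrite /r2 eq_sym (negbTE ji) eq_sym (negbTE k0i) mulr0 addr0 => /eqP.
    by rewrite mulf_eq0 mpolyC_eq0 (negbTE vi) orbF => /eqP.
  split => //; have := E k0; rewrite A0 mul0r add0r /r2 (negbTE k0j) eqxx => /eqP.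
  by rewrite mulf_eq0 (negbTE fj) orbF => /eqP.
have m1 : (e <= maxn m0 e)%N by apply: leq_maxr.
have := dim_syz_ge hg h1 h2 s1 s2 ind (leq0n _) m1.
rewrite H ?leq_maxl // /syz_bound; move: (maxn m0 e) m1 => m m1.
have E1 : 'C(m + 2, 2) = (m + 1 + 'C(m + 1, 2))%N.
  by rewrite addn2 addn1 binS bin1 addnC.
have E2 : 'C(m + 3 - e, 2) = (m - e + 2 + 'C(m - e + 2, 2))%N.
  by rewrite (_ : m + 3 - e = (m - e + 2).+1)%N ?binS ?bin1 1?addnC //; lia.
rewrite subn0 E1 E2; move: ('C(_, _)) ('C(_, _)) => B1 B2; lia.
Qed.

(** The bound is 1 for m = 1 and has to be attained there and for m = e - 1, since deficits
    persist; by [vanishing_field_strict] a zero of the field off the curve would cause a deficit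
    for m = e - 1. *)
Lemma linear_syz_of_tjurina : rigid gs -> total_tjurina f target ->
  exists2 rho, [/\ forall i, rho i \is 1.-homog, exists i, rho i != 0 &
                   dot rho (fun i => f^`M(i)) = 0] &
    forall p, (forall i, ev (rho i) p = 0) -> ev f p = 0.
Proof.
move=> rg /(tjurinaP hf) []; first by lia.
move=> m0 H; have [a [b gl]] := good_line_exists c0 cgs pd rg.
have strict m1 : ~~ (\dim (syz e (fun i => f^`M(i)) m1) < syz_bound e m1)%N.
  apply/negP => lt; have := good_line_strict hf gl lt (leq_maxr m0 m1).
  by rewrite H ?leq_maxl // ltnn.
have [r r0 rs] : exists2 r, r != 0 & r \in syz e (fun i => f^`M(i)) 1.
  have : syz e (fun i => f^`M(i)) 1 != 0%VS.
    rewrite -dimv_eq0; apply: contra (strict 1%N) => /eqP ->.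
    by rewrite /syz_bound addn_gt0.
  by rewrite -vpick0 => nz; exists (vpick (syz e (fun i => f^`M(i)) 1)); rewrite ?memv_pick.
exists (fun i => val (r i)); first split.
- by move=> i; apply: dhomog_is_dhomog.
- apply: contrapT => /forallNP z; case/eqP: r0; apply/ffunP => i; apply: val_inj.
  by have /negP := z i; rewrite negbK ffunE => /eqP.
- exact/(syzP hg).
move=> p rp; apply/eqP; apply: contraT => fp; have /negP := strict e.-1; case.
have gsp g : g \in gs -> ev g p != 0.
  move=> gin; apply: contraNneq fp => gp.
  by rewrite /f evZ (big_rem g) //= evM gp mul0r mulr0.
have [G genG sepG] := separable_arrangement cgs pd gsp.
apply: (vanishing_field_strict hf (rho := fun i => val (r i)) (p := p) _ gl) => //.
- by lia.
- by move=> i; apply: dhomog_is_dhomog.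
- apply: contrapT => /forallNP z; case/eqP: r0; apply/ffunP => i; apply: val_inj.
  by have /negP := z i; rewrite negbK ffunE => /eqP.
- exact/(syzP hg).
exists G => // a' /sepG; rewrite /f unlock restrZ derivZ coprimepZl // coprimepZr //.
Qed.

End Criteria.

(** * Vector fields and line arrangements with a general line *)

Section Fields.
Variable K : numClosedFieldType.
Implicit Types (f g h l : {mpoly K[3]}) (u v w : 'rV[K]_3) (rho : 'I_3 -> {mpoly K[3]}).

Definition act rho f := dot rho (fun i => f^`M(i)).

Lemma actM rho f g : act rho (f * g) = act rho f * g + f * act rho g.
Proof.
rewrite /act /dot mulr_suml mulr_sumr -big_split; apply: eq_bigr => i _ /=.
rewrite mderivM; ring.
Qed.

Lemma actZ rho c f : act rho (c *: f) = c *: act rho f.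
Proof.
by rewrite /act /dot scaler_sumr; apply: eq_bigr => i _; rewrite mderivZ scalerAr.
Qed.

Lemma actD rho f g : act rho (f + g) = act rho f + act rho g.
Proof.
by rewrite /act /dot -big_split; apply: eq_bigr => i _; rewrite mderivD mulrDr.
Qed.

Lemma act_comb (A B : {mpoly K[3]}) rho1 rho2 f :
  act (fun i => A * rho1 i + B * rho2 i) f = A * act rho1 f + B * act rho2 f.
Proof.
rewrite /act /dot !mulr_sumr -big_split; apply: eq_bigr => i _ /=; ring.
Qed.

Lemma act0 f rho : (forall i, rho i = 0) -> act rho f = 0.
Proof. by move=> r0; rewrite /act /dot big1 // => i _; rewrite r0 mul0r. Qed.

Lemma act_homog d rho f : (forall i, rho i \is 1.-homog) -> f \is d.-homog ->
  act rho f \is d.-homog.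
Proof.
move=> hr; case: d => [|d] hf; apply: rpred_sum => i _.
  by rewrite (homog0E hf) mderivC mulr0 rpred0.
exact: (@dhomogM _ _ _ 1 _ d _ (hr i) (mderiv_homog i hf)).
Qed.

Definition vf (a : {mpoly K[3]}) u b v c w (i : 'I_3) : {mpoly K[3]} :=
  u ord0 i *: a + v ord0 i *: b + w ord0 i *: c.

Lemma act_vf a u b v c w f :
  act (vf a u b v c w) f = a * dirder u f + b * dirder v f + c * dirder w f.
Proof.
rewrite /act /dot /dirder !mulr_sumr -!big_split; apply: eq_bigr => i _ /=.
rewrite /vf -!mul_mpolyC; ring.
Qed.

Lemma vf_homog d a u b v c w : a \is d.-homog -> b \is d.-homog -> c \is d.-homog ->
  forall i, vf a u b v c w i \is d.-homog.
Proof. by move=> ha hb hc i; rewrite !rpredD // rpredZ. Qed.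

Lemma dirder_line v l : l \is 1.-homog -> dirder v l = (ev l v)%:MP.
Proof. by move=> hl; apply: ev_eq => u; rewrite ev_dirder pol_line // /ev mevalC. Qed.

Lemma act_vf_line a u b v c w l : l \is 1.-homog ->
  act (vf a u b v c w) l = ev l u *: a + ev l v *: b + ev l w *: c.
Proof. by move=> hl; rewrite act_vf !dirder_line // ![_ * _%:MP]mulrC !mul_mpolyC. Qed.

Lemma act_prod (lam : {mpoly K[3]} -> K) rho gs :
  (forall g, g \in gs -> act rho g = lam g *: g) ->
  act rho (\prod_(g <- gs) g) = (\sum_(g <- gs) lam g) *: \prod_(g <- gs) g.
Proof.
elim: gs => [|g gs IH] H.
  rewrite !big_nil scale0r /act /dot big1 // => i _.
  by rewrite -mpolyC1 mderivC mulr0.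
rewrite !big_cons actM H ?mem_head // IH => [|h hgs]; last by apply: H; rewrite in_cons hgs orbT.
by rewrite -scalerAl -scalerAr scalerDl.
Qed.

Lemma act_euler d f : f \is d.-homog -> act (fun i => 'X_i) f = d%:R *: f.
Proof. by move=> hf; rewrite -(euler hf). Qed.

End Fields.

Section EigenCriterion.
Variable K : numClosedFieldType.
Variables (e : nat) (c : K) (l : {mpoly K[3]}) (gs : seq {mpoly K[3]}).
Let f := c *: \prod_(g <- l :: gs) g.
Hypotheses (e4 : (4 <= e)%N) (c0 : c != 0) (hf : f \is e.+1.-homog).
Hypothesis cgs : forall g, g \in l :: gs -> component g.
Hypothesis pd : pairwise_distinct (l :: gs).
Hypothesis rg : rigid (l :: gs).
Hypothesis ll : is_line l.

Lemma rigid_no_const v : dirder v f = 0 -> v = 0.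
Proof.
move=> vf0; have [a [b [_ _ _ const]]] := good_line_exists c0 cgs pd rg.
by apply: const; rewrite -restr_dirder -/f vf0 rmorph0.
Qed.

(** Write f = l h. The Hamiltonian field of h in the plane directions v, w on which l is constant
    kills both l and h, and it is independent of any field that moves l. *)
Lemma tjurina_of_field rho (k : K) : (forall i, rho i \is 1.-homog) -> act rho f = 0 ->
  k != 0 -> act rho l = k *: l -> total_tjurina f (e * (e - 1) + 1).
Proof.
move=> h1 rf k0 rl; have [s [v [w [Y [Z co]]]]] := line_frame ll; have [l0 hl] := ll.
pose h := c *: \prod_(g <- gs) g.
have fE : f = l * h by rewrite /f /h big_cons scalerAr.
have hh : h \is e.-homog.
  by apply: (@homog_div _ _ e 1 f h l) => //; [rewrite addn1 | rewrite mulrC].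
pose rho2 := vf (dirder w h) v (- dirder v h) w 0 s.
have he : e = e.-1.+1 by lia.
have hh' : h \is e.-1.+1.-homog by rewrite -he.
have hd x : dirder x h \is e.-1.-homog by apply: dirder_homog.
have h2 : forall i, rho2 i \is e.-1.-homog.
  by apply: vf_homog; rewrite ?rpredN ?rpred0.
have lv : ev l v = 0 by have := coordsE1 co 0 1 0; rewrite !scale0r add0r addr0 scale1r.
have lw : ev l w = 0 by have := coordsE1 co 0 0 1; rewrite !scale0r !add0r scale1r.
have r2l : act rho2 l = 0.
  by rewrite act_vf_line // lv lw !scale0r scaler0 !addr0.
have r2h : act rho2 h = 0 by rewrite act_vf mul0r addr0; ring.
have r2f : act rho2 f = 0 by rewrite fE actM r2l r2h mul0r mulr0 addr0.
apply: (tjurina_of_syz e4 c0 hf cgs pd rg h1 h2 rf r2f) => A B E.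
have A0 : A = 0.
  have := act0 l E; rewrite act_comb rl r2l mulr0 addr0 -scalerAr => /eqP.
  by rewrite scaler_eq0 (negbTE k0) mulf_eq0 (negbTE l0) orbF => /eqP.
split => //; apply/eqP; apply: contraT => B0.
have r20 i : rho2 i = 0.
  by have /eqP := E i; rewrite A0 mul0r add0r mulf_eq0 (negbTE B0) => /eqP.
have hY := coords_homog2 co.
have Yv : ev Y v = 1 by have := coordsE2 co 0 1 0; rewrite !scale0r add0r addr0 scale1r.
have Yw : ev Y w = 0 by have := coordsE2 co 0 0 1; rewrite !scale0r !add0r scale1r.
have wh : dirder w h = 0.
  have := act0 Y r20; rewrite act_vf_line // Yv Yw scale0r scale1r scaler0 !addr0 //.
have w0 : w = 0.
  by apply: rigid_no_const; rewrite fE dirderM wh mulr0 dirder_line // lw mpolyC0 mul0r addr0.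
by have := coordsE3 co 0 0 1; rewrite w0 !scale0r !scaler0 !addr0 (ev0 (coords_homog3 co)) => /eqP;
  rewrite eq_sym oner_eq0.
Qed.

(** Subtracting a multiple of the Euler field makes the field kill f; the hypothesis on
    eigenvalues says that it still moves l. *)
Lemma tjurina_eigen rho (lam : {mpoly K[3]} -> K) : (forall i, rho i \is 1.-homog) ->
  (forall g, g \in l :: gs -> act rho g = lam g *: g) ->
  e.+1%:R * lam l != \sum_(g <- l :: gs) lam g ->
  total_tjurina f (e * (e - 1) + 1).
Proof.
move=> hr eig ne; set k := \sum_(g <- _) _ in ne.
pose rho1 i := (e.+1%:R : K)%:MP * rho i + (- k)%:MP * 'X_i.
apply: (@tjurina_of_field rho1 (e.+1%:R * lam l - k)).
- move=> i; rewrite /rho1 !mul_mpolyC; apply: rpredD; apply: rpredZ; first exact: hr.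
  by rewrite dhomogX /= mdeg1.
- rewrite act_comb (act_euler hf) /f actZ (act_prod eig) -/k !mul_mpolyC !scalerA.
  by rewrite -scalerDl; apply/eqP; rewrite scaler_eq0; apply/orP; left; apply/eqP; ring.
- by rewrite subr_eq0.
have [_ hl] := ll.
rewrite act_comb (act_euler hl) eig ?mem_head // !mul_mpolyC !scalerA -scalerDl mulr1.
by [].
Qed.

End EigenCriterion.

(** The field l0 d_p scales l0 and kills the lines through p. *)
Lemma type_L_tjurina (K : numClosedFieldType) e (f : {mpoly K[3]}) : (4 <= e)%N ->
  f \is e.+1.-homog -> type_L e.+1 f -> total_tjurina f (e * (e - 1) + 1).
Proof.
move=> e4 hf [ls [l0 [p [szls lls pdls [p0 lsp ll0 l0p [c c0 fE]]]]]].
have nl g : g \in ls -> ~ same_proj l0 g.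
  move=> gls [k k0 E]; move: l0p; rewrite E evZ (lsp g gls) mulr0 eqxx //.
have pd : pairwise_distinct (l0 :: ls) by apply: distinct_consI.
have lines g : g \in l0 :: ls -> is_line g.
  by rewrite in_cons => /orP [/eqP ->|/lls].
have cgs g : g \in l0 :: ls -> component g by move/lines; left.
have rg : rigid (l0 :: ls).
  apply: Or33; split => // v gv.
  case: ls szls lls pdls lsp {nl pd lines cgs fE} gv => [|l [|m r]]; try by move=> /= E; lia.
  move=> _ lls pdls lsp gv.
  have lm : ~ same_proj l m by apply: (pdls 0%N 1%N).
  have lin : l \in [:: l, m & r] by rewrite mem_head.
  have min : m \in [:: l, m & r] by rewrite !in_cons eqxx orbT.
  have [q q0 span] := two_lines_point (lls l lin) (lls m min) lm.
  have [k pk] := span p (lsp l lin) (lsp m min).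
  have k0 : k != 0 by apply: contraNneq p0 => k0; rewrite pk k0 scale0r.
  have l0q : ev l0 q != 0.
    by apply: contraNneq l0p => l0q; have [_ hl0] := ll0; rewrite pk evZ1 // l0q mulr0.
  have [j vj] : exists j, v = j *: q.
    by apply: span; apply: gv; rewrite in_cons ?lin ?min orbT.
  have := gv l0 (mem_head _ _); have [_ hl0] := ll0; rewrite vj evZ1 // => /eqP.
  by rewrite mulf_eq0 (negbTE l0q) orbF => /eqP ->; rewrite scale0r.
pose rho := vf l0 p 0 p 0 p.
pose lam g := ev g p.
rewrite fE; have [_ hl0] := ll0.
apply: (@tjurina_eigen _ e c l0 ls e4 c0 _ cgs pd rg ll0 rho lam).
- by rewrite -fE.
- by apply: vf_homog; rewrite ?rpred0.
- move=> g gin; have [_ hg] := lines g gin.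
  rewrite act_vf_line // !scaler0 !addr0 /lam; move: gin; rewrite in_cons => /orP [/eqP -> //|gls].
  by rewrite lsp // !scale0r.
rewrite big_cons big_seq big1 ?addr0; last by move=> g /lsp.
rewrite /lam -subr_eq0 -[X in _ - X]mul1r -mulrBl mulf_neq0 // subr_eq0.
by rewrite pnatr_eq1; lia.
Qed.

(** * Normal forms of the pencils *)

Section Pencils.
Variable K : numClosedFieldType.
Implicit Types (f g h l m : {mpoly K[3]}) (u v w p : 'rV[K]_3) (q : 'I_2 -> {mpoly K[3]}).

Lemma member2 q (x : 'rV[K]_2) : member q x = x ord0 ord0 *: q ord0 + x ord0 ord_max *: q ord_max.
Proof.
rewrite /member !big_ord_recl big_ord0 addr0.
by congr (_ + _ ord0 _ *: q _); apply: val_inj.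
Qed.

Lemma member_scale q (c : K) (x : 'rV[K]_2) : member q (c *: x) = c *: member q x.
Proof. by rewrite !member2 !mxE scalerDr !scalerA. Qed.

Lemma memberD q (x y : 'rV[K]_2) : member q (x + y) = member q x + member q y.
Proof. rewrite !member2 !mxE !scalerDl; ring. Qed.

(** Smoothness of members being generic, two independent parameters with smooth members exist. *)
Lemma two_members q : is_pencil q -> general_member_smooth q ->
  exists g h, [/\ smooth_member q g, smooth_member q h, ~ same_proj h g &
    forall x, exists a b, member q x = a *: g + b *: h].
Proof.
move=> [hq inj] [D D0 sm].
have gen0 : generic (fun x : 'rV[K]_2 => x ord0 ord0).
  by split; [apply: linepoly_coord | exists (const_mx 1); rewrite mxE oner_eq0].
have [_ [x]] := genericM gen0 (generic_mpoly D0).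
rewrite mulf_eq0 negb_or => /andP [x0 Dx].
have gen1 : generic (fun y : 'rV[K]_2 =>
    x ord0 ord0 * y ord0 ord_max - x ord0 ord_max * y ord0 ord0).
  split; first by apply: linepoly_linear => c u v; rewrite !mxE; ring.
  exists (delta_mx 0 ord_max); rewrite !mxE /= mulr1 mulr0 subr0 //.
have [_ [y]] := genericM gen1 (generic_mpoly D0).
rewrite mulf_eq0 negb_or => /andP [det Dy].
exists (member q x), (member q y); split.
- by split; [apply: sm | exists x].
- by split; [apply: sm | exists y].
- case=> c c0; rewrite -member_scale => E.
  have : member q (y - c *: x) = 0.
    by rewrite memberD -scaleN1r member_scale E scaleN1r subrr.
  by move/inj/eqP; rewrite subr_eq0 => /eqP yE; move: det; rewrite yE !mxE mulrCA [X in _ - X]mulrCA [X in c * X]mulrC subrr eqxx.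
move=> z; pose d := x ord0 ord0 * y ord0 ord_max - x ord0 ord_max * y ord0 ord0.
exists ((z ord0 ord0 * y ord0 ord_max - z ord0 ord_max * y ord0 ord0) / d).
exists ((x ord0 ord0 * z ord0 ord_max - x ord0 ord_max * z ord0 ord0) / d).
rewrite -!member_scale -memberD; congr member.
have i2 (i : 'I_2) : i = ord0 \/ i = ord_max.
  by case: i => [[|[|i]] Hi] //; [left | right]; apply: val_inj.
by apply/rowP => i; rewrite !mxE /d; case: (i2 i) => ->; field.
Qed.

Lemma coords_at X Y Z u v w : coords X Y Z u v w ->
  [/\ [/\ ev X u = 1, ev X v = 0 & ev X w = 0], [/\ ev Y u = 0, ev Y v = 1 & ev Y w = 0] &
      [/\ ev Z u = 0, ev Z v = 0 & ev Z w = 1]].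
Proof.
move=> co; have E1 := coordsE1 co; have E2 := coordsE2 co; have E3 := coordsE3 co.
have eu : u = 1 *: u + 0 *: v + 0 *: w by rewrite !scale0r !addr0 scale1r.
have ew : w = 0 *: u + 0 *: v + 1 *: w by rewrite !scale0r !add0r scale1r.
have ev' : v = 0 *: u + 1 *: v + 0 *: w by rewrite !scale0r addr0 add0r scale1r.
have X1 : [/\ ev X u = 1, ev X v = 0 & ev X w = 0].
  by split; [rewrite {1}eu E1 | rewrite {1}ev' E1 | rewrite {1}ew E1].
have Y1 : [/\ ev Y u = 0, ev Y v = 1 & ev Y w = 0].
  by split; [rewrite {1}eu E2 | rewrite {1}ev' E2 | rewrite {1}ew E2].
by split => //; split; [rewrite {1}eu E3 | rewrite {1}ev' E3 | rewrite {1}ew E3].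
Qed.

Lemma coords_neq0 X Y Z u v w : coords X Y Z u v w -> [/\ X != 0, Y != 0 & Z != 0].
Proof.
move=> /coords_at [[Xu _ _] [_ Yv _] [_ _ Zw]].
have n0 l p : ev l p = 1 -> l != 0.
  by move=> E; apply: contra_eq_neq E => ->; rewrite /ev meval0 eq_sym oner_eq0.
by split; [apply: n0 Xu | apply: n0 Yv | apply: n0 Zw].
Qed.

Lemma frame_neq0 X Y Z u v w : coords X Y Z u v w -> [/\ u != 0, v != 0 & w != 0].
Proof.
move=> co; have [[Xu _ _] [_ Yv _] [_ _ Zw]] := coords_at co.
have n0 l p : l \is 1.-homog -> ev l p = 1 -> p != 0.
  by move=> hl E; apply: contra_eq_neq E => ->; rewrite (ev0 hl) eq_sym oner_eq0.
by split; [apply: n0 (coords_homog1 co) Xu | apply: n0 (coords_homog2 co) Yv |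
           apply: n0 (coords_homog3 co) Zw].
Qed.

Lemma coords_line X Y Z u v w l : coords X Y Z u v w -> l \is 1.-homog ->
  l = ev l u *: X + ev l v *: Y + ev l w *: Z.
Proof.
move=> co hl; apply: ev_eq => p; rewrite {1}(coordsK co p) ev_comb // !evD !evZ; ring.
Qed.

Lemma XZYY_homog X Y Z u v w (a b : K) : coords X Y Z u v w ->
  a *: (X * Z) + b *: Y ^+ 2 \is 2.-homog.
Proof.
move=> co; have [[hX hY] hZ] := (coords_homog1 co, coords_homog2 co, coords_homog3 co).
apply: rpredD; apply: rpredZ; first exact: (dhomogM hX hZ).
by rewrite expr2; exact: (dhomogM hY hY).
Qed.

Lemma smooth_conic_no_line g l : smooth_conic g -> is_line l -> ~ divides l g.
Proof.
move=> sg ll [k gE]; have [gam [w pa]] := line_param ll.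
have r0 : restr gam g = 0 by rewrite gE rmorphM /= (param_restr pa) mulr0.
have [c c0 Eg] := param_component pa (or_intror sg) r0.
have [l0 hl] := ll; have [hg _] := sg; have g0 := smooth_conic_neq0 sg.
have hg1 : g \is 1.-homog by rewrite Eg rpredZ.
by have := homog_degree g0 hg hg1.
Qed.

Lemma crossv_distinct p p' : p != 0 -> ~ same_proj p p' -> p' != 0 -> crossv p p' != 0.
Proof.
move=> p0 dist p'0; apply/eqP => c0; have [k Ek] := crossv_parallel c0 p'0.
by apply: dist; exists k => //; apply: contraNneq p0 => k0; rewrite Ek k0 scale0r.
Qed.

(** Otherwise the conic would contain the line through p and p'. *)
Lemma smooth_conic_secant g p p' : smooth_conic g -> p != 0 -> p' != 0 -> ~ same_proj p p' ->
  ev g p = 0 -> ev g p' = 0 -> pol g p p' != 0.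
Proof.
move=> sg p0 p'0 dist gp gp'; have [hg sm] := sg; apply/eqP => pp'.
have cr := crossv_distinct p0 dist p'0.
apply: (@smooth_conic_no_line g (lform (crossv p p')) sg).
  by split; [rewrite lform_eq0 | apply: lform_homog].
apply: (restr_affine_eq0 cr hg); apply: restr_evalP => t.
by rewrite ev_affine ev_add // evZ2 // polZr // gp gp' pp'; ring.
Qed.

Lemma pol_scale (c : K) g u v : pol (c *: g) u v = c * pol g u v.
Proof.
by rewrite /pol mulr_sumr; apply: eq_bigr => i _; rewrite mderivZ evZ mulrCA.
Qed.

(** All smooth members share two points p, p' and the tangent lines there, hence the pole v of the
    line p p'. In the frame p', v, p the mixed coefficients therefore vanish. *)
Lemma bitangent_coords q p p' : bitangent_pencil q p p' ->
  exists X Y Z v, coords X Y Z p' v p /\ forall g, smooth_member q g ->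
    exists a b, [/\ a != 0, b != 0 & g = a *: (X * Z) + b *: Y ^+ 2].
Proof.
move=> [pq gm [p0 p'0 dist] bit].
have [g0 [h0 [sg0 sh0 dgh span]]] := two_members pq gm.
have partner g : smooth_member q g -> exists2 h, smooth_member q h & ~ same_proj g h.
  move=> sg; have [gg0|] := pselect (same_proj g g0); last by exists g0.
  exists h0 => // gh0; apply: dgh; case: gg0 => a a0 Ea; case: gh0 => b b0 Eb.
  exists (b^-1 * a); first by rewrite mulf_neq0 // invr_eq0.
  by rewrite -scalerA -Ea Eb scalerA mulVf // scale1r.
have through g : smooth_member q g -> ev g p = 0 /\ ev g p' = 0.
  move=> sg; have [h sh gh] := partner g sg; have [cm _ _] := bit g h sg sh gh.
  split; [have [_ [|-> _]] := cm p p0 | have [_ [|-> _]] := cm p' p'0] => //.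
  - by left; apply: same_proj_refl.
  by right; apply: same_proj_refl.
have [hg0 sm0] := sg0.1; have [gp gp'] := through g0 sg0.
have pp' := smooth_conic_secant sg0.1 p0 p'0 dist gp gp'.
have [v [v0 vp vp']] := common_zero (tangent_homog g0 p) (tangent_homog g0 p').
rewrite !ev_tangent in vp vp'.
have gpp : pol g0 p p = 0 by rewrite pol_diag // gp mulr0.
have gpp' : pol g0 p' p' = 0 by rewrite pol_diag // gp' mulr0.
have ind : basis3 p' v p.
  move=> x y z E.
  have x0 : x = 0.
    have : pol g0 (x *: p' + y *: v + z *: p) p = 0 by rewrite E -(scale0r 0) polZl mul0r.
    rewrite !polDl !polZl vp gpp !mulr0 !addr0 (polC hg0) => /eqP.
    by rewrite mulf_eq0 (negbTE pp') orbF => /eqP.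
  have z0 : z = 0.
    have : pol g0 (x *: p' + y *: v + z *: p) p' = 0 by rewrite E -(scale0r 0) polZl mul0r.
    rewrite !polDl !polZl vp' gpp' !mulr0 !add0r => /eqP.
    by rewrite mulf_eq0 (negbTE pp') orbF => /eqP.
  split => //; move/eqP: E; rewrite x0 z0 !scale0r add0r addr0 scaler_eq0 (negbTE v0) orbF.
  by move/eqP.
have [X [Y [Z co]]] := basis3_coords ind; exists X, Y, Z, v; split => // g sg.
have [hg sm] := sg.1; have [gp1 gp1'] := through g sg.
have [gvp gvp'] : pol g v p = 0 /\ pol g v p' = 0.
  have [[k k0 ->]|gg0] := pselect (same_proj g g0).
    by rewrite !pol_scale vp vp' mulr0.
  have [_ [[k k0 E] _] [[k' k0' E'] _]] := bit g g0 sg sg0 gg0.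
  by rewrite -!ev_tangent E E' !evZ !ev_tangent vp vp' !mulr0.
have gE : g = pol g p' p *: (X * Z) + ev g v *: Y ^+ 2.
  apply: ev_eq => x; rewrite {1}(coordsK co x) ev_comb2 // gp1 gp1' gvp (polC hg p' v) gvp'.
  by rewrite evD !evZ evM evX; ring.
exists (pol g p' p), (ev g v); split => //.
  by rewrite polC //; apply: smooth_conic_secant sg.1 p0 p'0 dist gp1 gp1'.
apply/eqP => gv; have [x] := smooth_pol hg sm v0.
rewrite (coordsK co x) !polDl !polZl (polC hg p' v) (polC hg p v) gvp gvp' pol_diag // gv.
by rewrite !mulr0 !addr0 eqxx.
Qed.

Lemma nonvanishing_const (r : {poly K}) : (forall t, r.[t] != 0) -> size r = 1%N.
Proof.
move=> H; apply/eqP/negPn/negP => /closed_rootP [t /rootP rt].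
by have := H t; rewrite rt eqxx.
Qed.

(** In a frame where one member g is XZ + Y^2, another member h restricts to the parametrization u
    + t v - t^2 p of g as a polynomial of degree at most four without roots, since p is the only
    common point. It is constant, and this determines h up to two coefficients. *)
Lemma hyperosculating_coords q p : hyperosculating_pencil q p ->
  exists X Y Z u v, coords X Y Z u v p /\ forall g, smooth_member q g ->
    exists a b, b != 0 /\ g = a *: X ^+ 2 + b *: (X * Z + Y ^+ 2).
Proof.
move=> [pq gm p0 base]; have [g [h [sg sh dgh span]]] := two_members pq gm.
have base_member k : smooth_member q k -> ev k p = 0.
  move=> [_ [x ->]]; have H i := (base p p0).2 (same_proj_refl p) i.
  by rewrite member2 evD !evZ !H !mulr0 addr0.
have common w : w != 0 -> ev g w = 0 -> ev h w = 0 -> same_proj w p.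
  move=> w0 gw hw; apply/base => // i.
  have [a [b E]] := span (delta_mx 0 i).
  have -> : q i = member q (delta_mx 0 i).
    rewrite /member (bigD1 i) //= mxE !eqxx scale1r big1 ?addr0 // => j /negbTE ji.
    by rewrite mxE ji andbF scale0r.
  by rewrite E evD !evZ gw hw !mulr0 addr0.
have [hg _] := sg.1; have [hh _] := sh.1; have gp := base_member g sg.
have [u [v [ind gu gv [gup guv gvp]]]] := conic_frame sg.1 p0 gp.
have [X [Y [Z co]]] := basis3_coords ind; exists X, Y, Z, u, v; split => //.
have gE := frame_eq hg co gu gv gp gup guv gvp.
have [[Xu Xv Xp] [Yu Yv Yp] [Zu Zv Zp]] := coords_at co.
pose r : {poly K} := (ev h u)%:P + (pol h u v) *: 'X + (ev h v - pol h u p) *: 'X^2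
   + (- pol h v p) *: 'X^3 + (ev h p) *: 'X^4.
have rE t : r.[t] = ev h (1 *: u + t *: v + (- t ^+ 2) *: p).
  by rewrite ev_comb2 // /r !hornerD !hornerZ hornerC !hornerXn hornerX; ring.
have r1 : size r = 1%N.
  apply: nonvanishing_const => t; rewrite rE; apply/eqP => ht.
  set w := _ + _ in ht.
  have Xw : ev X w = 1 by rewrite (coordsE1 co).
  have w0 : w != 0.
    by apply: contra_eq_neq Xw => ->; rewrite (ev0 (coords_homog1 co)) eq_sym oner_eq0.
  have gw : ev g w = 0.
    by rewrite gE evD evM evX (coordsE1 co) (coordsE2 co) (coordsE3 co); ring.
  have [k _ Ek] := common w w0 gw ht.
  move: Xw; rewrite Ek evZ1 ?(coords_homog1 co) // Xp mulr0 => /eqP.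
  by rewrite eq_sym oner_eq0.
have coef i : (0 < i)%N -> r`_i = 0 by move=> i0; rewrite nth_default // r1.
have := (coef 1%N isT, coef 2 isT, coef 3 isT, coef 4 isT).
rewrite /r !coefD !coefZ !coefC !coefXn !coefX /= !(mulr0, mulr1, addr0, add0r).
case=> [[[huv /eqP]]]; rewrite subr_eq0 => /eqP hv /eqP; rewrite oppr_eq0 => /eqP hvp hp.
have hE : h = ev h u *: X ^+ 2 + ev h v *: (X * Z + Y ^+ 2).
  apply: ev_eq => x; rewrite {1}(coordsK co x) ev_comb2 // huv -hv hvp hp.
  by rewrite evD !evZ !evD evM !evX; ring.
move=> k [sk [x kE]]; have [a [b E]] := span x.
have {}kE : k = (b * ev h u) *: X ^+ 2 + (a + b * ev h v) *: (X * Z + Y ^+ 2).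
  by rewrite kE E {1}gE {1}hE [b *: _]scalerDr !scalerA scalerDl addrCA.
exists (b * ev h u), (a + b * ev h v); split => //; apply/eqP => z.
have [hk smk] := sk; have [x'] := smooth_pol hk smk p0.
rewrite kE z scale0r addr0 pol_scale expr2 -ev_dirder dirderM !dirder_line ?(coords_homog1 co) //.
by rewrite evD !evM Xp !mulr0 mul0r addr0 mulr0 eqxx.
Qed.

Lemma pol_XZYY X Y Z u v w (a b : K) x y : coords X Y Z u v w ->
  pol (a *: (X * Z) + b *: Y ^+ 2) x y =
  a * (ev X x * ev Z y + ev X y * ev Z x) + 2 * b * (ev Y x * ev Y y).
Proof.
move=> co; have [[hX hY] hZ] := (coords_homog1 co, coords_homog2 co, coords_homog3 co).
have -> : pol (a *: (X * Z) + b *: Y ^+ 2) x y =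
    a * pol (X * Z) x y + b * pol (Y ^+ 2) x y.
  rewrite -!pol_scale -!ev_dirder -evD; congr ev.
  by rewrite /dirder -big_split; apply: eq_bigr => i _; rewrite /= mderivD scalerDr.
rewrite -!ev_dirder expr2 !dirderM !dirder_line // !evD !evM /ev !mevalC; ring.
Qed.

End Pencils.

(** * Arrangements in a bitangent pencil are maximal *)

Section TypesAreMaximal.
Variable K : numClosedFieldType.
Implicit Types (f g h l m : {mpoly K[3]}) (u v w p : 'rV[K]_3) (q : 'I_2 -> {mpoly K[3]}).

Lemma line_not_conic l g : is_line l -> smooth_conic g -> ~ same_proj l g.
Proof.
move=> [l0 hl] [hg _] [k k0 E].
have hl2 : l \is 2.-homog by rewrite E rpredZ.
by have := homog_degree l0 hl hl2.
Qed.

Lemma distinct_nil : pairwise_distinct ([::] : seq {mpoly K[3]}).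
Proof. by move=> i j; rewrite ltn0 andbF. Qed.

Lemma distinct_seq1 g : pairwise_distinct [:: g].
Proof. exact: distinct_consI distinct_nil _. Qed.

Lemma distinct_lines_conics ls gs : pairwise_distinct ls -> pairwise_distinct gs ->
  (forall l, l \in ls -> is_line l) -> (forall g, g \in gs -> smooth_conic g) ->
  pairwise_distinct (ls ++ gs).
Proof.
move=> pl pg lin con; elim: ls pl lin => [|l ls IH] // /distinct_cons [pl dl] lin /=.
apply: distinct_consI; first by apply: IH => // k kls; apply: lin; rewrite in_cons kls orbT.
move=> h; rewrite mem_cat => /orP [/dl //|/con ch].
by apply: line_not_conic ch; apply: lin; rewrite mem_head.
Qed.

Lemma rigid_with_conic d L g : (4 < d)%N -> (forall h, h \in L -> component h) ->
  pairwise_distinct L -> \prod_(h <- L) h \is d.-homog -> g \in L -> smooth_conic g -> rigid L.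
Proof.
move=> d4 cL pL hL gL sg; case: (arrangement_rigid d4 cL pL hL) => // [[lin _]].
by case: (line_not_conic (lin g gL) sg (same_proj_refl g)).
Qed.

(** The field X d/dX - Z d/dZ kills XZ and Y and has weights 1 and -1 on X and Z. As Z occurs at
    most once, the weights of the components add up to 0 or 1, which differs from e + 1 times the
    weight of l. *)
Lemma bitangent_lines_tjurina e (X Y Z : {mpoly K[3]}) (u v w : 'rV[K]_3) (c : K) l (r gs : seq {mpoly K[3]}) :
  (4 <= e)%N -> coords X Y Z u v w -> c != 0 -> gs != [::] ->
  (forall g, g \in gs -> smooth_conic g /\ exists a b, g = a *: (X * Z) + b *: Y ^+ 2) ->
  (exists2 k, k != 0 & l = k *: X) ->
  (forall m, m \in r -> is_line m /\ (exists2 k, k != 0 & m = k *: Y \/ m = k *: Z)) ->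
  (size [seq m <- r | ev m w != 0%R] <= 1)%N ->
  pairwise_distinct r -> pairwise_distinct gs ->
  c *: \prod_(g <- l :: r ++ gs) g \is e.+1.-homog ->
  total_tjurina (c *: \prod_(g <- l :: r ++ gs) g) (e * (e - 1) + 1).
Proof.
move=> e4 co c0 gsn gsP [kl kl0 lE] rP szr pr pg hf.
have [[Xu Xv Xw] [Yu Yv Yw] [Zu Zv Zw]] := coords_at co.
have [X0 Y0 Z0] := coords_neq0 co.
have [[hX hY] hZ] := (coords_homog1 co, coords_homog2 co, coords_homog3 co).
have ll : is_line l by split; rewrite lE ?rpredZ // scaler_eq0 negb_or kl0.
have cL g : g \in l :: r ++ gs -> component g.
  rewrite in_cons mem_cat => /or3P [/eqP ->|/rP [lm _]|/gsP [sg _]]; [by left|by left|by right].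
have pL : pairwise_distinct (l :: r ++ gs).
  rewrite -cat_cons; apply: distinct_lines_conics => //.
  - apply: distinct_consI => // m /rP [_ [k k0 mE]] [j j0 E].
    have : ev l u = kl by rewrite lE evZ Xu mulr1.
    case: mE E => -> ->; rewrite !evZ ?Yu ?Zu !mulr0 => /eqP; by rewrite eq_sym (negbTE kl0).
  - by move=> m; rewrite in_cons => /orP [/eqP -> //|/rP []].
  by move=> g /gsP [].
have hL : \prod_(g <- l :: r ++ gs) g \is e.+1.-homog.
  by have := dhomogZ c^-1 hf; rewrite scalerA mulVf // scale1r.
have [g0 g0gs] : exists g, g \in gs by case: gs gsn {gsP pg cL pL hf hL} => // g gs _; exists g; rewrite mem_head.
have rg : rigid (l :: r ++ gs).
  apply: (rigid_with_conic (d := e.+1) (g := g0)) => //.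
    by rewrite in_cons mem_cat g0gs !orbT.
  by have [] := gsP g0 g0gs.
pose rho := vf X u 0 v (- Z) w.
pose lam g : K := (ev g u != 0)%:R - (ev g w != 0)%:R.
have rX : act rho X = X by rewrite act_vf_line // Xu Xv Xw !scale0r !addr0 scale1r.
have rY : act rho Y = 0 by rewrite act_vf_line // Yu Yv Yw !scale0r scaler0 !addr0.
have rZ : act rho Z = - Z by rewrite act_vf_line // Zu Zv Zw !scale0r !add0r scale1r.
have lamr m : m \in r -> lam m = - (ev m w != 0)%:R.
  move=> /rP [_ [k k0 [->|->]]]; by rewrite /lam !evZ ?Yu ?Zu mulr0 eqxx sub0r.
have lamgs g : g \in gs -> lam g = 0.
  move=> /gsP [_ [a [b ->]]]; rewrite /lam !evD !evZ expr2 !evM Xu Xw Yu Yw Zu Zw.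
  by rewrite !(mulr0, mul0r, addr0) eqxx subrr.
apply: (@tjurina_eigen _ e c l (r ++ gs) e4 c0 hf cL pL rg ll rho lam).
- by apply: vf_homog; rewrite ?rpredN ?rpred0.
- move=> g; rewrite in_cons mem_cat => /or3P [/eqP ->|gr|ggs].
  + rewrite lE actZ rX /lam !evZ Xu Xw mulr1 mulr0 eqxx kl0 subr0 scale1r //.
  + rewrite lamr //; have [_ [k k0 [->|->]]] := rP g gr; rewrite actZ evZ ?Yw ?Zw.
      by rewrite rY mulr0 eqxx scaler0 oppr0 scale0r.
    by rewrite rZ mulr1 k0 scaleN1r scalerN.
  rewrite lamgs // scale0r; have [_ [a [b ->]]] := gsP g ggs.
  rewrite actD !actZ expr2 !actM rX rY rZ -!mul_mpolyC; ring.
rewrite big_cons big_cat /= [X in _ + (_ + X)]big_seq [X in _ + (_ + X)]big1 // addr0.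
have -> : lam l = 1 by rewrite /lam lE !evZ Xu Xw mulr1 mulr0 eqxx kl0 subr0.
have -> : \sum_(m <- r) lam m = - (size [seq m <- r | ev m w != 0])%:R.
  rewrite big_seq (eq_bigr (fun m => - (ev m w != 0)%:R)) => [|m]; last exact: lamr.
  by rewrite -big_seq sumrN -natr_sum size_filter -sumn_count sumnE big_map.
move: (size _) szr => [|[|//]] _.
  by rewrite oppr0 addr0 mulr1 pnatr_eq1 eqSS -lt0n (leq_trans _ e4).
by rewrite subrr mulr1 pnatr_eq0.
Qed.

Lemma bitangent_tangent q p p' l X Y Z v g : bitangent_pencil q p p' ->
  coords X Y Z p' v p -> smooth_member q g ->
  (exists a b, [/\ a != 0, b != 0 & g = a *: (X * Z) + b *: Y ^+ 2]) ->
  (common_tangent q p l -> exists2 k, k != 0 & l = k *: X) /\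
  (common_tangent q p' l -> exists2 k, k != 0 & l = k *: Z).
Proof.
move=> bit co sg [a [b [a0 b0 gE]]].
have [[Xu Xv Xw] [Yu Yv Yw] [Zu Zv Zw]] := coords_at co.
split=> -[ll tan]; have [k k0 lE] := tan g sg; exists (k * a); rewrite ?mulf_neq0 //;
  rewrite lE -scalerA; congr (_ *: _); apply: ev_eq => x;
  rewrite ev_tangent gE (pol_XZYY _ _ _ _ co) evZ ?Xw ?Zw ?Yw ?Xu ?Zu ?Yu; ring.
Qed.

Lemma joining_line_coord p p' m X Y Z v : coords X Y Z p' v p -> joining_line p p' m ->
  exists2 k, k != 0 & m = k *: Y.
Proof.
move=> co [[m0 hm] mp mp']; have E := coords_line co hm.
rewrite mp mp' !scale0r add0r addr0 in E; exists (ev m v) => //.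
by apply: contraNneq m0 => z; rewrite E z scale0r.
Qed.

Lemma bitangent_types_tjurina e f : (4 <= e)%N -> f \is e.+1.-homog ->
  type_CL2 f \/ type_CL3 f \/ type_CL4 f \/ type_CL5 f -> total_tjurina f (e * (e - 1) + 1).
Proof.
move=> e4 hf.
have main q p p' gs l r : bitangent_pencil q p p' -> conics_of_pencil q gs ->
    common_tangent q p l -> 
    [\/ r = [::], exists2 l', common_tangent q p' l' & r = [:: l'],
        exists2 m, joining_line p p' m & r = [:: m] |
        exists l' m, [/\ common_tangent q p' l', joining_line p p' m & r = [:: l'; m]]] ->
    curve_union f (l :: r ++ gs) -> total_tjurina f (e * (e - 1) + 1).
  move=> bit [sz gsq pg] tan rcase [c c0 fE]; rewrite fE in hf *.
  have [X [Y [Z [v [co forms]]]]] := bitangent_coords bit.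
  have [[Xu Xv Xw] [Yu Yv Yw] [Zu Zv Zw]] := coords_at co.
  have [g0 g0gs] : exists g, g \in gs.
    by case: gs sz {gsq pg fE hf} => // g gs _; exists g; rewrite mem_head.
  have tang l' := bitangent_tangent l' bit co (gsq g0 g0gs) (forms g0 (gsq g0 g0gs)).
  have lX := (tang l).1 tan.
  have tZ l' : common_tangent q p' l' -> exists2 k, k != 0 & l' = k *: Z by move/(tang l').2.
  have jY m : joining_line p p' m -> exists2 k, k != 0 & m = k *: Y.
    exact: joining_line_coord co.
  apply: (bitangent_lines_tjurina e4 co c0) => //.
  - by case: gs g0gs {sz gsq pg fE hf}.
  - move=> g ggs; split; first by have [] := gsq g ggs.
    by have [a [b [_ _ gE]]] := forms g (gsq g ggs); exists a, b.
  - case: rcase => [->|[l' tl' ->]|[m jm ->]|[l' [m [tl' jm ->]]]] // k.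
    + rewrite inE => /eqP ->; have [j j0 E] := tZ l' tl'; split; first by have [] := tl'.
      by exists j => //; right.
    + rewrite inE => /eqP ->; have [j j0 E] := jY m jm; split; first by have [] := jm.
      by exists j => //; left.
    rewrite !inE => /orP [] /eqP ->.
      have [j j0 E] := tZ l' tl'; split; first by have [] := tl'.
      by exists j => //; right.
    have [j j0 E] := jY m jm; split; first by have [] := jm.
    by exists j => //; left.
  - case: rcase => [->|[l' tl' ->]|[m jm ->]|[l' [m [tl' jm ->]]]] //=; try by case: ifP.
    by have [_ mp _] := jm; rewrite mp eqxx; case: ifP.
  case: rcase => [->|[l' tl' ->]|[m jm ->]|[l' [m [tl' jm ->]]]]; 
    try by [apply: distinct_nil | apply: distinct_seq1].
  apply: distinct_consI; first exact: distinct_seq1.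
  move=> h; rewrite inE => /eqP ->; have [j j0 ->] := tZ l' tl'; have [_ mp _] := jm.
  case=> k k0 /(congr1 (fun x => ev x p)); rewrite !evZ mp Zw mulr0 mulr1 => /eqP.
  by rewrite (negbTE j0).
case=> [[q [p [p' [gs [l [b cs t cu]]]]]]|[|[]]].
- by apply: (main q p p' gs l [::]) => //; apply: Or41.
- move=> [q [p [p' [gs [l [l' [b cs t t' cu]]]]]]].
  by apply: (main q p p' gs l [:: l']) => //; apply: Or42; exists l'.
- move=> [q [p [p' [gs [l [m [b cs t j cu]]]]]]].
  by apply: (main q p p' gs l [:: m]) => //; apply: Or43; exists m.
move=> [q [p [p' [gs [l [l' [m [b cs [t t' j cu]]]]]]]]].
by apply: (main q p p' gs l [:: l'; m]) => //; apply: Or44; exists l', m.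
Qed.

(** The product P of the conics is a binary form of degree n in X^2 and C, and FS, FC are its
    partial derivatives, built up by the Leibniz rule; only the leading power of C is not
    divisible by X. The degrees are stated after multiplication by a power of X, because n.*2 - 2
    is truncated when n = 0. *)
Lemma osculating_expansion (X Y Z : {mpoly K[3]}) gs :
  X \is 1.-homog -> Y \is 1.-homog -> Z \is 1.-homog ->
  (forall g, g \in gs -> exists a b, b != 0 /\ g = a *: X ^+ 2 + b *: (X * Z + Y ^+ 2)) ->
  let P := \prod_(g <- gs) g in let C := X * Z + Y ^+ 2 in let n := size gs in
  exists FS FC D D' (c : K), c != 0 /\
  [/\ forall rho, act rho P = FS * act rho (X ^+ 2) + FC * act rho C,
      P = c *: C ^+ n + X * D', FC = (n%:R * c) *: C ^+ n.-1 + X * D,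
      X ^+ 2 * FS + C * FC = n%:R *: P &
      [/\ FS * X ^+ 2 \is n.*2.-homog, FC * X ^+ 2 \is n.*2.-homog,
          D * X ^+ 3 \is n.*2.-homog & D' * X \is n.*2.-homog]].
Proof.
move=> hX hY hZ; elim: gs => [|g gs IH] H.
  exists 0, 0, 0, 0, 1; split; first exact: oner_neq0.
  rewrite /= !big_nil; split; rewrite ?(mulr0, mul0r, addr0, expr0, scale0r, scale1r, rpred0) //.
  by move=> rho; rewrite !mul0r addr0 /act /dot big1 // => i _; rewrite -mpolyC1 mderivC mulr0.
have [|FS [FC [D [D' [c [c0 [actP PE FCE eul [h1 h2 h3 h4]]]]]]]] := IH.
  by move=> h hgs; apply: H; rewrite in_cons hgs orbT.
have [a [b [b0 gE]]] := H g (mem_head _ _).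
rewrite /= in actP PE FCE eul h1 h2 h3 h4 *; rewrite big_cons.
move: (\prod_(j <- gs) j) actP PE eul => P actP PE eul.
move: (size gs) PE FCE eul h1 h2 h3 h4 => n PE FCE eul h1 h2 h3 h4.
set C := X * Z + Y ^+ 2 in gE actP PE FCE eul *.
have hX2 : X ^+ 2 \is 2.-homog by rewrite expr2; apply: (dhomogM hX hX).
have hC : C \is 2.-homog.
  by apply: rpredD; [apply: (dhomogM hX hZ) | rewrite expr2; apply: (dhomogM hY hY)].
have hg : g \is 2.-homog by rewrite gE; apply: rpredD; apply: rpredZ.
have hP : P \is n.*2.-homog.
  rewrite PE; apply: rpredD; last by rewrite mulrC.
  by rewrite rpredZ // -mul2n; apply: dhomogMn.
have hCn : C ^+ n \is n.*2.-homog by rewrite -mul2n; apply: dhomogMn.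
have up (p r : {mpoly K[3]}) : p \is 2.-homog -> r \is n.*2.-homog -> p * r \is n.*2.+2.-homog.
  by move=> hp hr; apply: (dhomogM hp hr).
exists (a *: P + g * FS), (b *: P + g * FC), (b *: D' + a *: (X * FC) + b *: (C * D)).
exists ((a * c) *: (X * C ^+ n) + a *: (X ^+ 2 * D') + b *: (C * D')), (b * c).
split; first by rewrite mulf_neq0.
split.
- by move=> rho; rewrite actM actP {1}gE actD !actZ -!mul_mpolyC; ring.
- rewrite PE gE [C ^+ n.+1]exprS -!mul_mpolyC !mpolyCM; ring.
- rewrite {1}PE FCE gE; case: n {PE FCE eul h1 h2 h3 h4 hP hCn up} => [|n] /=.
    by rewrite mul0r scale0r mul1r expr0 -!mul_mpolyC !mpolyCM; ring.
  rewrite [C ^+ n.+1]exprS -!mul_mpolyC !mpolyCM !mpolyC_nat; ring.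
- transitivity (g * (X ^+ 2 * FS + C * FC) + g * P).
    have -> : g * P = a *: (X ^+ 2 * P) + b *: (C * P) by rewrite gE mulrDl !scalerAl.
    by rewrite -!mul_mpolyC; ring.
  by rewrite eul -!mul_mpolyC !mpolyC_nat; ring.
split.
- rewrite (_ : _ * _ = a *: (X ^+ 2 * P) + g * (FS * X ^+ 2)); last by rewrite -!mul_mpolyC; ring.
  by apply: rpredD; [apply: rpredZ|]; apply: up.
- rewrite (_ : _ * _ = b *: (X ^+ 2 * P) + g * (FC * X ^+ 2)); last by rewrite -!mul_mpolyC; ring.
  by apply: rpredD; [apply: rpredZ|]; apply: up.
- rewrite (_ : _ * _ = b *: (X ^+ 2 * (D' * X)) + a *: (X ^+ 2 * (FC * X ^+ 2))
    + b *: (C * (D * X ^+ 3))); last by rewrite -!mul_mpolyC; ring.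
  by apply: rpredD; [apply: rpredD|]; apply: rpredZ; apply: up.
rewrite (_ : _ * _ = (a * c) *: (X ^+ 2 * C ^+ n) + a *: (X ^+ 2 * (D' * X)) + b *: (C * (D' * X)));
  last by rewrite -!mul_mpolyC; ring.
by apply: rpredD; [apply: rpredD|]; apply: rpredZ; apply: up.
Qed.

End TypesAreMaximal.

(** * Arrangements in a hyperosculating pencil are maximal *)

Section OsculatingTypes.
Variable K : numClosedFieldType.
Implicit Types (f g h l m : {mpoly K[3]}) (u v w p : 'rV[K]_3) (q : 'I_2 -> {mpoly K[3]}).

(** The first syzygy is the nilpotent field X d/dY - 2 Y d/dZ, which kills X and C. The second
    maps X to FC, or to X FC if the line X is present, and Y, Z to polynomials V, W for which the
    actions on the factors cancel. Such V and W exist because FC and P are multiples of powers of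
    C = XZ + Y^2 modulo X: the part with Y^2 is absorbed by V and the part with X by W. *)
Lemma osculating_types_tjurina e f : (4 <= e)%N -> f \is e.+1.-homog ->
  type_C1 f \/ type_CL1 f -> total_tjurina f (e * (e - 1) + 1).
Proof.
move=> e4 hf ty.
have [q [p [gs [ls [hyp cs [c c0 fE] lsP]]]]] : exists q p gs ls,
    [/\ hyperosculating_pencil q p, conics_of_pencil q gs, curve_union f (ls ++ gs) &
        ls = [::] \/ exists2 l, common_tangent q p l & ls = [:: l]].
  case: ty => [[q [p [gs [h cs cu]]]]|[q [p [gs [l [h cs t cu]]]]]].
    by exists q, p, gs, [::]; split => //; left.
  by exists q, p, gs, [:: l]; split => //; right; exists l.
have [X [Y [Z [u [v [co forms]]]]]] := hyperosculating_coords hyp.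
have [[Xu Xv Xp] [Yu Yv Yp] [Zu Zv Zp]] := coords_at co.
have [X0 Y0 Z0] := coords_neq0 co.
have [[hX hY] hZ] := (coords_homog1 co, coords_homog2 co, coords_homog3 co).
have [sz gsq pg] := cs.
have [g0 g0gs] : exists g, g \in gs.
  by case: gs sz {cs gsq pg fE} => // g gs _; exists g; rewrite mem_head.
have con g : g \in gs -> smooth_conic g by case/gsq.
have lX l : common_tangent q p l -> exists2 k, k != 0 & l = k *: X.
  move=> [ll tan]; have [k k0 lE] := tan g0 (gsq g0 g0gs).
  have [a [b [b0 g0E]]] := forms g0 (gsq g0 g0gs).
  exists (k * b); rewrite ?mulf_neq0 // lE -scalerA; congr (_ *: _); apply: ev_eq => x.
  rewrite ev_tangent g0E -ev_dirder.
  have -> : dirder x (a *: X ^+ 2 + b *: (X * Z + Y ^+ 2)) =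
      a *: dirder x (X * X) + b *: (dirder x (X * Z) + dirder x (Y * Y)).
    by rewrite dirderD !dirderZ dirderD.
  rewrite !dirderM !dirder_line // evZ !evD !evZ !evD !evM /ev !mevalC.
  move: Xp Yp Zp; rewrite /ev => -> -> ->; ring.
have [FS [FC [D [D' [c1 [c10 [actP PE FCE eul [h1 h2 h3 h4]]]]]]]] :=
  osculating_expansion hX hY hZ (fun g ggs => forms g (gsq g ggs)).
set P := \prod_(g <- gs) g in actP PE eul; set C := X * Z + Y ^+ 2 in actP PE FCE eul.
set n := size gs in PE FCE eul h1 h2 h3 h4.
have linls l : l \in ls -> is_line l.
  by case: lsP => [->|[l' [ll _] ->]] //; rewrite inE => /eqP ->.
have pls : pairwise_distinct ls.
  by case: lsP => [->|[l' _ ->]]; [apply: distinct_nil | apply: distinct_seq1].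
have pL : pairwise_distinct (ls ++ gs) by apply: distinct_lines_conics.
have cL g : g \in ls ++ gs -> component g.
  by rewrite mem_cat => /orP [/linls|/con]; [left|right].
have hL : \prod_(g <- ls ++ gs) g \is e.+1.-homog.
  by have := dhomogZ c^-1 hf; rewrite fE scalerA mulVf // scale1r.
have rg : rigid (ls ++ gs).
  apply: (rigid_with_conic (d := e.+1) (g := g0)) => //; last exact: con.
  by rewrite mem_cat g0gs orbT.
have deg : (size ls + n.*2 = e.+1)%N.
  apply: homog_degree hL; first exact: components_prod_neq0.
  by rewrite big_cat; apply: dhomogM (lines_homog linls) (conics_homog con).
have szls : (size ls <= 1)%N by case: lsP => [->|[l _ ->]].
have n2 : (1 < n)%N by clear -deg szls e4; lia.
have nK : n%:R != 0 :> K by rewrite pnatr_eq0; clear -n2; lia.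
have X20 : X ^+ 2 != 0 by rewrite expf_neq0.
have X30 : X ^+ 3 != 0 by rewrite expf_neq0.
have hX2 : X ^+ 2 \is 2.-homog by rewrite expr2; apply: (dhomogM hX hX).
have hX3 : X ^+ 3 \is 3.-homog by rewrite exprS; apply: (dhomogM hX hX2).
have hC : C \is 2.-homog.
  by apply: rpredD; [apply: (dhomogM hX hZ) | rewrite expr2; apply: (dhomogM hY hY)].
have hCk k : C ^+ k \is k.*2.-homog by rewrite -mul2n; apply: dhomogMn.
have hFS : FS \is (n.*2 - 2).-homog.
  apply: (homog_div (e := 2) _ hX2 X20 (erefl _)); rewrite subnK //; clear -n2; lia.
have hFC : FC \is (n.*2 - 2).-homog.
  apply: (homog_div (e := 2) _ hX2 X20 (erefl _)); rewrite subnK //; clear -n2; lia.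
have hD : D \is (n.*2 - 3).-homog.
  apply: (homog_div (e := 3) _ hX3 X30 (erefl _)); rewrite subnK //; clear -n2; lia.
have hD' : D' \is (n.*2 - 1).-homog.
  apply: (homog_div (e := 1) _ hX X0 (erefl _)); rewrite subnK //; clear -n2; lia.
have FC0 : FC != 0.
  apply/eqP => z; have /eqP := congr1 (fun x => ev x v) FCE.
  rewrite z /ev meval0 -/(ev _ v) evD evZ evM evX /C evD evM evX Xv Yv mul0r add0r expr1n.
  by rewrite expr1n mul0r addr0 mulr1 eq_sym mulf_eq0 (negbTE nK) (negbTE c10).
pose rho1 := vf 0 u X v ((-2) *: Y) p.
have r1X : act rho1 X = 0 by rewrite act_vf_line // Xu Xv Xp !scale0r scaler0 !addr0.
have r1Y : act rho1 Y = X by rewrite act_vf_line // Yu Yv Yp !scale0r add0r addr0 scale1r.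
have r1Z : act rho1 Z = (-2) *: Y by rewrite act_vf_line // Zu Zv Zp !scale0r !add0r scale1r.
have r1C : act rho1 C = 0.
  by rewrite /C actD expr2 !actM r1X r1Y r1Z -!mul_mpolyC !mpolyCN !mpolyC_nat; ring.
have r1P : act rho1 P = 0 by rewrite actP r1C expr2 actM r1X; ring.
have hr1 : forall i, rho1 i \is 1.-homog.
  by apply: vf_homog; rewrite ?rpred0 // rpredZ.
have indep rho2 : act rho2 X != 0 -> forall A B, (forall i, A * rho1 i + B * rho2 i = 0) ->
    A = 0 /\ B = 0.
  move=> r2X A B E; have := act0 X E; rewrite act_comb r1X mulr0 add0r => /eqP.
  rewrite mulf_eq0 (negbTE r2X) orbF => /eqP B0; split => //.
  have := act0 Y E; rewrite act_comb r1Y B0 mul0r addr0 => /eqP.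
  by rewrite mulf_eq0 (negbTE X0) orbF => /eqP.
rewrite fE; rewrite fE in hf.
case: lsP => [lsE|[l tl lsE]]; rewrite lsE /= in fE hf deg pL cL rg *.
-
  (* k is the coefficient of C^(n-1) in FC modulo X; V and W are chosen so that the field acts on C
     as -2 X FS, which balances its action FC on X in the expansion of the action on P *)
  pose k := n%:R * c1; pose V := (- (k / 2)) *: (Y * Z * C ^+ (n - 2)).
  pose W := (-2) *: FS - k *: (Z * Z * C ^+ (n - 2)) - D * Z.
  have r2X : act (vf FC u V v W p) X = FC.
    by rewrite act_vf_line // Xu Xv Xp !scale0r !addr0 scale1r.
  have r2Y : act (vf FC u V v W p) Y = V.
    by rewrite act_vf_line // Yu Yv Yp !scale0r add0r addr0 scale1r.
  have r2Z : act (vf FC u V v W p) Z = W.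
    by rewrite act_vf_line // Zu Zv Zp !scale0r !add0r scale1r.
  apply: (tjurina_of_syz e4 c0 hf cL pL rg hr1 _ _ _ (indep (vf FC u V v W p) _)).
  + have -> : e.-1 = (n.*2 - 2)%N by clear -deg n2; lia.
    apply: vf_homog => //.
      rewrite rpredZ // (_ : n.*2 - 2 = 1 + 1 + (n - 2).*2)%N; last by clear -n2; lia.
      exact: dhomogM (dhomogM hY hZ) (hCk _).
    apply: rpredB; first apply: rpredB; first exact: rpredZ.
      rewrite rpredZ // (_ : n.*2 - 2 = 1 + 1 + (n - 2).*2)%N; last by clear -n2; lia.
      exact: dhomogM (dhomogM hZ hZ) (hCk _).
    rewrite (_ : n.*2 - 2 = (n.*2 - 3) + 1)%N; last by clear -n2; lia.
    exact: dhomogM hD hZ.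
  + by change (act rho1 (c *: P) = 0); rewrite actZ r1P scaler0.
  + change (act (vf FC u V v W p) (c *: P) = 0); rewrite actZ actP.
    have FCE' : FC = k *: (C * C ^+ (n - 2)) + X * D.
      by rewrite FCE -exprS; congr (_ *: _ ^+ _ + _); clear -n2; lia.
    have two : (2%:R * (k / 2)%:MP : {mpoly K[3]}) = k%:MP.
      by rewrite -mpolyC_nat -mpolyCM mulrC divfK // pnatr_eq0.
    suff -> : act (vf FC u V v W p) C = (-2) *: (X * FS).
      by rewrite expr2 actM r2X -!mul_mpolyC !mpolyCN !mpolyC_nat; ring.
    rewrite /C actD expr2 !actM r2X r2Y r2Z /V /W -/C.
    transitivity (FC * Z - (k *: ((X * Z + Y ^+ 2) * C ^+ (n - 2)) + X * D) * Z
        + (-2) *: (X * FS)).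
      rewrite -!mul_mpolyC !mpolyCN -two !mpolyC_nat; ring.
    by rewrite -/C -FCE'; ring.
  by rewrite r2X.
have [kl kl0 lE] := lX l tl.
pose V := (- (c1 / 2)) *: (Y * C ^+ n.-1).
pose W := - (c1 *: (C ^+ n.-1 * Z) + (1 + 2 * n%:R) *: D' + Z * FC - 2 *: (C * D)).
have r2X : act (vf (X * FC) u V v W p) X = X * FC.
  by rewrite act_vf_line // Xu Xv Xp !scale0r !addr0 scale1r.
have r2Y : act (vf (X * FC) u V v W p) Y = V.
  by rewrite act_vf_line // Yu Yv Yp !scale0r add0r addr0 scale1r.
have r2Z : act (vf (X * FC) u V v W p) Z = W.
  by rewrite act_vf_line // Zu Zv Zp !scale0r !add0r scale1r.
apply: (tjurina_of_syz e4 c0 hf cL pL rg hr1 _ _ _ (indep (vf (X * FC) u V v W p) _)).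
- have -> : e.-1 = (n.*2 - 1)%N by clear -deg n2; lia.
  apply: vf_homog.
  + rewrite (_ : n.*2 - 1 = 1 + (n.*2 - 2))%N; last by clear -n2; lia.
    exact: dhomogM hX hFC.
  + rewrite rpredZ // (_ : n.*2 - 1 = 1 + n.-1.*2)%N; last by clear -n2; lia.
    exact: dhomogM hY (hCk _).
  rewrite rpredN; apply: rpredB; first apply: rpredD; first apply: rpredD.
  + rewrite rpredZ // (_ : n.*2 - 1 = n.-1.*2 + 1)%N; last by clear -n2; lia.
    exact: dhomogM (hCk _) hZ.
  + exact: rpredZ.
  + rewrite (_ : n.*2 - 1 = 1 + (n.*2 - 2))%N; last by clear -n2; lia.
    exact: dhomogM hZ hFC.
  rewrite rpredZ // (_ : n.*2 - 1 = 2 + (n.*2 - 3))%N; last by clear -n2; lia.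
  exact: dhomogM hC hD.
- change (act rho1 (c *: \prod_(g <- l :: gs) g) = 0).
  by rewrite big_cons actZ actM r1P lE actZ r1X scaler0 mul0r mulr0 addr0 scaler0.
- change (act (vf (X * FC) u V v W p) (c *: \prod_(g <- l :: gs) g) = 0).
  rewrite big_cons actZ actM actP lE actZ -/P -/C.
  have two : (2%:R * (c1 / 2)%:MP : {mpoly K[3]}) = c1%:MP.
    by rewrite -mpolyC_nat -mpolyCM mulrC divfK // pnatr_eq0.
  have PE' : P = c1 *: (C * C ^+ n.-1) + X * D' by rewrite PE -exprS prednK // ltnW.
  have FCE' : FC = n%:R * c1%:MP * C ^+ n.-1 + X * D.
    by rewrite FCE -mul_mpolyC mpolyCM mpolyC_nat.
  (* the Euler relation eliminates FS, the expansions of P and FC do the rest *)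
  suff key : P + 2 * (X ^+ 2 * FS) + X * Z * FC + X * W + 2 * (Y * V) = 0.
    rewrite r2X [act _ (X ^+ 2)]actM [act _ C]actD [act _ (Y ^+ 2)]actM actM r2X r2Y r2Z.
    transitivity (c *: (kl *: (X * FC * (P + 2 * (X ^+ 2 * FS) + X * Z * FC + X * W + 2 * (Y * V))))).
      rewrite -!mul_mpolyC; ring.
    by rewrite key mulr0 !scaler0.
  have -> : X ^+ 2 * FS = n%:R * P - C * FC by rewrite -mpolyC_nat mul_mpolyC -eul addrK.
  rewrite PE' /V /W FCE' -!mul_mpolyC mpolyCD mpolyCM !mpolyCN -two !mpolyC_nat mpolyC1.
  transitivity (2 * (c1 / 2)%:MP * C ^+ n.-1 * (C - (X * Z + Y ^+ 2))).
    ring.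
  by rewrite subrr mulr0.
by rewrite r2X mulf_neq0.
Qed.

End OsculatingTypes.

(** * Linear fields tangent to an arrangement; the case of lines *)

Section Invariance.
Variable K : numClosedFieldType.
Implicit Types (f g h l m : {mpoly K[3]}) (u v w p x y : 'rV[K]_3).
Implicit Types (rho : 'I_3 -> {mpoly K[3]}) (gs : seq {mpoly K[3]}).

Definition at_point rho x : 'rV[K]_3 := \row_i ev (rho i) x.

Lemma ev_act rho f x : ev (act rho f) x = pol f (at_point rho x) x.
Proof.
by rewrite /act /dot /ev raddf_sum; apply: eq_bigr => i _; rewrite /= mevalM mxE.
Qed.

Lemma at_point_linear rho c x y : (forall i, rho i \is 1.-homog) ->
  at_point rho (c *: x + y) = c *: at_point rho x + at_point rho y.
Proof. by move=> h; apply/rowP => i; rewrite !mxE ev_linear. Qed.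

(** On a parametrized factor g the other factors do not vanish identically, so the Leibniz rule
    leaves [act rho g = 0] along g. *)
Lemma component_eigen c gs rho : c != 0 -> (forall g, g \in gs -> component g) ->
  pairwise_distinct gs -> (forall i, rho i \is 1.-homog) ->
  act rho (c *: \prod_(g <- gs) g) = 0 ->
  forall g, g \in gs -> exists mu, act rho g = mu *: g.
Proof.
move=> c0 cgs /pairwise_distinctP [ugs dist] hr rf g gin.
have cg := cgs g gin; have [gam [w pa]] := component_param cg.
move: rf; rewrite actZ => /eqP; rewrite scaler_eq0 (negbTE c0) (big_rem g) //= actM.
set h := \prod_(y <- _) y => /eqP/(congr1 (restr gam)).
rewrite rmorph0 rmorphD !rmorphM /= (param_restr pa) mul0r addr0 => /eqP.
have hn : restr gam h != 0.
  rewrite rmorph_prod prodf_seq_neq0; apply/allP => k; rewrite mem_rem_uniq // inE => /andP [kg kin].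
  apply/implyP => _; apply/eqP => r0; exact: dist k g kin gin kg (param_component pa (cgs k kin) r0).
rewrite mulf_eq0 (negbTE hn) orbF => /eqP r0; have [d hg] := component_homog cg.
by have [mu] := param_same_degree pa hg (act_homog hr hg) r0; exists mu.
Qed.

Lemma type_L_of_point c gs l q : c != 0 -> (forall g, g \in gs -> is_line g) ->
  pairwise_distinct gs -> l \in gs -> ev l q != 0 ->
  (forall g, g \in gs -> g != l -> ev g q = 0) -> type_L (size gs) (c *: \prod_(g <- gs) g).
Proof.
move=> c0 lin pd lgs lq gq; have [u dist] := (pairwise_distinctP gs).1 pd.
have [_ hl] := lin l lgs.
exists (rem l gs), l, q; split.
- by rewrite size_rem.
- by move=> g /mem_rem /lin.
- apply/pairwise_distinctP; split; first exact: rem_uniq.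
  by move=> g h /mem_rem gg /mem_rem hh; apply: dist.
split => //.
- by apply: contraNneq lq => ->; rewrite (ev0 hl).
- by move=> g; rewrite mem_rem_uniq // inE => /andP [gl gin]; apply: gq.
- exact: lin.
exists c => //; rewrite big_cons; congr (_ *: _); exact: big_rem.
Qed.

(** In coordinates given by three independent lines of the curve the field is diagonal. Three
    distinct eigenvalues would leave room for three invariant lines only, and three equal ones
    would make the field a multiple of the Euler field, which does not kill f. So exactly two
    coincide, and all lines but one pass through the point where the corresponding two coordinates
    vanish. *)
Lemma lines_type_L c gs rho : c != 0 -> (4 < size gs)%N -> (forall g, g \in gs -> is_line g) ->
  pairwise_distinct gs -> (forall v, (forall g, g \in gs -> ev g v = 0) -> v = 0) ->
  (forall i, rho i \is 1.-homog) -> (exists i, rho i != 0) ->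
  act rho (c *: \prod_(g <- gs) g) = 0 -> type_L (size gs) (c *: \prod_(g <- gs) g).
Proof.
move=> c0 sz lin pd conc hr [i0 ri0] rf.
have [ugs dist] := (pairwise_distinctP gs).1 pd.
have eig := component_eigen c0 (fun g gin => or_introl (lin g gin)) pd hr rf.
have [l1 [l2 [l1in l2in d12]]] : exists l1 l2, [/\ l1 \in gs, l2 \in gs & ~ same_proj l1 l2].
  case: gs sz ugs dist {lin pd conc rf eig} => [|l1 [|l2 gs]] //= _ /andP [ni _] dist.
  exists l1, l2; split; rewrite ?mem_head ?in_cons ?eqxx ?orbT //.
  apply: dist; rewrite ?mem_head ?in_cons ?eqxx ?orbT //.
  by apply: contraNneq ni => ->; rewrite mem_head.
have [q q0 span] := two_lines_point (lin l1 l1in) (lin l2 l2in) d12.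
have [l3 l3in l3q] : exists2 l3, l3 \in gs & ev l3 q != 0.
  apply: contrapT => H; case/eqP: q0; apply: conc => g gin; apply/eqP.
  by apply: contra_notT H => gq; exists g.
have q12 : ev l1 q = 0 /\ ev l2 q = 0.
  have [_ hl1] := lin l1 l1in; have [_ hl2] := lin l2 l2in.
  have [x [x0 l1x l2x]] := common_zero hl1 hl2; have [k xq] := span x l1x l2x.
  have k0 : k != 0 by apply: contraNneq x0 => k0; rewrite xq k0 scale0r.
  move: l1x l2x; rewrite xq !evZ1 // => /eqP; rewrite mulf_eq0 (negbTE k0) => /eqP ->.
  by move/eqP; rewrite mulf_eq0 (negbTE k0) => /eqP ->.
have [q1 q2] := q12; have [_ hl1] := lin l1 l1in; have [_ hl2] := lin l2 l2in.
have [_ hl3] := lin l3 l3in.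
(* three independent lines: coordinates in which the field is diagonal *)
have det v : ev l1 v = 0 -> ev l2 v = 0 -> ev l3 v = 0 -> v = 0.
  move=> v1 v2 v3; have [k vE] := span v v1 v2; move: v3; rewrite vE evZ1 // => /eqP.
  by rewrite mulf_eq0 (negbTE l3q) orbF => /eqP ->; rewrite scale0r.
have dual l m n : l \is 1.-homog -> m \is 1.-homog -> n \is 1.-homog ->
    (forall v, ev l v = 0 -> ev m v = 0 -> ev n v = 0 -> v = 0) ->
    exists x, [/\ ev l x = 0, ev m x = 0 & ev n x = 1].
  move=> hl hm hn inj; have [x [x0 lx mx]] := common_zero hl hm.
  have nx : ev n x != 0 by apply: contraNneq x0 => nx; apply/eqP/inj.
  by exists ((ev n x)^-1 *: x); rewrite !evZ1 // lx mx !mulr0 mulVf.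
have [u [u2 u3 u1]] := dual _ _ _ hl2 hl3 hl1 (fun v a b c => det v c a b).
have [v [v1 v3 v2]] := dual _ _ _ hl1 hl3 hl2 (fun v a b c => det v a c b).
have [w [w1 w2 w3]] := dual _ _ _ hl1 hl2 hl3 det.
have E x : x = ev l1 x *: u + ev l2 x *: v + ev l3 x *: w.
  apply/eqP; rewrite -subr_eq0 -scaleN1r addrC; apply/eqP/det;
  by rewrite ev_linear // ev_comb // ?u1 ?u2 ?u3 ?v1 ?v2 ?v3 ?w1 ?w2 ?w3; ring.
have [m1 E1] := eig l1 l1in; have [m2 E2] := eig l2 l2in; have [m3 E3] := eig l3 l3in.
have lE l : l \is 1.-homog -> l = ev l u *: l1 + ev l v *: l2 + ev l w *: l3.
  by move=> hl; apply: ev_eq => x; rewrite {1}(E x) ev_comb // !evD !evZ; ring.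
have coefs l : l \in gs -> exists mu, [/\ ev l u * m1 = mu * ev l u,
    ev l v * m2 = mu * ev l v & ev l w * m3 = mu * ev l w].
  move=> lgs; have [mu Emu] := eig l lgs; have [_ hl] := lin l lgs; exists mu.
  have A : act rho l = ev l u *: act rho l1 + ev l v *: act rho l2 + ev l w *: act rho l3.
    by rewrite {1}(lE l hl) !actD !actZ.
  rewrite E1 E2 E3 Emu in A.
  have H x := congr1 (fun r => ev r x) A.
  split; [have := H u | have := H v | have := H w]; rewrite /= !evD !evZ
    ?u1 ?u2 ?u3 ?v1 ?v2 ?v3 ?w1 ?w2 ?w3 => ->; ring.
have nscalar : ~ (m1 = m2 /\ m2 = m3).
  move=> [e12 e23]; case/negP: ri0.
  have rl l : l \is 1.-homog -> act rho l = m3 *: l.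
    by move=> hl; rewrite [in LHS](lE l hl) !actD !actZ E1 E2 E3 e12 e23 [in RHS](lE l hl)
      !scalerDr !scalerA ![m3 * _]mulrC.
  have rX i : rho i = m3 *: 'X_i.
    have hX : ('X_i : {mpoly K[3]}) \is 1.-homog by rewrite dhomogX /= mdeg1.
    rewrite -rl // /act /dot (bigD1 i) //= big1 ?addr0 => [|j ji].
      by rewrite mderivX mnm1E eqxx -{1}[U_(i)%MM]add0m addmK mpolyX0 scale1r mulr1.
    by rewrite mderivX mnm1E eq_sym (negbTE ji) scale0r mulr0.
  have := rf; rewrite actZ (@act_prod _ (fun=> m3)); last by move=> g /lin [_ /rl].
  rewrite scalerA => /eqP; rewrite scaler_eq0 mulf_eq0 (negbTE c0) /=.
  have /negbTE -> : \prod_(g <- gs) g != 0.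
    by apply: components_prod_neq0 => g gin; left; apply: lin.
  rewrite orbF big_const_seq count_predT iter_addr_0 -mulr_natr mulf_eq0 pnatr_eq0.
  by rewrite (_ : size gs == 0 = false)%N ?orbF => [/eqP m30|]; [rewrite rX m30 scale0r | case: (gs) sz].
(* the line outside the double eigenspace *)
have finish x l : l \in gs -> ev l x != 0 ->
    (forall g, g \in gs -> ev g x != 0 -> same_proj g l) -> type_L (size gs) (c *: \prod_(g <- gs) g).
  move=> lgs lx gl; apply: (type_L_of_point c0 lin pd lgs lx) => g ggs neq.
  by apply/eqP; apply: contraT => gx; case: (dist g l ggs lgs neq); apply: gl.
have cancel (k k' y : K) : y * k = k' * y -> y != 0 -> k' = k.
  by move=> Ek y0; apply: (mulIf y0); rewrite -Ek mulrC.
have l_neq0 l : l \in gs -> l != 0 by move=> /lin [].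
have [e12|n12] := eqVneq m1 m2.
  have n23 : m3 != m2 by apply/eqP => e; apply: nscalar.
  apply: (finish w l3) => //; first by rewrite w3 oner_neq0.
  move=> g ggs gw; have [mu [c1 c2 c3]] := coefs g ggs; have [_ hgl] := lin g ggs.
  have mu3 := cancel _ _ _ c3 gw.
  have gu : ev g u = 0.
    by apply/eqP; apply: contraT => /(cancel _ _ _ c1); rewrite mu3 e12 => /eqP; rewrite (negbTE n23).
  have gv : ev g v = 0.
    by apply/eqP; apply: contraT => /(cancel _ _ _ c2); rewrite mu3 => /eqP; rewrite (negbTE n23).
  by apply: (same_projE (l_neq0 g ggs)); rewrite {1}(lE g hgl) gu gv !scale0r !add0r.
have [e13|n13] := eqVneq m1 m3.
  apply: (finish v l2) => //; first by rewrite v2 oner_neq0.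
  move=> g ggs gv; have [mu [c1 c2 c3]] := coefs g ggs; have [_ hgl] := lin g ggs.
  have mu2 := cancel _ _ _ c2 gv.
  have gu : ev g u = 0.
    by apply/eqP; apply: contraT => /(cancel _ _ _ c1); rewrite mu2 => /eqP; rewrite eq_sym (negbTE n12).
  have gw : ev g w = 0.
    by apply/eqP; apply: contraT => /(cancel _ _ _ c3); rewrite mu2 -e13 => /eqP; rewrite eq_sym (negbTE n12).
  by apply: (same_projE (l_neq0 g ggs)); rewrite {1}(lE g hgl) gu gw !scale0r add0r addr0.
have [e23|n23] := eqVneq m2 m3.
  apply: (finish u l1) => //; first by rewrite u1 oner_neq0.
  move=> g ggs gu; have [mu [c1 c2 c3]] := coefs g ggs; have [_ hgl] := lin g ggs.
  have mu1 := cancel _ _ _ c1 gu.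
  have gv : ev g v = 0.
    by apply/eqP; apply: contraT => /(cancel _ _ _ c2); rewrite mu1 => /eqP; rewrite (negbTE n12).
  have gw : ev g w = 0.
    by apply/eqP; apply: contraT => /(cancel _ _ _ c3); rewrite mu1 => /eqP; rewrite (negbTE n13).
  by apply: (same_projE (l_neq0 g ggs)); rewrite {1}(lE g hgl) gv gw !scale0r !addr0.
(* three distinct eigenvalues leave room for three lines only *)
have only l : l \in gs -> [|| l == l1, l == l2 | l == l3].
  move=> lgs; have [mu [c1 c2 c3]] := coefs l lgs; have [l0 hl] := lin l lgs.
  have same m k : m \in gs -> l = k *: m -> l == m.
    move=> mgs Em; apply: contraT => neq; case: (dist l m lgs mgs neq); exact: same_projE Em.
  have EL := lE l hl.
  have [lu|lu] := eqVneq (ev l u) 0; last first.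
    have mu1 := cancel _ _ _ c1 lu.
    have lv : ev l v = 0.
      by apply/eqP; apply: contraT => /(cancel _ _ _ c2); rewrite mu1 => /eqP; rewrite (negbTE n12).
    have lw : ev l w = 0.
      by apply/eqP; apply: contraT => /(cancel _ _ _ c3); rewrite mu1 => /eqP; rewrite (negbTE n13).
    by rewrite lv lw !scale0r !addr0 in EL; apply/orP; left; apply: same l1in EL.
  have [lv|lv] := eqVneq (ev l v) 0; last first.
    have mu2 := cancel _ _ _ c2 lv.
    have lw : ev l w = 0.
      by apply/eqP; apply: contraT => /(cancel _ _ _ c3); rewrite mu2 => /eqP; rewrite (negbTE n23).
    rewrite lu lw !scale0r add0r addr0 in EL.
    by apply/orP; right; apply/orP; left; apply: same l2in EL.
  rewrite lu lv !scale0r !add0r in EL.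
  by apply/orP; right; apply/orP; right; apply: same l3in EL.
have : (size gs <= size [:: l1; l2; l3])%N.
  by apply: uniq_leq_size ugs _ => l /only; rewrite !inE.
by rewrite /= leqNgt (leq_trans _ sz).
Qed.

End Invariance.

(** * Linear fields tangent to a conic *)

Section SkewEndomorphisms.
Variable K : numClosedFieldType.
Implicit Types (f g h l m : {mpoly K[3]}) (u v w p x y : 'rV[K]_3).
Variable B : 'rV[K]_3 -> 'rV[K]_3.
Hypothesis linB : forall (c : K) x y, B (c *: x + y) = c *: B x + B y.

Let B0 : B 0 = 0.
Proof. by apply: (addrI (B 0)); rewrite -{1}[B 0]scale1r -linB scaler0 !addr0. Qed.

Let BD x y : B (x + y) = B x + B y.
Proof. by rewrite -{1}[x]scale1r linB scale1r. Qed.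

Let BZ c x : B (c *: x) = c *: B x.
Proof. by rewrite -{1}[c *: x]addr0 linB B0 addr0. Qed.

Lemma pol_invariant g nu : g \is 2.-homog -> (forall x, pol g (B x) x = nu * ev g x) ->
  forall x y, pol g (B x) y + pol g (B y) x = nu * pol g x y.
Proof.
move=> hg H x y; have := H (x + y).
rewrite BD polDl !polDr // ev_add // !mulrDr => E.
have {}E : pol g (B x) x + pol g (B x) y + (pol g (B y) x + pol g (B y) y) -
  (pol g (B x) x + pol g (B y) y) = nu * pol g x y by rewrite E !H; ring.
by rewrite -E; ring.
Qed.

(** Skewness of B for the polar form of g, read off in the basis. *)
Lemma skew_frame g u v p : g \is 2.-homog -> (forall x, pol g (B x) x = 0) ->
  basis3 u v p -> ev g u = 0 -> ev g v = 1 -> ev g p = 0 ->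
  pol g u p = 1 -> pol g u v = 0 -> pol g v p = 0 ->
  exists a b c, [/\ B u = a *: u + b *: v, B v = (- 2 * c) *: u + (- 2 * b) *: p
    & B p = c *: v - a *: p].
Proof.
move=> hg H ind gu gv gp gup guv gvp; have [X [Y [Z co]]] := basis3_coords ind.
have H' x : pol g (B x) x = 0 * ev g x by rewrite mul0r.
have P := pol_invariant hg H'.
have [uu vv pp] : [/\ pol g u u = 0, pol g v v = 2 & pol g p p = 0].
  by rewrite !pol_diag // gu gv gp mulr0 mulr1.
have [vu pv pu] : [/\ pol g v u = 0, pol g p v = 0 & pol g p u = 1].
  by rewrite !(polC hg _ u) (polC hg p v).
have Ev x z : pol g (B x) z = ev X (B x) * pol g u z + ev Y (B x) * pol g v z + ev Z (B x) * pol g p z.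
  by rewrite {1}(coordsK co (B x)) !polDl !polZl.
have two0 : (2 : K) != 0 by rewrite pnatr_eq0.
have half (k : K) : k * 2 = 0 -> k = 0.
  by move/eqP; rewrite mulf_eq0 (negbTE two0) orbF => /eqP.
have := H u; rewrite Ev uu vu pu !(mulr0, add0r, mulr1) => Zu.
have := H v; rewrite Ev guv vv pv !(mulr0, add0r, addr0) => /half Yv.
have := H p; rewrite Ev gup gvp pp !(mulr0, mulr1, addr0) => Xp.
have := P u v; rewrite !Ev guv vv pv uu vu pu !(mulr0, mulr1, add0r, addr0, mul0r) => Zv.
have := P u p; rewrite !Ev gup gvp pp uu vu pu !(mulr0, mulr1, add0r, addr0, mul0r) => Zp.
have := P v p; rewrite !Ev gup gvp pp guv vv pv !(mulr0, mulr1, add0r, addr0, mul0r) => Xv.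
exists (ev X (B u)), (ev Y (B u)), (ev Y (B p)); split.
- by rewrite {1}(coordsK co (B u)) Zu scale0r addr0.
- rewrite {1}(coordsK co (B v)) Yv scale0r addr0; congr (_ *: _ + _ *: _).
    by apply/eqP; rewrite -subr_eq0 -Xv; apply/eqP; ring.
  by apply/eqP; rewrite -subr_eq0 -Zv; apply/eqP; ring.
rewrite {1}(coordsK co (B p)) Xp scale0r add0r -scaleNr; congr (_ + _ *: _).
by apply/eqP; rewrite -subr_eq0 -Zp; apply/eqP; ring.
Qed.

(** On the conic u + t v - t^2 p an infinitesimal rotation acts by the quadratic field b - a t + c
    t^2, so it fixes a point of the conic. *)
Lemma skew_fixed_point g : smooth_conic g -> (forall x, pol g (B x) x = 0) ->
  exists p k, [/\ p != 0, ev g p = 0 & B p = k *: p].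
Proof.
move=> sg H; have [hg _] := sg; have [p p0 gp] := conic_point hg.
have [u [v [ind gu gv [gup guv gvp]]]] := conic_frame sg p0 gp.
have [a [b [c [Bu Bv Bp]]]] := skew_frame hg H ind gu gv gp gup guv gvp.
have [c0|c0] := eqVneq c 0.
  by exists p, (- a); rewrite Bp c0 scale0r add0r scaleNr.
have [t tE] : exists t, b - a * t + c * t ^+ 2 = 0.
  exists ((a + sqrtC (a ^+ 2 - 4 * b * c)) / (2 * c)).
  have S := sqrtCK (a ^+ 2 - 4 * b * c); move: (sqrtC _) S => s S.
  have -> : b - a * ((a + s) / (2 * c)) + c * ((a + s) / (2 * c)) ^+ 2 =
      (s ^+ 2 - (a ^+ 2 - 4 * b * c)) / (4 * c) by field.
  by rewrite S subrr mul0r.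
exists (1 *: u + t *: v + (- t ^+ 2) *: p), (a - 2 * c * t); split.
- by apply/eqP => /ind [/eqP]; rewrite oner_eq0.
- by rewrite ev_comb2 // gu gv gp gup guv gvp; ring.
have bE : b = a * t - c * t ^+ 2.
  by apply/eqP; rewrite -subr_eq0 -tE; apply/eqP; ring.
rewrite !BD !BZ Bu Bv Bp bE; apply/rowP => i; rewrite !mxE; ring.
Qed.

(** With a fixed point p of the conic as third basis vector, c = 0. If a <> 0, the field b - a t
    has a second zero t = b / a; taking that point as first basis vector diagonalizes B. If a = 0,
    then B is nilpotent. *)
Lemma skew_normal_form g : smooth_conic g -> (forall x, pol g (B x) x = 0) ->
  (exists x, B x != 0) ->
  exists X Y Z u v w, coords X Y Z u v w /\
    ((exists2 a, a != 0 & [/\ B u = a *: u, B v = 0 & B w = - a *: w]) \/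
     (exists2 b, b != 0 & [/\ B u = b *: v, B v = (- 2 * b) *: w & B w = 0])).
Proof.
move=> sg H [x0 Bx0]; have [hg _] := sg; have [p [k [p0 gp Bpk]]] := skew_fixed_point sg H.
have [u [v [ind gu gv [gup guv gvp]]]] := conic_frame sg p0 gp.
have [a [b [c [Bu Bv Bp]]]] := skew_frame hg H ind gu gv gp gup guv gvp.
have c0 : c = 0.
  have [|_ -> //] := ind 0 c (- a - k).
  by rewrite scale0r add0r scalerBl addrA scaleNr -Bp Bpk subrr.
have {}Bv : B v = (- 2 * b) *: p by rewrite Bv c0 mulr0 scale0r add0r.
have {}Bp : B p = - a *: p by rewrite Bp c0 scale0r add0r scaleNr.
have [X [Y [Z co]]] := basis3_coords ind.
have [a0|a0] := eqVneq a 0.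
  exists X, Y, Z, u, v, p; split => //; right; exists b; last first.
    by rewrite Bu Bv Bp a0 oppr0 !scale0r add0r.
  apply: contraNneq Bx0 => b0; rewrite (coordsK co x0) !BD !BZ Bu Bv Bp a0 b0.
  by rewrite mulr0 oppr0 !(scale0r, scaler0, addr0).
pose t := b / a; pose u' := 1 *: u + t *: v + (- t ^+ 2) *: p; pose v' := v + (- 2 * t) *: p.
have ind' : basis3 u' v' p.
  move=> x y z E; have [|x00] := ind x (x * t + y) (- x * t ^+ 2 - 2 * y * t + z).
    by rewrite -[RHS]E /u' /v'; apply/rowP => i; rewrite !mxE; ring.
  rewrite x00 mul0r add0r oppr0 mul0r sub0r => ->.
  by rewrite mulr0 mul0r oppr0 add0r => ->.
have [X' [Y' [Z' co']]] := basis3_coords ind'.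
exists X', Y', Z', u', v', p; split => //; left; exists a => //.
have bE : b = a * t by rewrite /t mulrC divfK.
split => //; rewrite /u' /v' !BD !BZ ?Bu Bv Bp bE; apply/rowP => i; rewrite !mxE; ring.
Qed.

Section Invariants.
Variables (X Y Z : {mpoly K[3]}) (u v w : 'rV[K]_3) (a : K).
Hypotheses (co : coords X Y Z u v w) (a0 : a != 0).

Let eig (k nu y : K) : k * y = nu * y -> y != 0 -> k = nu.
Proof. by move=> E y0; apply: (mulIf y0). Qed.

Let eig0 (k nu y : K) : k * y = nu * y -> k != nu -> y = 0.
Proof. by move=> E ne; apply/eqP; apply: contraNT ne => y0; apply/eqP/(eig E). Qed.

Lemma torus_line l nu : B u = a *: u -> B v = 0 -> B w = - a *: w -> is_line l ->
  (forall x, ev l (B x) = nu * ev l x) ->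
  exists2 k, k != 0 & [\/ l = k *: X, l = k *: Y | l = k *: Z].
Proof.
move=> Bu Bv Bw [l0 hl] H; have E := coords_line co hl.
have := H u; rewrite Bu evZ1 // => Hu; have := H w; rewrite Bw evZ1 // => Hw.
have := H v; rewrite Bv (ev0 hl) => /esym/eqP; rewrite mulf_eq0.
have k0 k M : l = k *: M -> k != 0 by move=> El; apply: contraNneq l0 => k0; rewrite El k0 scale0r.
have [nu0 _|nu0 /eqP lv] := eqVneq nu 0.
  have lu : ev l u = 0 by apply: (eig0 Hu); rewrite nu0.
  have lw : ev l w = 0 by apply: (eig0 Hw); rewrite nu0 oppr_eq0.
  rewrite lu lw !scale0r add0r addr0 in E; exists (ev l v); first exact: k0 E.
  exact: Or32.
rewrite lv scale0r addr0 in E; have [lu|lu] := eqVneq (ev l u) 0.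
  rewrite lu scale0r add0r in E; exists (ev l w); first exact: k0 E.
  exact: Or33.
have lw : ev l w = 0.
  apply: (eig0 Hw); rewrite -(eig Hu lu) -subr_eq0 -opprD oppr_eq0.
  by rewrite -mulr2n mulrn_eq0 (negbTE a0).
rewrite lw scale0r addr0 in E; exists (ev l u); first exact: k0 E.
exact: Or31.
Qed.

Lemma nilpotent_line l nu : B u = a *: v -> B v = (- 2 * a) *: w -> B w = 0 -> is_line l ->
  (forall x, ev l (B x) = nu * ev l x) -> exists2 k, k != 0 & l = k *: X.
Proof.
move=> Bu Bv Bw [l0 hl] H; have E := coords_line co hl.
have := H u; rewrite Bu evZ1 // => Hu; have := H v; rewrite Bv evZ1 // => Hv.
have := H w; rewrite Bw (ev0 hl) => Hw.
have two_a : - 2 * a != 0 by rewrite mulf_neq0 // oppr_eq0 pnatr_eq0.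
have [nu0|nu0] := eqVneq nu 0.
  move: Hu Hv; rewrite nu0 !mul0r => /eqP; rewrite mulf_eq0 (negbTE a0) => /eqP lv /eqP.
  rewrite mulf_eq0 (negbTE two_a) => /eqP lw; rewrite lv lw !scale0r !addr0 in E.
  by exists (ev l u) => //; apply: contraNneq l0 => k0; rewrite E k0 scale0r.
case/negP: l0; move/esym/eqP: Hw; rewrite mulf_eq0 (negbTE nu0) => /eqP lw.
move/esym/eqP: Hv; rewrite lw mulr0 mulf_eq0 (negbTE nu0) => /eqP lv.
move/esym/eqP: Hu; rewrite lv mulr0 mulf_eq0 (negbTE nu0) => /eqP lu.
by rewrite E lu lv lw !scale0r !addr0.
Qed.

Let nondeg h x : smooth_conic h -> x != 0 -> pol h u x = 0 -> pol h v x = 0 ->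
  pol h w x = 0 -> False.
Proof.
move=> [hh sm] x0 hu hv hw; have [y] := smooth_pol hh sm x0.
by rewrite (coordsK co y) !polDl !polZl hu hv hw !mulr0 !addr0 eqxx.
Qed.

(** B has weights 2a, a, 0, -a, -2a on quadratic forms. A form of nonzero weight involves at most
    one of the monomials X^2, XY, YZ, Z^2 and is degenerate, so h has weight 0. *)
Lemma torus_conic h nu : B u = a *: u -> B v = 0 -> B w = - a *: w -> smooth_conic h ->
  (forall x, pol h (B x) x = nu * ev h x) ->
  exists al be, [/\ al != 0, be != 0 & h = al *: (X * Z) + be *: Y ^+ 2].
Proof.
move=> Bu Bv Bw sh H; have [hh _] := sh; have P := pol_invariant hh H.
have [u0 v0 w0] := frame_neq0 co.
have pol0 x : pol h 0 x = 0 by rewrite -(scale0r 0) polZl mul0r.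
have two0 : (2 : K) != 0 by rewrite pnatr_eq0.
have := H u; rewrite Bu polZl pol_diag // mulrA => Hu.
have := H v; rewrite Bv pol0 => Hv.
have := H w; rewrite Bw polZl pol_diag // mulrA => Hw.
have := P u v; rewrite Bu Bv polZl pol0 addr0 => Huv.
have := P v w; rewrite Bv Bw polZl pol0 add0r (polC hh w v) => Hvw.
have := P u w; rewrite Bu Bw !polZl (polC hh w u) mulNr subrr => Huw.
have [nu0|nu0] := eqVneq nu 0.
  have hu : ev h u = 0 by apply: (eig0 Hu); rewrite nu0 mulf_neq0.
  have hw : ev h w = 0 by apply: (eig0 Hw); rewrite nu0 mulf_neq0 // oppr_eq0.
  have huv : pol h u v = 0 by apply: (eig0 Huv); rewrite nu0.
  have hvw : pol h v w = 0 by apply: (eig0 Hvw); rewrite nu0 oppr_eq0.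
  exists (pol h u w), (ev h v); split.
  - apply/eqP => huw; apply: (nondeg sh w0 huw hvw).
    by rewrite pol_diag // hw mulr0.
  - apply/eqP => hv; apply: (nondeg sh v0 huv); last by rewrite polC.
    by rewrite pol_diag // hv mulr0.
  apply: ev_eq => x; rewrite {1}(coordsK co x) ev_comb2 // hu hw huv hvw.
  by rewrite evD !evZ evM evX; ring.
have huw : pol h u w = 0.
  by move/esym/eqP: Huw; rewrite mulf_eq0 (negbTE nu0) => /eqP.
exfalso.
have [huu|huu] := eqVneq (ev h u) 0; last first.
  have nuE := eig Hu huu.
  have ne (k : K) : 0 < k -> - k * a != a * 2.
    move=> k_gt0; rewrite mulrC (inj_eq (mulfI a0)); apply: contraTneq k_gt0 => E.
    by rewrite -[k]opprK E oppr_gt0 le_gtF ?ler0n.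
  apply: (nondeg sh w0 huw).
    by apply: (eig0 Hvw); rewrite -nuE -mulN1r ne ?ltr01.
  by rewrite pol_diag // (_ : ev h w = 0) ?mulr0 //; apply: (eig0 Hw); rewrite -nuE mulrC mulrN -mulNr ne ?ltr0n.
have [huv|huv] := eqVneq (pol h u v) 0.
  apply: (nondeg sh u0); rewrite ?(polC hh _ u) //.
  by rewrite pol_diag // huu mulr0.
have nuE := eig Huv huv.
have ne (k : K) : 0 < k -> - k * a != a.
  move=> k_gt0; rewrite -[X in _ != X]mul1r (inj_eq (mulIf a0)); apply: contraTneq k_gt0 => E.
  by rewrite -[k]opprK E oppr_gt0 le_gtF ?ler01.
apply: (nondeg sh w0 huw).
  by apply: (eig0 Hvw); rewrite -nuE -mulN1r ne ?ltr01.
by rewrite pol_diag // (_ : ev h w = 0) ?mulr0 //; apply: (eig0 Hw); rewrite -nuE mulrC mulrN -mulNr ne ?ltr0n.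
Qed.

(** B is nilpotent on quadratic forms, so h is in its kernel; the case nu <> 0 leads to a form
    degenerate at w. *)
Lemma nilpotent_conic h nu : B u = a *: v -> B v = (- 2 * a) *: w -> B w = 0 ->
  smooth_conic h -> (forall x, pol h (B x) x = nu * ev h x) ->
  exists al be, be != 0 /\ h = al *: X ^+ 2 + be *: (X * Z + Y ^+ 2).
Proof.
move=> Bu Bv Bw sh H; have [hh _] := sh; have P := pol_invariant hh H.
have [u0 v0 w0] := frame_neq0 co.
have pol0 x : pol h 0 x = 0 by rewrite -(scale0r 0) polZl mul0r.
have two0 : (2 : K) != 0 by rewrite pnatr_eq0.
have two_a : - 2 * a != 0 by rewrite mulf_neq0 // oppr_eq0 pnatr_eq0.
have := H u; rewrite Bu polZl (polC hh v u) => Hu.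
have := H v; rewrite Bv polZl (polC hh w v) => Hv.
have := H w; rewrite Bw pol0 => Hw.
have := P u v; rewrite Bu Bv !polZl pol_diag // (polC hh w u) => Huv.
have := P v w; rewrite Bv Bw !polZl pol0 addr0 pol_diag // => Hvw.
have := P u w; rewrite Bu Bw !polZl pol0 addr0 => Huw.
have mul_0 (k y : K) : k * y = 0 -> k != 0 -> y = 0.
  by move=> /eqP; rewrite mulf_eq0 => /orP [/eqP ->|/eqP //]; rewrite eqxx.
have [nu0|nu0] := eqVneq nu 0.
  rewrite nu0 !mul0r in Hu Hv Hw Huv Hvw Huw.
  have huv := mul_0 _ _ Hu a0; have hvw := mul_0 _ _ Hv two_a.
  have hw := mul_0 _ _ (mul_0 _ _ Hvw two_a) two0.
  have huw : pol h u w = ev h v.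
    apply/eqP; rewrite eq_sym -subr_eq0; apply/eqP/(mul_0 _ _ _ two_a).
    by apply/eqP; rewrite -oppr_eq0 -Huv; apply/eqP; ring.
  exists (ev h u), (ev h v); split.
    apply/eqP => hv; apply: (nondeg sh v0 huv); last by rewrite polC.
    by rewrite pol_diag // hv mulr0.
  apply: ev_eq => x; rewrite {1}(coordsK co x) ev_comb2 // huw huv hvw hw.
  by rewrite evD !evZ evD evM !evX; ring.
exfalso; have hw := mul_0 _ _ (esym Hw) nu0.
rewrite hw !mulr0 in Hvw; have hvw := mul_0 _ _ (esym Hvw) nu0.
rewrite hvw !mulr0 in Huw; have huw := mul_0 _ _ (esym Huw) nu0.
by apply: (nondeg sh w0) => //; rewrite pol_diag // hw mulr0.
Qed.

End Invariants.

End SkewEndomorphisms.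

(** * The two pencils in coordinates *)

Section Jets.
Variable K : numClosedFieldType.
Implicit Types (r s g h : {mpoly K[3]}) (u v w p : 'rV[K]_3).

Definition jet v w r : 'rV[K]_2 := \row_i (if i == ord0 then ev r w else pol r v w).

Fact jet_linear v w : linear (jet v w).
Proof.
move=> c r s; apply/rowP => i; rewrite !mxE -!ev_dirder dirderD dirderZ !evD !evZ.
by case: ifP.
Qed.
HB.instance Definition _ v w :=
  GRing.isLinear.Build K {mpoly K[3]} 'rV[K]_2 _ (jet v w) (jet_linear v w).

Lemma polM v w r s : pol (r * s) v w = pol r v w * ev s w + ev r w * pol s v w.
Proof. by rewrite -!ev_dirder dirderM evD !evM. Qed.

Lemma polD v w r s : pol (r + s) v w = pol r v w + pol s v w.
Proof. by rewrite -!ev_dirder dirderD evD. Qed.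

Lemma pol_cst v w (c : K) : pol c%:MP v w = 0.
Proof. by rewrite /pol big1 // => i _; rewrite mderivC /ev meval0 mulr0. Qed.

Variables (X Y Z : {mpoly K[3]}) (u v w : 'rV[K]_3).
Hypothesis co : coords X Y Z u v w.

(** The polynomials with such an expansion form a subalgebra that contains the variables. *)
Lemma jet_expansion r : exists A B C,
  r = (ev r w)%:MP + (pol r v w)%:MP * Y + A * X + B * Y ^+ 2 + C * (Z - 1).
Proof.
have [[Xu Xv Xw] [Yu Yv Yw] [Zu Zv Zw]] := coords_at co.
have [[hX hY] hZ] := (coords_homog1 co, coords_homog2 co, coords_homog3 co).
have [c [d [A [B [C E]]]]] : exists (c d : K) A B C,
    r = c%:MP + d%:MP * Y + A * X + B * Y ^+ 2 + C * (Z - 1).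
  elim/mpoly_alg_ind: r => [c|i|p q|p q].
  - by exists c, 0, 0, 0, 0; rewrite mpolyC0; ring.
  - have hXi : ('X_i : {mpoly K[3]}) \is 1.-homog by rewrite dhomogX /= mdeg1.
    exists (ev 'X_i w), (ev 'X_i v), (ev 'X_i u)%:MP, 0, (ev 'X_i w)%:MP.
    by rewrite {1}(coords_line co hXi) -!mul_mpolyC; ring.
  - move=> [c [d [A [B [C ->]]]]] [c' [d' [A' [B' [C' ->]]]]].
    by exists (c + c'), (d + d'), (A + A'), (B + B'), (C + C'); rewrite !mpolyCD; ring.
  move=> [c [d [A [B [C ->]]]]] [c' [d' [A' [B' [C' ->]]]]].
  pose S := c'%:MP + d'%:MP * Y + A' * X + B' * Y ^+ 2 + C' * (Z - 1).
  exists (c * c'), (c * d' + d * c'), (A * S + (c%:MP + d%:MP * Y) * A'),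
    (B * S + (c%:MP + d%:MP * Y) * B' + d%:MP * d'%:MP), (C * S + (c%:MP + d%:MP * Y) * C').
  by rewrite /S !(mpolyCD, mpolyCM); ring.
have Z1 : ev (Z - 1) w = 0 by rewrite evB Zw /ev meval1 subrr.
have pZ1 : pol (Z - 1) v w = 0 by rewrite -mpolyC1 -mpolyCN polD pol_cst pol_line // Zv addr0.
have cE : ev r w = c.
  by rewrite E !evD !evM Z1 Xw Yw /ev !mevalC; ring.
have dE : pol r v w = d.
  have [pX pY] : pol X v w = 0 /\ pol Y v w = 1 by rewrite !pol_line.
  by rewrite E expr2 !polD !polM !pol_cst pZ1 Z1 pX pY !evM Xw Yw /ev !mevalC; ring.
by exists A, B, C; rewrite cE dE -E.
Qed.

(** Two independent combinations of XZ and Y^2 generate the same ideal as XZ and Y^2, which in the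
    chart Z = 1 is (X, Y^2), of colength two with basis 1, Y. *)
Lemma bitangent_contact (a b a' b' : K) : a * b' != a' * b ->
  intersection_mult (a *: (X * Z) + b *: Y ^+ 2) (a' *: (X * Z) + b' *: Y ^+ 2) w 2.
Proof.
move=> det; have [[Xu Xv Xw] [Yu Yv Yw] [Zu Zv Zw]] := coords_at co.
have [[hX hY] hZ] := (coords_homog1 co, coords_homog2 co, coords_homog3 co).
exists Z; split => //; exists (jet v w); split.
  move=> y; exists ((y ord0 ord0)%:MP + y ord0 ord_max *: Y) => //.
  apply/rowP => i; rewrite !mxE polD pol_cst pol_scale pol_line // Yv mulr1 add0r.
  rewrite evD evZ Yw mulr0 addr0 /ev mevalC.
  by case: ifP => [/eqP -> //|]; case: i => [[|[|i]] Hi] // _; congr (y _ _); apply: val_inj.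
move=> r _; split=> [j0|[s sw]].
  have rw0 : ev r w = 0 by have /rowP/(_ ord0) := j0; rewrite !mxE.
  have rv0 : pol r v w = 0 by have /rowP/(_ ord_max) := j0; rewrite !mxE.
  have [A [B [C E]]] := jet_expansion r; rewrite rw0 rv0 mpolyC0 mul0r !add0r in E.
  exists 1; first by rewrite /ev meval1 oner_eq0.
  pose e := (a * b' - a' * b)^-1.
  have d0 : a * b' - a' * b != 0 by rewrite subr_eq0.
  apply/in_ideal3; rewrite mul1r.
  exists (fun i => match val i with
    | 0%N => (e * b') *: A - (e * a') *: B
    | 1%N => (e * a) *: B - (e * b) *: A
    | _ => C - A * X end) => /=.
  have e1 : (e * (a * b' - a' * b))%:MP = 1 :> {mpoly K[3]} by rewrite mulVf // mpolyC1.
  rewrite E; transitivity ((e * (a * b' - a' * b))%:MP * (A * X * Z + B * Y ^+ 2) +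
      A * X * (1 - Z) + C * (Z - 1)); first by rewrite e1; ring.
  rewrite -!mul_mpolyC !(mpolyCM, mpolyCB); ring.
move=> /in_ideal3 [c].
set g := a *: (X * Z) + b *: Y ^+ 2; set h := a' *: (X * Z) + b' *: Y ^+ 2 => E.
have Z1 : ev (Z - 1) w = 0 by rewrite evB Zw /ev meval1 subrr.
have pZ1 : pol (Z - 1) v w = 0 by rewrite -mpolyC1 -mpolyCN polD pol_cst pol_line // Zv addr0.
have gw : ev g w = 0 by rewrite evD !evZ evM evX Xw Yw; ring.
have hw : ev h w = 0 by rewrite evD !evZ evM evX Xw Yw; ring.
have gvw : pol g v w = 0 by rewrite (pol_XZYY _ _ _ _ co) Xw Xv Yw; ring.
have hvw : pol h v w = 0 by rewrite (pol_XZYY _ _ _ _ co) Xw Xv Yw; ring.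
have rw0 : ev r w = 0.
  have := congr1 (fun q => ev q w) E; rewrite !evD !evM gw hw Z1 !mulr0 !addr0 => /eqP.
  by rewrite mulf_eq0 (negbTE sw) => /eqP.
have rv0 : pol r v w = 0.
  have := congr1 (fun q => pol q v w) E.
  rewrite !polD !polM gw hw Z1 gvw hvw pZ1 rw0 !mulr0 !addr0 add0r => /eqP.
  by rewrite mulf_eq0 (negbTE sw) => /eqP.
by apply/rowP => i; rewrite !mxE rw0 rv0; case: ifP.
Qed.

End Jets.

Section NormalPencils.
Variable K : numClosedFieldType.
Implicit Types (f g h l m : {mpoly K[3]}) (p : 'rV[K]_3).

Definition pencil2 g h (i : 'I_2) := if i == ord0 then g else h.

Lemma member_pencil2 g h (x : 'rV[K]_2) :
  member (pencil2 g h) x = x ord0 ord0 *: g + x ord0 ord_max *: h.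
Proof. by rewrite member2. Qed.

Definition pair2 (a b : K) : 'rV[K]_2 := \row_i (if i == ord0 then a else b).

Lemma member_pair2 g h a b : member (pencil2 g h) (pair2 a b) = a *: g + b *: h.
Proof. by rewrite member_pencil2 !mxE. Qed.

Lemma pencil2P g h : g \is 2.-homog -> h \is 2.-homog ->
  (forall a b : K, a *: g + b *: h = 0 -> a = 0 /\ b = 0) -> is_pencil (pencil2 g h).
Proof.
move=> hg hh ind; split=> [i|x]; first by rewrite /pencil2; case: ifP.
rewrite member_pencil2 => /ind [a0 b0]; apply/rowP => i; rewrite mxE.
by case: i => [[|[|i]] Hi] //; [rewrite -a0 | rewrite -b0]; congr (x _ _); apply: val_inj.
Qed.

Variables (X Y Z : {mpoly K[3]}) (u v w : 'rV[K]_3).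
Hypothesis co : coords X Y Z u v w.
Let hX := coords_homog1 co.
Let hY := coords_homog2 co.
Let hZ := coords_homog3 co.

(** Exchanges the two bitangency points. *)
Lemma coords_swap : coords Z Y X w v u.
Proof.
have C (a b c : 'rV[K]_3) : a + b + c = c + b + a by apply/rowP => i; rewrite !mxE; ring.
split => // [x|x y z|x y z|x y z]; rewrite C.
- exact: coordsK co x.
- exact: coordsE3 co _ _ _.
- exact: coordsE2 co _ _ _.
exact: coordsE1 co _ _ _.
Qed.

Lemma coords_ext p q : ev X p = ev X q -> ev Y p = ev Y q -> ev Z p = ev Z q -> p = q.
Proof. by move=> eX eY eZ; rewrite (coordsK co p) (coordsK co q) eX eY eZ. Qed.

Lemma smooth_XZYY (a b : K) : smooth_conic (a *: (X * Z) + b *: Y ^+ 2) <-> a != 0 /\ b != 0.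
Proof.
have [[Xu Xv Xw] [Yu Yv Yw] [Zu Zv Zw]] := coords_at co; have [u0 v0 w0] := frame_neq0 co.
have P x y := pol_XZYY a b x y co.
split=> [[hg sm]|[a0 b0]].
  split; apply/eqP => z0.
    have [x] := smooth_pol hg sm u0; rewrite P z0 Yu; apply/negP; rewrite negbK; apply/eqP; ring.
  have [x] := smooth_pol hg sm v0; rewrite P z0 Xv Zv; apply/negP; rewrite negbK; apply/eqP; ring.
have hg := XZYY_homog a b co.
split => //; apply: pol_smooth => //.
move=> x x0; apply: contrapT => /forallNP H.
have {}H y : pol (a *: (X * Z) + b *: Y ^+ 2) y x = 0 by have /negP := H y; rewrite negbK => /eqP.
case/negP: x0; apply/eqP/coords_ext; rewrite (ev0 hX, ev0 hY, ev0 hZ).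
- by have /eqP := H w; rewrite P Xw Yw Zw mul0r mul0r mulr0 addr0 add0r mulr1 mulf_eq0 (negbTE a0) => /eqP.
- have /eqP := H v; rewrite P Xv Yv Zv mul0r mulr0 addr0 mulr0 add0r mul1r !mulf_eq0 pnatr_eq0.
  by rewrite (negbTE b0) => /eqP.
by have /eqP := H u; rewrite P Xu Yu Zu mul0r mulr0 mulr0 !addr0 mul1r mulf_eq0 (negbTE a0) => /eqP.
Qed.

Definition bit_pencil := pencil2 (X * Z) (Y ^+ 2).

Lemma bit_member g : smooth_member bit_pencil g <->
  exists a b, [/\ a != 0, b != 0 & g = a *: (X * Z) + b *: Y ^+ 2].
Proof.
split=> [[sg [x gE]]|[a [b [a0 b0 ->]]]].
  rewrite member_pencil2 in gE; exists (x ord0 ord0), (x ord0 ord_max).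
  by rewrite gE in sg; have [] := (smooth_XZYY _ _).1 sg.
by split; [apply/smooth_XZYY | exists (pair2 a b); rewrite member_pair2].
Qed.

Lemma tangent_XZYY (a b : K) : tangent_form (a *: (X * Z) + b *: Y ^+ 2) w = a *: X.
Proof.
have [[Xu Xv Xw] [Yu Yv Yw] [Zu Zv Zw]] := coords_at co.
by apply: ev_eq => x; rewrite ev_tangent (pol_XZYY _ _ _ _ co) Xw Yw Zw evZ; ring.
Qed.

Lemma bit_tangent k : k != 0 -> common_tangent bit_pencil w (k *: X).
Proof.
move=> k0; have [X0 _ _] := coords_neq0 co; split.
  by split; rewrite ?rpredZ // scaler_eq0 negb_or k0.
move=> g /bit_member [a [b [a0 b0 ->]]]; rewrite tangent_XZYY.
by exists (k / a); rewrite ?mulf_neq0 ?invr_eq0 // scalerA divfK.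
Qed.

Lemma joining_Y k : k != 0 -> joining_line w u (k *: Y).
Proof.
move=> k0; have [_ Y0 _] := coords_neq0 co.
have [_ [Yu Yv Yw] _] := coords_at co.
by split; rewrite ?evZ ?Yw ?Yu ?mulr0 //; split; rewrite ?rpredZ // scaler_eq0 negb_or k0.
Qed.

Lemma same_proj_det (a b a' b' : K) g h : a' != 0 -> a * b' = a' * b -> a != 0 ->
  same_proj (a *: g + b *: h) (a' *: g + b' *: h).
Proof.
move=> a'0 det a0; exists (a / a'); first by rewrite mulf_neq0 // invr_eq0.
rewrite scalerDr !scalerA divfK //; congr (_ + _ *: _).
by rewrite mulrAC det mulrAC divff // mul1r.
Qed.

End NormalPencils.

Section Build.
Variable K : numClosedFieldType.
Implicit Types (f g h l m : {mpoly K[3]}) (p u v w : 'rV[K]_3).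

Lemma mpolyX_neq0 n (i : 'I_n) : ('X_i : {mpoly K[n]}) != 0.
Proof.
apply/eqP => /(congr1 (fun q => q.@[fun=> 1])); rewrite mevalXU meval0 => /eqP.
by rewrite oner_eq0.
Qed.

Lemma bit_pencil_swap (X Y Z : {mpoly K[3]}) : bit_pencil X Y Z = bit_pencil Z Y X.
Proof. by rewrite /bit_pencil mulrC. Qed.

Lemma bit_pencilP (X Y Z : {mpoly K[3]}) u v w : coords X Y Z u v w ->
  bitangent_pencil (bit_pencil X Y Z) w u.
Proof.
move=> co; have [[Xu Xv Xw] [Yu Yv Yw] [Zu Zv Zw]] := coords_at co.
have [[hX hY] hZ] := (coords_homog1 co, coords_homog2 co, coords_homog3 co).
have [u0 _ w0] := frame_neq0 co.
split.
- apply: pencil2P; [exact: (dhomogM hX hZ) | by rewrite expr2; exact: (dhomogM hY hY) |].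
  move=> a b E; split.
    have := congr1 (fun q => ev q (u + w)) E; rewrite evD !evZ evM evX !(evD1 _ _ hX, evD1 _ _ hY, evD1 _ _ hZ).
    by rewrite Xu Xw Yu Yw Zu Zw /ev !meval0 => <-; ring.
  have := congr1 (fun q => ev q v) E; rewrite evD !evZ evM evX.
  by rewrite Xv Yv Zv /ev !meval0 => <-; ring.
- exists ('X_ord0 * 'X_ord_max); first by rewrite mulf_neq0 // mpolyX_neq0.
  move=> x; rewrite mevalM !mevalXU mulf_eq0 negb_or => /andP [x0 x1].
  by rewrite member_pencil2; apply/(smooth_XZYY co).
- split => // -[k k0 /(congr1 (ev Z))]; rewrite evZ1 // Zw Zu mulr0 => /eqP.
  by rewrite oner_eq0.
move=> g h /(bit_member co) [a [b [a0 b0 ->]]] /(bit_member co) [a' [b' [a'0 b'0 ->]]] dist.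
have det : a * b' != a' * b by apply/eqP => det; apply: dist; apply: same_proj_det.
have tan (M : {mpoly K[3]}) : same_proj (a *: M) (a' *: M).
  by exists (a / a'); rewrite ?mulf_neq0 ?invr_eq0 // scalerA divfK.
split.
- move=> p p0; split=> [[]|]; rewrite !evD !evZ evM evX.
    move=> E1 E2; have d0 : a * b' - a' * b != 0 by rewrite subr_eq0.
    have /eqP : ev X p * ev Z p = 0.
      apply: (mulfI d0); rewrite mulr0.
      transitivity (b' * (a * (ev X p * ev Z p) + b * ev Y p ^+ 2) -
        b * (a' * (ev X p * ev Z p) + b' * ev Y p ^+ 2)); first by ring.
      by rewrite E1 E2 !mulr0 subrr.
    have Yp : ev Y p = 0.
      apply/eqP; have : (a * b' - a' * b) * ev Y p ^+ 2 == 0.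
        apply/eqP; transitivity (a * (a' * (ev X p * ev Z p) + b' * ev Y p ^+ 2) -
          a' * (a * (ev X p * ev Z p) + b * ev Y p ^+ 2)); first by ring.
        by rewrite E1 E2 !mulr0 subrr.
      by rewrite mulf_eq0 (negbTE d0) expf_eq0.
    rewrite mulf_eq0 => /orP [] /eqP E; [left | right].
      have pE : p = ev Z p *: w by rewrite {1}(coordsK co p) E Yp !scale0r !add0r.
      by exists (ev Z p) => //; apply: contraNneq p0 => k0; rewrite pE k0 scale0r.
    have pE : p = ev X p *: u by rewrite {1}(coordsK co p) E Yp !scale0r !addr0.
    by exists (ev X p) => //; apply: contraNneq p0 => k0; rewrite pE k0 scale0r.
  by case=> -[k k0 ->]; rewrite !evZ1 // ?Xw ?Yw ?Yu ?Zu; split; ring.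
- split; last exact: (bitangent_contact co).
  by rewrite !(tangent_XZYY co).
have co' := coords_swap co; rewrite ![X * Z]mulrC; split; last exact: (bitangent_contact co').
by rewrite !(tangent_XZYY co').
Qed.

Definition hyp_pencil (X Y Z : {mpoly K[3]}) := pencil2 (X ^+ 2) (X * Z + Y ^+ 2).

Section Hyper.
Variables (X Y Z : {mpoly K[3]}) (u v w : 'rV[K]_3).
Hypothesis co : coords X Y Z u v w.

Lemma pol_hyp (a b : K) x y : pol (a *: X ^+ 2 + b *: (X * Z + Y ^+ 2)) x y =
  2 * a * (ev X x * ev X y) +
  b * (ev X x * ev Z y + ev X y * ev Z x + 2 * (ev Y x * ev Y y)).
Proof.
have [[hX hY] hZ] := (coords_homog1 co, coords_homog2 co, coords_homog3 co).
by rewrite !expr2 polD !pol_scale polD !polM !pol_line //; ring.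
Qed.

Lemma hyp_homog (a b : K) : a *: X ^+ 2 + b *: (X * Z + Y ^+ 2) \is 2.-homog.
Proof.
have [[hX hY] hZ] := (coords_homog1 co, coords_homog2 co, coords_homog3 co).
rewrite !expr2; apply: rpredD; apply: rpredZ; first exact: (dhomogM hX hX).
by apply: rpredD; [exact: (dhomogM hX hZ) | exact: (dhomogM hY hY)].
Qed.

Lemma smooth_hyp (a b : K) : smooth_conic (a *: X ^+ 2 + b *: (X * Z + Y ^+ 2)) <-> b != 0.
Proof.
have [[Xu Xv Xw] [Yu Yv Yw] [Zu Zv Zw]] := coords_at co.
have [[hX hY] hZ] := (coords_homog1 co, coords_homog2 co, coords_homog3 co).
have [_ _ w0] := frame_neq0 co.
have hg := hyp_homog a b.
split=> [[_ sm]|b0].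
  apply/eqP => z0; have [x] := smooth_pol hg sm w0; rewrite pol_hyp z0 Xw.
  by apply/negP; rewrite negbK; apply/eqP; ring.
split => //; apply: pol_smooth => // x x0; apply: contrapT => /forallNP H.
have {}H y : pol (a *: X ^+ 2 + b *: (X * Z + Y ^+ 2)) y x = 0.
  by have /negP := H y; rewrite negbK => /eqP.
have Xx : ev X x = 0.
  have /eqP := H w; rewrite pol_hyp Xw Yw Zw !mul0r !mulr0 !addr0 !add0r mulr1.
  by rewrite mulf_eq0 (negbTE b0) => /eqP.
have Yx : ev Y x = 0.
  have /eqP := H v; rewrite pol_hyp Xv Yv Zv Xx !mul0r !mulr0 !add0r mul1r.
  by rewrite !mulf_eq0 (negbTE b0) pnatr_eq0 => /eqP.
have Zx : ev Z x = 0.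
  have /eqP := H u; rewrite pol_hyp Xu Yu Zu Xx !mul0r !mulr0 !addr0 !add0r mul1r.
  by rewrite !mulf_eq0 (negbTE b0) => /eqP.
by case/negP: x0; apply/eqP/(coords_ext co); rewrite (Xx, Yx, Zx) (ev0 hX, ev0 hY, ev0 hZ).
Qed.

Lemma hyp_member g : smooth_member (hyp_pencil X Y Z) g <->
  exists a b, b != 0 /\ g = a *: X ^+ 2 + b *: (X * Z + Y ^+ 2).
Proof.
split=> [[sg [x gE]]|[a [b [b0 ->]]]].
  rewrite member_pencil2 in gE; exists (x ord0 ord0), (x ord0 ord_max); split => //.
  by rewrite gE in sg; apply/(smooth_hyp (x ord0 ord0)).
by split; [apply/smooth_hyp | exists (pair2 a b); rewrite member_pair2].
Qed.

Lemma hyp_tangent k : k != 0 -> common_tangent (hyp_pencil X Y Z) w (k *: X).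
Proof.
have [[Xu Xv Xw] [Yu Yv Yw] [Zu Zv Zw]] := coords_at co.
move=> k0; have [X0 _ _] := coords_neq0 co; split.
  by split; rewrite ?rpredZ ?(coords_homog1 co) // scaler_eq0 negb_or k0.
move=> g /hyp_member [a [b [b0 ->]]].
have -> : tangent_form (a *: X ^+ 2 + b *: (X * Z + Y ^+ 2)) w = b *: X.
  by apply: ev_eq => x; rewrite ev_tangent pol_hyp Xw Yw Zw evZ; ring.
by exists (k / b); rewrite ?mulf_neq0 ?invr_eq0 // scalerA divfK.
Qed.

Lemma hyp_pencilP : hyperosculating_pencil (hyp_pencil X Y Z) w.
Proof.
have [[Xu Xv Xw] [Yu Yv Yw] [Zu Zv Zw]] := coords_at co.
have [[hX hY] hZ] := (coords_homog1 co, coords_homog2 co, coords_homog3 co).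
have [_ _ w0] := frame_neq0 co.
split => //.
- apply: pencil2P.
  + by have := hyp_homog 1 0; rewrite scale1r scale0r addr0.
  + by have := hyp_homog 0 1; rewrite scale1r scale0r add0r.
  move=> a b E.
  have a0 : a = 0.
    have := congr1 (fun q => ev q u) E; rewrite evD !evZ evD !evM.
    by rewrite Xu Yu Zu /ev !meval0 => <-; ring.
  split => //; have := congr1 (fun q => ev q v) E; rewrite a0 evD !evZ evD !evM.
  by rewrite Xv Yv Zv /ev !meval0 => <-; ring.
- exists 'X_ord_max; first by rewrite mpolyX_neq0.
  by move=> x; rewrite mevalXU => x1; rewrite member_pencil2; apply/smooth_hyp.
move=> p p0; split=> [H|[k k0 ->] i].
  have := H ord0; rewrite /hyp_pencil /pencil2 /= evX => /eqP; rewrite expf_eq0 /= => /eqP Xp.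
  have := H ord_max; rewrite /hyp_pencil /pencil2 /= evD evM evX Xp mul0r add0r => /eqP.
  rewrite expf_eq0 /= => /eqP Yp.
  have pE : p = ev Z p *: w by rewrite {1}(coordsK co p) Xp Yp !scale0r !add0r.
  by exists (ev Z p) => //; apply: contraNneq p0 => k0; rewrite pE k0 scale0r.
rewrite /hyp_pencil /pencil2; case: ifP => _.
  by rewrite evX evZ1 // Xw mulr0 expr0n.
by rewrite evD evM evX !evZ1 // Xw Yw mulr0 mul0r expr0n addr0.
Qed.

End Hyper.

End Build.

(** * The classification *)

Section Classification.
Variable K : numClosedFieldType.
Implicit Types (f g h l m : {mpoly K[3]}) (gs : seq {mpoly K[3]}) (p u v w x y : 'rV[K]_3).

Lemma same_proj_common g h m : same_proj g m -> same_proj h m -> same_proj g h.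
Proof.
move=> [a a0 ->] [b b0 ->]; exists (a / b); first by rewrite mulf_neq0 // invr_eq0.
by rewrite scalerA divfK.
Qed.

(** Distinct components cannot have the same equation, so each coordinate line occurs at most
    once. *)
Lemma filter_same_proj m (P : pred {mpoly K[3]}) gs : pairwise_distinct gs ->
  (forall g, P g -> same_proj g m) ->
  filter P gs = [::] \/ exists2 l, same_proj l m & filter P gs = [:: l].
Proof.
move=> /(@distinct_filter _ P) pd Pm; have sub g : g \in filter P gs -> same_proj g m.
  by rewrite mem_filter => /andP [/Pm].
case: (filter P gs) pd sub => [|l [|h r]] pd sub; first by left.
  by right; exists l => //; apply: sub; rewrite mem_head.
case: (pd 0%N 1%N isT); apply: (@same_proj_common _ _ m); apply: sub.
  exact: mem_head.
by rewrite !in_cons eqxx orbT.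
Qed.

Lemma torus_types (X Y Z : {mpoly K[3]}) u v w c gs g0 l0 : coords X Y Z u v w ->
  c != 0 -> pairwise_distinct gs -> g0 \in gs -> smooth_conic g0 ->
  l0 \in gs -> same_proj l0 X ->
  (forall g, g \in gs -> [\/ same_proj g X, same_proj g Y, same_proj g Z |
     exists a b, [/\ a != 0, b != 0 & g = a *: (X * Z) + b *: Y ^+ 2]]) ->
  let f := c *: \prod_(g <- gs) g in
  type_CL2 f \/ type_CL3 f \/ type_CL4 f \/ type_CL5 f.
Proof.
move=> co c0 pd g0gs sg0 l0gs l0X H f.
pose PX g := `[<same_proj g X>]; pose PY g := `[<same_proj g Y>]; pose PZ g := `[<same_proj g Z>].
pose lX := filter PX gs; pose lY := filter (fun g => ~~ PX g && PY g) gs.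
pose lZ := filter (fun g => ~~ PX g && ~~ PY g && PZ g) gs.
pose cs := filter (fun g => ~~ PX g && ~~ PY g && ~~ PZ g) gs.
have fE : f = c *: (\prod_(g <- lX) g * (\prod_(g <- lY) g *
    (\prod_(g <- lZ) g * \prod_(g <- cs) g))).
  by rewrite !big_filter /f (bigID PX) /= [X in _ * X](bigID PY) /= [X in _ * (_ * X)](bigID PZ).
have bit := bit_pencilP co.
have [[hX hY] hZ] := (coords_homog1 co, coords_homog2 co, coords_homog3 co).
have [X0 Y0 Z0] := coords_neq0 co.
have cP : conics_of_pencil (bit_pencil X Y Z) cs.
  split.
  - suff : g0 \in cs by case: (cs).
    have nl m : m \is 1.-homog -> m != 0 -> ~~ `[<same_proj g0 m>].
      move=> hm m0; apply/asboolPn => /same_proj_sym; apply: line_not_conic sg0.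
      by split.
    by rewrite mem_filter /PX /PY /PZ !nl.
  - move=> g; rewrite mem_filter => /andP [/andP [/andP [/asboolPn gX /asboolPn gY] /asboolPn gZ] gin].
    by apply/(bit_member co); case: (H g gin).
  exact: distinct_filter.
have tX l : same_proj l X -> common_tangent (bit_pencil X Y Z) w l.
  by move=> [k k0 ->]; exact: (bit_tangent co k0).
have tZ l : same_proj l Z -> common_tangent (bit_pencil X Y Z) u l.
  by move=> [k k0 ->]; rewrite bit_pencil_swap; exact: (bit_tangent (coords_swap co) k0).
have jY l : same_proj l Y -> joining_line w u l.
  by move=> [k k0 ->]; exact: (joining_Y co k0).
have [lX0|[l lX_ lXE]] : lX = [::] \/ exists2 l, same_proj l X & lX = [:: l].
- by apply: filter_same_proj => // g /asboolP.
- have : l0 \in lX by rewrite mem_filter l0gs andbT; apply/asboolP.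
  by rewrite lX0.
have [lYE|[m lY_ lYE]] : lY = [::] \/ exists2 l, same_proj l Y & lY = [:: l].
- by apply: filter_same_proj => // g /andP [_ /asboolP].
- have [lZE|[l' lZ_ lZE]] : lZ = [::] \/ exists2 l, same_proj l Z & lZ = [:: l].
  + by apply: filter_same_proj => // g /andP [_ /asboolP].
  + left; exists (bit_pencil X Y Z), w, u, cs, l; split => //; first exact: tX.
    exists c => //; rewrite fE lXE lYE lZE !big_cons !big_nil; congr (_ *: _); ring.
  right; left; exists (bit_pencil X Y Z), w, u, cs, l, l'; split => //; [exact: tX | exact: tZ |].
  exists c => //; rewrite fE lXE lYE lZE !big_cons !big_nil; congr (_ *: _); ring.
have [lZE|[l' lZ_ lZE]] : lZ = [::] \/ exists2 l, same_proj l Z & lZ = [:: l].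
- by apply: filter_same_proj => // g /andP [_ /asboolP].
- right; right; left; exists (bit_pencil X Y Z), w, u, cs, l, m; split => //; [exact: tX | exact: jY |].
  exists c => //; rewrite fE lXE lYE lZE !big_cons !big_nil; congr (_ *: _); ring.
right; right; right; exists (bit_pencil X Y Z), w, u, cs, l, l', m; split => //.
split; [exact: tX | exact: tZ | exact: jY |].
exists c => //; rewrite fE lXE lYE lZE !big_cons !big_nil; congr (_ *: _); ring.
Qed.

Lemma nilpotent_types (X Y Z : {mpoly K[3]}) u v w c gs g0 : coords X Y Z u v w ->
  c != 0 -> pairwise_distinct gs -> g0 \in gs -> smooth_conic g0 ->
  (forall g, g \in gs -> same_proj g X \/
     exists a b, b != 0 /\ g = a *: X ^+ 2 + b *: (X * Z + Y ^+ 2)) ->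
  let f := c *: \prod_(g <- gs) g in type_C1 f \/ type_CL1 f.
Proof.
move=> co c0 pd g0gs sg0 H f.
pose PX g := `[<same_proj g X>]; pose lX := filter PX gs; pose cs := filter (predC PX) gs.
have fE : f = c *: (\prod_(g <- lX) g * \prod_(g <- cs) g).
  by rewrite !big_filter /f (bigID PX).
have cP : conics_of_pencil (hyp_pencil X Y Z) cs.
  split.
  - suff : g0 \in cs by case: (cs).
    rewrite mem_filter g0gs andbT; apply/asboolPn => /same_proj_sym; apply: line_not_conic sg0.
    by have [X0 _ _] := coords_neq0 co; split => //; apply: coords_homog1 co.
  - move=> g; rewrite mem_filter => /andP [/asboolPn gX gin].
    by apply/(hyp_member co); case: (H g gin).
  exact: distinct_filter.
have [lXE|[l [k k0 lE] lXE]] : lX = [::] \/ exists2 l, same_proj l X & lX = [:: l].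
- by apply: filter_same_proj => // g /asboolP.
- left; exists (hyp_pencil X Y Z), w, cs; split => //; first exact: (hyp_pencilP co).
  by exists c => //; rewrite fE lXE big_nil mul1r.
right; exists (hyp_pencil X Y Z), w, cs, l; split => //; first exact: (hyp_pencilP co).
  by rewrite lE; exact: (hyp_tangent co k0).
by exists c => //; rewrite fE lXE !big_cons big_nil mulr1.
Qed.

(** B is the linear map of the field rho minus the multiple of the Euler field that makes it kill
    g0. *)
Lemma conic_case e c gs g0 : (4 <= e)%N -> c != 0 ->
  c *: \prod_(g <- gs) g \is e.+1.-homog -> (forall g, g \in gs -> component g) ->
  pairwise_distinct gs -> g0 \in gs -> smooth_conic g0 ->
  let f := c *: \prod_(g <- gs) g in total_tjurina f (e * (e - 1) + 1) ->
  type_C1 f \/ type_CL1 f \/ type_CL2 f \/ type_CL3 f \/ type_CL4 f \/ type_CL5 f.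
Proof.
move=> e4 c0 hf cgs pd g0gs sg0 f tj.
have hL : \prod_(g <- gs) g \is e.+1.-homog.
  by have := dhomogZ c^-1 hf; rewrite scalerA mulVf // scale1r.
have rg : rigid gs by apply: (rigid_with_conic (d := e.+1) (g := g0)).
have [rho [hr [i ri] rf] rv] := linear_syz_of_tjurina e4 c0 hf cgs pd rg tj.
have {}rf : act rho f = 0 := rf.
have eig := component_eigen c0 cgs pd hr rf.
have [mu mu0] := eig g0 g0gs.
pose B x := at_point rho x - (mu / 2) *: x.
have linB (k : K) x y : B (k *: x + y) = k *: B x + B y.
  by rewrite /B at_point_linear // ; apply/rowP => j; rewrite !mxE; ring.
have polB g d x : g \is d.-homog -> pol g (B x) x = pol g (at_point rho x) x - (mu / 2) * (d%:R * ev g x).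
  move=> hg; rewrite /B addrC -scaleNr pol_linl mulNr addrC; congr (_ - _ * _).
  by have := congr1 (fun q => ev q x) (act_euler hg); rewrite ev_act evZ => <-; congr pol;
    apply/rowP => j; rewrite mxE /ev mevalXU.
have [hg0 _] := sg0.
have H0 x : pol g0 (B x) x = 0.
  by rewrite (polB _ _ _ hg0) -ev_act mu0 evZ; field.
have eigB g : g \in gs -> exists nu, forall x, pol g (B x) x = nu * ev g x.
  move=> gin; have [nu nuE] := eig g gin; have [d hg] := component_homog (cgs g gin).
  by exists (nu - mu / 2 * d.+1%:R) => x; rewrite (polB _ _ _ hg) -ev_act nuE evZ mulrBl !mulrA.
have fx (k : K) x : at_point rho x = k *: x -> ev f x != 0 -> k = 0.
  move=> rx fx0; have := congr1 (fun q => ev q x) rf.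
  rewrite ev_act rx -[k *: x]addr0 pol_linl -(scale0r 0) polZl mul0r addr0 /ev meval0 -/(ev _ _).
  have -> : pol f x x = e.+1%:R * ev f x.
    have := congr1 (fun q => ev q x) (act_euler hf); rewrite ev_act evZ => <-; congr pol.
    by apply/rowP => j; rewrite mxE /ev mevalXU.
  move/eqP; rewrite !mulf_eq0 pnatr_eq0 (negbTE fx0) !orbF => /eqP //.
have Bn : exists x, B x != 0.
  apply: contrapT => /forallNP Bz.
  have {}Bz x : at_point rho x = (mu / 2) *: x.
    by have /negP := Bz x; rewrite negbK subr_eq0 => /eqP.
  have f0 : f != 0 by rewrite scaler_eq0 negb_or c0 components_prod_neq0.
  have [_ [x fx0]] := generic_mpoly f0.
  have k0 := fx _ _ (Bz x) fx0; case/negP: ri; apply/eqP/ev_eq => y.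
  by have /rowP/(_ i) := Bz y; rewrite k0 scale0r !mxE => ->; rewrite /ev meval0.
have [X [Y [Z [u [v [w [co [[a a0 [Bu Bv Bw]]|[b b0 [Bu Bv Bw]]]]]]]]]] := skew_normal_form linB sg0 H0 Bn.
- have cls g : g \in gs -> [\/ same_proj g X, same_proj g Y, same_proj g Z |
     exists a b, [/\ a != 0, b != 0 & g = a *: (X * Z) + b *: Y ^+ 2]].
    move=> gin; have [nu nuE] := eigB g gin; case: (cgs g gin) => [lg|sg].
      have [_ hg] := lg; have nuE' x : ev g (B x) = nu * ev g x by rewrite -nuE pol_line.
      have [k k0 [E|E|E]] := torus_line co a0 Bu Bv Bw lg nuE'.
      - by apply: Or41; exists k.
      - by apply: Or42; exists k.
      by apply: Or43; exists k.
    by apply: Or44; apply: (torus_conic linB co a0 Bu Bv Bw sg nuE).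
  right; right.
  have [[l0 l0gs l0X]|nX] := pselect (exists2 l, l \in gs & same_proj l X).
    exact: torus_types co c0 pd g0gs sg0 l0gs l0X cls.
  have [[l0 l0gs l0Z]|nZ] := pselect (exists2 l, l \in gs & same_proj l Z).
    apply: torus_types (coords_swap co) c0 pd g0gs sg0 l0gs l0Z _ => g gin.
    case: (cls g gin) => [gX|gY|gZ|[a1 [b1 [a10 b10 ->]]]]; [exact: Or43 | exact: Or42 | exact: Or41 |].
    by apply: Or44; exists a1, b1; rewrite [Z * X]mulrC.
  (* the singular point of the field is off the curve *)
  have [[Xu Xv Xw] [Yu Yv Yw] [Zu Zv Zw]] := coords_at co.
  have fv : ev f v != 0.
    rewrite evZ mulf_neq0 // /ev rmorph_prod prodf_seq_neq0; apply/allP => g gin; apply/implyP => _.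
    rewrite -/(ev g v); case: (cls g gin) => [gX|[k k0 ->]|gZ|[a1 [b1 [a10 b10 ->]]]].
    - by case: nX; exists g.
    - by rewrite /= -/(ev _ v) evZ Yv mulr1.
    - by case: nZ; exists g.
    by rewrite /= -/(ev _ v) evD !evZ evM evX Xv Yv mul0r mulr0 add0r expr1n mulr1.
  have rhov : at_point rho v = (mu / 2) *: v by apply/eqP; rewrite -subr_eq0; apply/eqP.
  have k0 := fx _ _ rhov fv; rewrite k0 scale0r in rhov.
  case/negP: fv; apply/eqP/rv => j; have /rowP/(_ j) := rhov; by rewrite !mxE.
have cls g : g \in gs -> same_proj g X \/
     exists a b, b != 0 /\ g = a *: X ^+ 2 + b *: (X * Z + Y ^+ 2).
  move=> gin; have [nu nuE] := eigB g gin; case: (cgs g gin) => [lg|sg].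
    have [_ hg] := lg; have nuE' x : ev g (B x) = nu * ev g x by rewrite -nuE pol_line.
    by have [k k0 E] := nilpotent_line co b0 Bu Bv Bw lg nuE'; left; exists k.
  by right; apply: (nilpotent_conic linB co b0 Bu Bv Bw sg nuE).
by case: (nilpotent_types co c0 pd g0gs sg0 cls) => t; [left | right; left].
Qed.

Lemma classification d f : (5 <= d)%N -> conic_line_arrangement d f ->
  total_tjurina f ((d - 1) * (d - 2) + 1)%N <->
  (type_L d f \/ type_C1 f \/ type_CL1 f \/ type_CL2 f \/ type_CL3 f \/
   type_CL4 f \/ type_CL5 f).
Proof.
case: d => [//|e] e4 [f0 hf sf irr].
have -> : ((e.+1 - 1) * (e.+1 - 2) + 1 = e * (e - 1) + 1)%N by rewrite subn1 subSS.
split=> [tj|]; last first.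
  case=> [tL|[t|[t|H]]].
  - exact: type_L_tjurina.
  - by apply: osculating_types_tjurina => //; left.
  - by apply: osculating_types_tjurina => //; right.
  exact: bitangent_types_tjurina.
have [c [gs [c0 fE cgs]]] := components_of f0 hf irr.
rewrite fE in f0 hf sf tj *; have pd := squarefree_distinct sf cgs.
have hL : \prod_(g <- gs) g \is e.+1.-homog.
  by have := dhomogZ c^-1 hf; rewrite scalerA mulVf // scale1r.
have [[g0 [g0gs sg0]]|nc] := pselect (exists g, g \in gs /\ smooth_conic g).
  by right; apply: conic_case sg0 tj.
have lines g : g \in gs -> is_line g.
  by move=> gin; case: (cgs g gin) => // sg; case: nc; exists g.
have P0 : \prod_(g <- gs) g != 0 by apply: components_prod_neq0.
have sz : size gs = e.+1 by apply: homog_degree P0 (lines_homog lines) hL.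
left; case: (arrangement_rigid e4 cgs pd hL) => [rg|[_ [v v0 gv]]].
  have [rho [hr ri rf] _] := linear_syz_of_tjurina e4 c0 hf cgs pd rg tj.
  have conc v : (forall g, g \in gs -> ev g v = 0) -> v = 0.
    case: rg => [[g [h [gin _ sg _ _]]]|[g [_ [_ [[sg gin] _ _ _]]]]|[_ H]]; last exact: H.
      by case: nc; exists g.
    by case: nc; exists g.
  by rewrite -sz; apply: lines_type_L rf => //; rewrite sz.
case: (not_tjurina_of_const e4 c0 hf cgs v0 _ tj).
rewrite dirderZ; apply/eqP; rewrite scaler_eq0 (negbTE c0) /=; apply/eqP.
elim: (gs) lines gv => [|g r IH] lin gv.
  by rewrite big_nil /dirder big1 // => i _; rewrite -mpolyC1 mderivC scaler0.
rewrite big_cons dirderM IH => [|h hr|h hr]; first last.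
- by apply: gv; rewrite in_cons hr orbT.
- by apply: lin; rewrite in_cons hr orbT.
have [_ hg] := lin g (mem_head _ _).
by rewrite dirder_line // gv ?mem_head // mpolyC0 mul0r mulr0 addr0.
Qed.

End Classification.

From mathcomp Require Import reals complex.

Theorem theorem1 (R : realType) (d : nat) (f : {mpoly R[i][3]})
    (hd : (5 <= d)%N) (hf : conic_line_arrangement d f) :
  total_tjurina f ((d - 1) * (d - 2) + 1)%N <->
  (type_L d f \/ type_C1 f \/ type_CL1 f \/ type_CL2 f \/ type_CL3 f \/
   type_CL4 f \/ type_CL5 f).
Proof. exact: classification hd hf. Qed.
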